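(* Let $n\ge2$ and let $F:\mathbb{R}^n\times\mathbb{R}^n\to\mathbb{R}^3$ be $F(\xi,\eta)=(|\xi|,|\eta|,|\xi+\eta|)$. Let $\tau=(\tau_1,\tau_2,\tau_3)$ specify the side lengths of a nondegenerate triangle in the plane and let $\operatorname{area}(\tau)$ denote the area of that triangle. Then the Leray measure of $F^{-1}(\tau)$ is $$\operatorname{vol}F^{-1}(\tau)=\operatorname{vol}(S^{n-1})\,\operatorname{vol}(S^{n-2})\,\tau_1\tau_2\tau_3\,(2\operatorname{area}(\tau))^{n-3}.$$
   Context: $\operatorname{vol}(S^{d})$ is the standard $d$-dimensional volume of the unit sphere in $\mathbb{R}^{d+1}$ (so $\operatorname{vol}(S^0)=2$). Leray measure: if $F:\mathbb{R}^m\to\mathbb{R}^d$ is smooth near $F^{-1}(y)$ and $dF$ has full rank at every point of $F^{-1}(y)$, the Leray density on $F^{-1}(y)$ is $d_F=\frac{|dx_1\wedge\cdots\wedge dx_m|}{|dF_1\wedge\cdots\wedge dF_d|}$; that is, if $(z,z')$ are local coordinates on $\mathbb{R}^m$ with $z$ restricting to coordinates on $F^{-1}(y)$, then $d_F=|\det\partial x/\partial(z,z')|\,|\det\partial F/\partial z'|^{-1}dz$. Equivalently, $\int_{F^{-1}(y)}f\,d_F=\int_{\mathbb{R}^m}f(x)\,\delta(F(x)-y)\,dx$ for continuous $f$. The Leray measure is $\operatorname{vol}F^{-1}(y)=\int_{F^{-1}(y)}d_F$. *)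

(* Defs.v *)
From HB Require Import structures.
From mathcomp Require Import all_boot all_order all_algebra.
From mathcomp Require Import all_classical all_reals all_analysis.

Set Implicit Arguments.
Unset Strict Implicit.
Unset Printing Implicit Defensive.

Import Order.TTheory GRing.Theory Num.Theory.
Import numFieldTopology.Exports numFieldNormedType.Exports.

Local Open Scope classical_set_scope.
Local Open Scope ring_scope.

(* Points of R^n are row vectors 'rV[R]_n. *)

(* The library's norm on 'rV[R]_n is the sup norm, hence this definition. *)
Definition enorm (R : realType) (n : nat) (v : 'rV[R]_n) : R :=
  Num.sqrt (\sum_(i < n) v ord0 i ^+ 2).

(* Borel sigma-algebra of R^n, generated by the coordinate functions, as the
   library does for n.-tuple. *)
Section measurable_rV.
Context {R : realType} {n : nat}.

Definition rV_coord (i : 'I_n) (v : 'rV[R]_n) : measurableTypeR R := v ord0 i.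

Let rV_set0 : g_sigma_preimage rV_coord set0.
Proof. exact: sigma_algebra0. Qed.

Let rV_setC A : g_sigma_preimage rV_coord A -> g_sigma_preimage rV_coord (~` A).
Proof. exact: sigma_algebraC. Qed.

Let rV_bigcup (F : (set 'rV[R]_n)^nat) :
  (forall i, g_sigma_preimage rV_coord (F i)) ->
  g_sigma_preimage rV_coord (\bigcup_i (F i)).
Proof. exact: sigma_algebra_bigcup. Qed.

HB.instance Definition _ := @isMeasurable.Build default_measure_display
  'rV[R]_n (g_sigma_preimage rV_coord) rV_set0 rV_setC rV_bigcup.

End measurable_rV.

Section measurable_rV_lemmas.
Context {R : realType}.

Lemma measurable_rV_coord n (i : 'I_n) :
  measurable_fun [set: 'rV[R]_n] (@rV_coord R n i).
Proof.
move=> _ A mA; rewrite setTI; apply: sub_sigma_algebra.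
case: n i => [[] []//|n i].
rewrite -bigcup_mkord_ord; exists i; first exact: ltn_ord.
by exists A => //; rewrite inord_val setTI.
Qed.

Lemma measurable_fun_rVP d (T : measurableType d) n (f : T -> 'rV[R]_n) :
  (forall i, measurable_fun [set: T] (rV_coord i \o f)) ->
  measurable_fun [set: T] f.
Proof.
move=> mf _ A mA; rewrite setTI.
suff : g_sigma_preimage (fun i => rV_coord i \o f) `<=` measurable.
  rewrite g_sigma_preimage_comp; apply.
  by exists A => //; rewrite setTI.
apply: smallest_sub; first exact: sigma_algebra_measurable.
case: n => [|n] in f mf {A mA} *; first by rewrite big_ord0.
rewrite -bigcup_mkord_ord; apply: bigcup_sub => i Ii.
by move=> A [B mB <-]; exact: mf.
Qed.

End measurable_rV_lemmas.

Section lebesgue_rV.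
Context {R : realType}.

Definition rV_cons n (p : measurableTypeR R * 'rV[R]_n) : 'rV[R]_n.+1 :=
  row_mx (const_mx p.1 : 'rV_1) p.2.

Lemma rV_cons0 n (p : measurableTypeR R * 'rV[R]_n) :
  rV_cons p ord0 ord0 = p.1.
Proof.
have -> : (ord0 : 'I_n.+1) = lshift n (ord0 : 'I_1) by exact/val_inj.
by rewrite (row_mxEl (const_mx p.1 : 'rV_1) p.2) mxE.
Qed.

Lemma rV_consS n (p : measurableTypeR R * 'rV[R]_n) i :
  rV_cons p ord0 (lift ord0 i) = p.2 ord0 i.
Proof.
have -> : lift ord0 i = rshift 1 i :> 'I_n.+1 by exact/val_inj.
exact: (row_mxEr (const_mx p.1 : 'rV_1) p.2).
Qed.

Lemma measurable_rV_cons n :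
  measurable_fun [set: measurableTypeR R * 'rV[R]_n] (@rV_cons n).
Proof.
apply: measurable_fun_rVP => i; case: (unliftP ord0 i) => [j|] ->.
  rewrite (_ : _ \o _ = rV_coord j \o snd).
    by apply: measurableT_comp; [exact: measurable_rV_coord|exact: measurable_snd].
  by apply/funext => p; rewrite /= /rV_coord rV_consS.
rewrite (_ : _ \o _ = fst); first exact: measurable_fst.
by apply/funext => p; rewrite /= /rV_coord rV_cons0.
Qed.

Definition rV_uncons n (v : 'rV[R]_n.+1) : measurableTypeR R * 'rV[R]_n :=
  (rV_coord ord0 v, rsubmx (v : 'rV_(1 + n))).

Lemma rV_consK n : cancel (@rV_cons n) (@rV_uncons n).
Proof.
by move=> [x v]; rewrite /rV_uncons /rV_coord rV_cons0 /rV_cons row_mxKr.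
Qed.

Lemma rV_unconsK n : cancel (@rV_uncons n) (@rV_cons n).
Proof.
move=> v; apply/rowP => i; case: (unliftP ord0 i) => [j|] ->.
  by rewrite rV_consS mxE; congr (v _ _); exact/val_inj.
by rewrite rV_cons0.
Qed.

Lemma measurable_rV_uncons n : measurable_fun setT (@rV_uncons n).
Proof.
apply/measurable_fun_pairP; split; first exact: measurable_rV_coord.
apply: measurable_fun_rVP => i.
rewrite (_ : _ \o _ = rV_coord (rshift 1 i : 'I_n.+1)).
  exact: measurable_rV_coord.
by apply/funext => v; rewrite /= /rV_coord mxE.
Qed.

Section step.
Variables (n : nat) (m : {sigma_finite_measure set 'rV[R]_n -> \bar R}).

Definition lebesgue_rV_step : set 'rV[R]_n.+1 -> \bar R :=
  pushforward (@lebesgue_measure R \x m)%E (@rV_cons n).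

HB.instance Definition _ := Measure.copy lebesgue_rV_step
  (measure_function_pushforward__canonical__measure_function_Measure
    ((@lebesgue_measure R \x m)%E : {measure set (measurableTypeR R * 'rV[R]_n)%type -> \bar R})
    (@measurable_rV_cons n)).

Let sigma_finite_step : sigma_finite setT lebesgue_rV_step.
Proof.
have /sigma_finiteP[F [FT ndF Foo]] := sigma_finiteT (@lebesgue_measure R).
have /sigma_finiteP[G [GT ndG Goo]] := sigma_finiteT m.
exists (fun k => @rV_uncons n @^-1` (F k `*` G k)).
  rewrite -preimage_bigcup [X in _ @^-1` X](_ : _ = setT) ?preimage_setT//.
  apply/seteqP; split => // -[x y] _.
  have [i _ Fx] : (\bigcup_i F i) x by rewrite -FT.
  have [j _ Gy] : (\bigcup_j G j) y by rewrite -GT.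
  exists (maxn i j) => //; split.
    by move: x Fx; exact/subsetPset/ndF/leq_maxl.
  by move: y Gy; exact/subsetPset/ndG/leq_maxr.
move=> k; have [mFk Fkoo] := Foo k; have [mGk Gkoo] := Goo k; split.
  rewrite -[X in measurable X]setTI; apply: measurable_rV_uncons => //.
  exact: measurableX.
rewrite /lebesgue_rV_step /pushforward -comp_preimage (_ : _ \o _ = id).
  by rewrite preimage_id product_measure1E// lte_mul_pinfty// ge0_fin_numE.
by apply/funext => p; exact: rV_consK.
Qed.

HB.instance Definition _ := Measure_isSigmaFinite.Build _ _ _ lebesgue_rV_step
  sigma_finite_step.

End step.

Fixpoint lebesgue_rV (n : nat) : {sigma_finite_measure set 'rV[R]_n -> \bar R} :=
  if n is n'.+1 then lebesgue_rV_step (lebesgue_rV n') else \d_(0 : 'rV[R]_0).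

Lemma lebesgue_rV_box n (A : 'I_n -> set (measurableTypeR R)) :
  (forall i, measurable (A i)) ->
  lebesgue_rV n [set v | forall i, A i (v ord0 i)] =
  (\prod_(i < n) lebesgue_measure (A i))%E.
Proof.
elim: n A => [|n IHn] A mA /=.
  rewrite big_ord0 -[RHS](diracT _ (0 : 'rV[R]_0)); congr (_ _).
  by apply/seteqP; split => // v _ [].
rewrite big_ord_recl -IHn//.
pose B := [set v : 'rV[R]_n | forall i, A (lift ord0 i) (v ord0 i)].
have mB : measurable B.
  have -> : B = \bigcap_(i in [set: 'I_n]) (rV_coord i @^-1` A (lift ord0 i)).
    by apply/seteqP; split => v /= vA i; [move=> _|]; exact: vA.
  apply: fin_bigcap_measurable => // i _.
  by rewrite -[X in measurable X]setTI; exact: measurable_rV_coord.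
rewrite -[RHS](product_measure1E _ _ (mA ord0) mB) /lebesgue_rV_step /pushforward.
congr (_ _); apply/seteqP; split => p /= pA.
  split => /= [|i]; first by rewrite -(rV_cons0 p); exact: pA.
  by rewrite -(rV_consS p); exact: pA.
move=> i; case: (unliftP ord0 i) => [j|] ->; first by rewrite rV_consS; exact: pA.2.
by rewrite rV_cons0; exact: pA.1.
Qed.

End lebesgue_rV.

(* [jacobian f x], also written 'J f x, acts on row vectors from the right: the
   entry (i, j) is the partial derivative of f_j with respect to x_i. *)
Definition C1_on (R : realType) (m d : nat) (W : set 'rV[R]_m)
    (f : 'rV[R]_m -> 'rV[R]_d) : Prop :=
  open W /\
  forall x, W x -> differentiable f x /\ {for x, continuous (jacobian f)}.

(* dF has full rank at every point of F^-1(y). *)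
Definition regular_value (R : realType) (m d : nat)
    (F : 'rV[R]_m -> 'rV[R]_d) (y : 'rV[R]_d) : Prop :=
  (exists2 V : set 'rV[R]_m, C1_on V F & F @^-1` [set y] `<=` V) /\
  forall x, F x = y -> \rank (jacobian F x) = d.

(* Local coordinates on R^m: psi maps coordinates in W to points of R^m. *)
Definition local_coordinates (R : realType) (m n : nat)
    (W : set 'rV[R]_n) (psi : 'rV[R]_n -> 'rV[R]_m) : Prop :=
  [/\ C1_on W psi, {in W &, injective psi} &
      forall w, W w -> row_free (jacobian psi w)].

(* The coordinates (z, z'), with z in R^k and z' in R^d, are such that z
   restricts to coordinates on F^-1(y): in them F^-1(y) is the graph z' = s z
   over the open set U, along which dF/dz' is invertible. *)
Definition leray_coordinates (R : realType) (m d k : nat)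
    (F : 'rV[R]_m -> 'rV[R]_d) (y : 'rV[R]_d)
    (W : set 'rV[R]_(k + d)) (psi : 'rV[R]_(k + d) -> 'rV[R]_m)
    (U : set 'rV[R]_k) (s : 'rV[R]_k -> 'rV[R]_d) : Prop :=
  [/\ local_coordinates W psi,
      open U,
      W `&` [set w | F (psi w) = y] = [set row_mx z (s z) | z in U] &
      forall z, U z ->
        dsubmx (jacobian (F \o psi) (row_mx z (s z))) \in unitmx].

(* |det dx/d(z, z')| |det dF/dz'|^-1 at the point of coordinates w = (z, z');
   dsubmx keeps the rows of the derivatives with respect to z'. *)
Definition leray_density (R : realType) (m d k : nat) (e : (k + d = m)%N)
    (F : 'rV[R]_m -> 'rV[R]_d) (psi : 'rV[R]_(k + d) -> 'rV[R]_m)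
    (w : 'rV[R]_(k + d)) : R :=
  `|\det (castmx (e, erefl m) (jacobian psi w))| *
  `|\det (dsubmx (jacobian (F \o psi) w))|^-1.

(* mu is the Leray measure of F^-1(y), seen as a measure on R^m carried by
   F^-1(y): in all local coordinates as above it is leray_density dz. *)
Definition is_leray_measure (R : realType) (m d : nat)
    (F : 'rV[R]_m -> 'rV[R]_d) (y : 'rV[R]_d)
    (mu : {measure set 'rV[R]_m -> \bar R}) : Prop :=
  [/\ regular_value F y,
      mu (~` (F @^-1` [set y])) = 0%E &
      forall (k : nat) (e : (k + d = m)%N) W psi U s,
        leray_coordinates F y W psi U s ->
        forall A : set 'rV[R]_m, measurable A -> A `<=` psi @` W ->
        mu A = (\int[lebesgue_rV k]_(z in U `&` [set z | A (psi (row_mx z (s z)))])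
                  (leray_density e F psi (row_mx z (s z)))%:E)%E].

(* d-dimensional volume of the injectively parametrized set phi @` U. *)
Definition param_volume (R : realType) (d m : nat) (U : set 'rV[R]_d)
    (phi : 'rV[R]_d -> 'rV[R]_m) : \bar R :=
  (\int[lebesgue_rV d]_(x in U)
     (Num.sqrt (\det (jacobian phi x *m (jacobian phi x)^T)))%:E)%E.

Definition hemisphere (R : realType) (d : nat) (c : R) (x : 'rV[R]_d) :
    'rV[R]_(d + 1) :=
  row_mx x (const_mx (c * Num.sqrt (1 - enorm x ^+ 2))).

Definition unit_ball (R : realType) (d : nat) : set 'rV[R]_d :=
  [set x | enorm x < 1].

(* vol(S^d): total area of the two open hemispheres of the unit sphere of
   R^(d+1), which are graphs over the open unit ball of R^d; their complement,
   the equator, has d-dimensional volume 0. *)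
Definition vol_sphere (R : realType) (d : nat) : \bar R :=
  (param_volume (@unit_ball R d) (hemisphere 1) +
   param_volume (@unit_ball R d) (hemisphere (-1)))%E.

Lemma vol_sphere0 (R : realType) : vol_sphere R 0 = 2%:E.
Proof.
have enorm0 (x : 'rV[R]_0) : enorm x = 0 by rewrite /enorm big_ord0 sqrtr0.
have volE c : param_volume (@unit_ball R 0) (hemisphere c) = 1%E.
  rewrite /param_volume (_ : @unit_ball R 0 = setT); last first.
    by apply/seteqP; split => // x _; rewrite /unit_ball /= enorm0.
  under eq_integral do rewrite det_mx00 sqrtr1.
  by rewrite integral_cst//= diracT mule1.
by rewrite /vol_sphere !volE -EFinD.
Qed.

Definition triangle (R : realType) (a b c : 'rV[R]_2) : set 'rV[R]_2 :=
  [set x | exists p q r : R, [/\ 0 <= p, 0 <= q, 0 <= r, p + q + r = 1 &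
                                 x = p *: a + q *: b + r *: c]].

Definition nondegenerate_triangle (R : realType) (a b c : 'rV[R]_2) : bool :=
  row_free (col_mx (b - a) (c - a)).

Definition triangle_area (R : realType) (a b c : 'rV[R]_2) : R :=
  fine (lebesgue_rV 2 (triangle a b c)).

Definition side_lengths (R : realType) (a b c : 'rV[R]_2) : 'rV[R]_3 :=
  \row_(i < 3) [:: enorm (b - a); enorm (c - b); enorm (a - c)]`_i.

(* (xi, eta) |-> (|xi|, |eta|, |xi + eta|), where R^n x R^n is 'rV[R]_(n + n). *)
Definition length_map (R : realType) (n : nat) (x : 'rV[R]_(n + n)) : 'rV[R]_3 :=
  \row_(i < 3) [:: enorm (lsubmx x); enorm (rsubmx x);
                   enorm (lsubmx x + rsubmx x)]`_i.

(* Main.v *)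
(* Let e be the last axis of R^n. For xi off the ray opposite to e, the reflection
   mapping xi to - |xi| e, applied to eta, is a fiberwise isometry that turns F into
   (|xi|, |zeta|, |zeta - |xi| e|) and has Jacobian determinant of modulus 1. Writing
   xi = rho omega and zeta = (q omega', p) with omega and omega' on open hemispheres of
   S^(n-1) and S^(n-2) gives coordinates in which the fiber is rho, p, q = const, with
   Leray density
     rho^(n-1) q^(n-2) J(omega) J(omega') * tau_2 tau_3 / (rho q),
   J being the area density of the hemisphere as a graph over the ball; moreover
   rho = tau_1 and rho q = 2 area(tau). Composing with signed transpositions of the
   axes gives charts that cover the fiber. Four of them, one for each pair of signs,
   have disjoint images and cover it up to sets that are coordinate hyperplanes in the
   other charts, hence negligible: summing the four integrals gives the volume, and
   summing the four chart measures gives the existence of the Leray measure. That the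
   measures of two charts agree where both are defined is the change of variables
   formula for the transition map, whose Jacobian determinant is the quotient of the
   two densities. *)

Require Import Defs.
From HB Require Import structures.
From mathcomp Require Import all_boot all_order all_algebra.
From mathcomp Require Import all_classical all_reals all_analysis.
From mathcomp Require Import fingroup perm measurable_realfun.
From mathcomp Require Import ring lra zify.
Import Order.TTheory GRing.Theory Num.Theory.
Import numFieldTopology.Exports numFieldNormedType.Exports.
Local Open Scope classical_set_scope.
Local Open Scope ring_scope.

Set Implicit Arguments.
Unset Strict Implicit.
Unset Printing Implicit Defensive.

(** * Lebesgue measure on row vectors *)

(** Independence of the chart has to hold for arbitrary Leray coordinates, in which the section [s]
    of the fiber is a bare function. Its regularity is recovered from the rest of the data: w |->
    (z, F(psi w)) is C1 with invertible derivative along the graph, hence open and bounded below by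
    distances there, and this gives in turn continuity, Lipschitz bounds and the derivative of z |->
    (z, s z). Transition maps are then differentiable and locally Lipschitz, as are their inverses,
    and the change of variables formula is proved under just these hypotheses: a bound on the
    measure of small balls gives one inequality, and the inverse map gives the other one. A
    reflection straightens the pair because it has an explicit smooth formula on the half-space
    where the last coordinate of xi is positive. The target - |xi| e, rather than |xi| e, is what
    keeps the mirror vector xi + |xi| e away from 0 there. *)

Section rV_borel.
Context {R : realType}.
Implicit Types n : nat.

Lemma ball_rVE n (x : 'rV[R]_n) r : 0 < r ->
  ball x r = [set v | forall i, ball (x ord0 i) r (v ord0 i)].
Proof.
move=> r0; apply/seteqP; split=> v; first by case=> _ + i; exact.
by move=> xv; split => // i j; rewrite ord1; exact: xv.
Qed.

Lemma measurable_box n (A : 'I_n -> set (measurableTypeR R)) :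
  (forall i, measurable (A i)) ->
  measurable [set v : 'rV[R]_n | forall i, A i (v ord0 i)].
Proof.
move=> mA.
have -> : [set v : 'rV[R]_n | forall i, A i (v ord0 i)] =
    \bigcap_(i in [set: 'I_n]) (rV_coord i @^-1` A i).
  by apply/seteqP; split => v /= vA i; [move=> _|]; exact: vA.
apply: fin_bigcap_measurable => // i _.
by rewrite -[X in measurable X]setTI; exact: measurable_rV_coord.
Qed.

Lemma measurable_ball_rV n (x : 'rV[R]_n) r : measurable (ball x r).
Proof.
have [r0|r0] := ltP 0 r; last first.
  suff -> : ball x r = set0 by [].
  by apply/seteqP; split => // v [+ _]; rewrite ltNge r0.
rewrite ball_rVE//; apply: (@measurable_box n (fun i => ball (x ord0 i) r)) => i.
exact: measurable_ball.
Qed.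

Lemma lebesgue_rV_ball n (x : 'rV[R]_n) r : 0 < r ->
  lebesgue_rV n (ball x r) = (((2 * r) ^+ n)%:E)%E.
Proof.
move=> r0; rewrite ball_rVE//.
rewrite (@lebesgue_rV_box _ n (fun i => ball (x ord0 i) r)); last first.
  by move=> i; exact: measurable_ball.
under eq_bigr do rewrite lebesgue_measure_ball ?ltW// -mulr_natl.
by rewrite prodEFin prodr_const card_ord.
Qed.

(** A countable base of the topology. Besides the measurability of open sets, it provides the
    countable cover by small balls in [integral_image]. *)
Definition rat_ball n (p : 'rV[rat]_n * nat) : set 'rV[R]_n :=
  ball (map_mx ratr p.1 : 'rV[R]_n) (p.2.+1%:R^-1).

Lemma rat_ball_nbhs n (A : set 'rV[R]_n) v : open A -> A v ->
  exists2 p, rat_ball p v & @rat_ball n p `<=` A.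
Proof.
move=> oA Av.
have /nbhs_ballP[e /= e0 eA] : nbhs v A by exact: open_nbhs_nbhs.
have [N Ne] : exists N : nat, N.+1%:R^-1 < e / 2.
  exists (Num.truncn (e / 2)^-1); rewrite invf_plt ?posrE ?divr_gt0//.
  by rewrite truncnS_gt.
have N0 : 0 < N.+1%:R^-1 :> R by rewrite invr_gt0.
have qP i : exists q : rat, ball (v ord0 i) (N.+1%:R^-1) (ratr q).
  have /rat_in_itvoo[q] : v ord0 i - N.+1%:R^-1 < v ord0 i + N.+1%:R^-1.
    by rewrite ltrBlDr -addrA ltrDl addr_gt0.
  rewrite in_itv /= => qv; exists q.
  by rewrite ball_itv/= in_itv/=.
pose q := \row_i sval (cid (qP i)).
have qv : rat_ball (q, N) v.
  rewrite /rat_ball /= ball_rVE// => i /=; rewrite !mxE.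
  by apply: ball_sym; exact: (svalP (cid (qP i))).
exists (q, N) => //= w Bw; apply: eA.
apply: (@le_ball R _ v (N.+1%:R^-1 + N.+1%:R^-1)).
  by rewrite (splitr e) lerD// ltW.
exact: (ball_triangle (ball_sym qv) Bw).
Qed.

Lemma open_measurable_rV n (A : set 'rV[R]_n) : open A -> measurable A.
Proof.
move=> oA.
have -> : A = \bigcup_(p in [set p | @rat_ball n p `<=` A]) rat_ball p.
  apply/seteqP; split => [v /(rat_ball_nbhs oA)[p pv pA]|v [p pA]]; last exact: pA.
  by exists p.
rewrite bigcup_mkcond; apply: countable_bigcupT_measurable => // p.
by case: ifP => // _; exact: measurable_ball_rV.
Qed.

(** The relative version of [measurable_fun_rVP]: parametrizations of the fiber and transition maps
    are controlled only on their open domains. The sets whose preimage has a measurable trace on [D]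
    form a sigma-algebra. *)
Lemma measurable_fun_rV d (T : measurableType d) n (D : set T) (f : T -> 'rV[R]_n) :
  (forall i, measurable_fun D (rV_coord i \o f)) -> measurable_fun D f.
Proof.
move=> mf mD A mA.
pose G := [set A : set 'rV[R]_n | measurable (D `&` f @^-1` A)].
have sG : sigma_algebra setT G.
  split.
  - by rewrite /G /= preimage_set0 setI0.
  - move=> B GB; rewrite /G /=.
    have -> : D `&` f @^-1` ([set: 'rV[R]_n] `\` B) = D `\` (D `&` f @^-1` B).
      by rewrite setDIr setDv set0U setTD preimage_setC setDE.
    exact: measurableD.
  - move=> F GF; rewrite /G /= preimage_bigcup setI_bigcupr.
    exact: bigcupT_measurable.
suff : @measurable _ 'rV[R]_n `<=` G by apply.
apply: smallest_sub => //.
case: n => [|n] in f mf A mA G sG *; first by rewrite big_ord0.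
rewrite -bigcup_mkord_ord; apply: bigcup_sub => i Ii _ [B mB <-].
by rewrite /G /= setTI; exact: mf.
Qed.

(** Open sets are a generating pi-system, so that two measures can be compared on open sets only;
    [integral_image] relies on this. *)
Lemma rV_measurableE n : @measurable _ 'rV[R]_n = <<s @open 'rV[R]_n >>.
Proof.
apply/seteqP; split; last first.
  apply: smallest_sub; first exact: sigma_algebra_measurable.
  exact: open_measurable_rV.
apply: smallest_sub; first exact: smallest_sigma_algebra.
case: n => [|n]; first by rewrite big_ord0.
rewrite -bigcup_mkord_ord; apply: bigcup_sub => i Ii _ [B mB <-].
suff : measurable_fun [set: g_sigma_algebraType (@open 'rV[R]_n.+1)] (rV_coord (inord i)).
  by apply.
apply: (measurability _ (RGenOInfty.measurableE R)) => _ [_ [x ->] <-].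
rewrite setTI; apply: sub_sigma_algebra.
apply: open_comp; last exact: interval_open.
by move=> v _; exact: coord_continuous.
Qed.

End rV_borel.

(** * Uniqueness of Lebesgue measure and its behaviour under linear maps *)

Section lebesgue_rV_unique.
Context {R : realType}.
Implicit Types n : nat.

(** Boxes form a generating pi-system, and the balls of integer radius around 0 are themselves
    boxes, the norm being the sup norm; they have finite measure and exhaust the space. *)
Lemma lebesgue_rV_unique n (m : {measure set 'rV[R]_n -> \bar R}) :
  (forall A : 'I_n -> set (measurableTypeR R), (forall i, measurable (A i)) ->
     m [set v | forall i, A i (v ord0 i)] =
     (\prod_(i < n) lebesgue_measure (A i))%E) ->
  forall A, measurable A -> lebesgue_rV n A = m A.
Proof.
move=> mbox A mA.
pose G := [set [set v : 'rV[R]_n | forall i, B i (v ord0 i)] |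
  B in [set B : 'I_n -> set (measurableTypeR R) | forall i, measurable (B i)]].
pose g k : set 'rV[R]_n := ball 0 k.+1%:R.
apply: (@g_sigma_algebra_measure_unique _ R _ G _ g) => //.
- by move=> _ [B mB <-]; exact: measurable_box.
- move=> k; exists (fun i => ball 0 k.+1%:R); first by move=> i; exact: measurable_ball.
  by rewrite /g ball_rVE//; apply/seteqP; split=> v /= vB i; have := vB i; rewrite mxE.
- apply/seteqP; split => // v _.
  exists (Num.truncn `|v|) => //.
  by rewrite /g -ball_normE/= sub0r normrN truncnS_gt.
- move=> _ _ [B mB <-] [C mC <-]; exists (fun i => B i `&` C i).
    by move=> i; exact: measurableI.
  apply/seteqP; split => [v BC|v [Bv Cv] i]; last by split.
  by split => i; have [] := BC i.
- by move=> _ [B mB <-]; rewrite [LHS](lebesgue_rV_box mB) mbox.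
- by move=> k; rewrite [ltLHS]lebesgue_rV_ball// ltry.
- move: A mA; apply: smallest_sub; first exact: smallest_sigma_algebra.
  case: n m mbox @G @g => [|n] m mbox G g; first by rewrite big_ord0.
  rewrite -bigcup_mkord_ord; apply: bigcup_sub => i Ii _ [B mB <-].
  apply: sub_sigma_algebra; exists (fun j => if j == inord i then B else setT).
    by move=> j; case: ifP.
  apply/seteqP; split => [v|v [_ vB] j].
    by move=> /(_ (inord i)); rewrite eqxx setTI.
  by case: ifPn => [/eqP ->|].
Qed.

Lemma lebesgue_measureZ (u : R) (A : set (measurableTypeR R)) : u != 0 -> measurable A ->
  lebesgue_measure [set x : R | A (x * u)] = (`|u|^-1%:E * lebesgue_measure A)%E.
Proof.
move=> u0 mA.
have mu : measurable_fun setT ((fun x => x * u) : measurableTypeR R -> measurableTypeR R).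
  exact: mulrr_measurable.
pose k : {nonneg R} := NngNum (normr_ge0 u).
suff h : lebesgue_measure A = (`|u|%:E * lebesgue_measure [set x : R | A (x * u)%R])%E.
  by rewrite h muleA -EFinM mulVf ?normr_eq0// mul1e.
pose m : {measure set (measurableTypeR R) -> \bar R} :=
  mscale k (measure_function_pushforward__canonical__measure_function_Measure lebesgue_measure mu).
apply: (@lebesgue_measure_unique _ m) => // _ [[a b] _ <-].
rewrite [RHS](_ : _ = `|u|%:E * lebesgue_measure ((fun x : R => x * u)%R @^-1` `]a, b]))%E//.
have [up|un|] := ltrgtP u 0; last by move/eqP; rewrite (negbTE u0).
  (* Here u < 0: the preimage is closed at its other end, which leaves its length unchanged. *)
  have -> : (fun x : R => x * u) @^-1` `]a, b] = `[b / u, a / u[%classic.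
    apply/seteqP; split => x /=; rewrite !in_itv/= ler_ndivrMr// ltr_ndivlMr//.
      by move=> /andP[-> ->].
    by move=> /andP[-> ->].
  rewrite !lebesgue_measure_itv/= !lte_fin ltr_nM2r ?invr_lt0//.
  case: ifPn => _; last by rewrite mule0.
  rewrite -!EFinD -EFinM; congr EFin; rewrite ltr0_norm//; field.
  by [].
have -> : (fun x : R => x * u) @^-1` `]a, b] = `]a / u, b / u]%classic.
  apply/seteqP; split => x /=; rewrite !in_itv/= ler_pdivlMr// ltr_pdivrMr//.
rewrite !lebesgue_measure_itv/= !lte_fin ltr_pM2r ?invr_gt0//.
case: ifPn => _; last by rewrite mule0.
rewrite -!EFinD -EFinM; congr EFin; rewrite gtr0_norm//; field.
by [].
Qed.

Lemma lebesgue_measureD (c : R) (A : set (measurableTypeR R)) : measurable A ->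
  lebesgue_measure [set x : R | A (x + c)] = lebesgue_measure A.
Proof.
move=> mA.
have mu : measurable_fun setT ((fun x => x + c) : measurableTypeR R -> measurableTypeR R).
  exact: measurable_funD.
pose m : {measure set (measurableTypeR R) -> \bar R} :=
  measure_function_pushforward__canonical__measure_function_Measure lebesgue_measure mu.
apply/esym; apply: (@lebesgue_measure_unique _ m) => // _ [[a b] _ <-].
rewrite [RHS](_ : _ = lebesgue_measure ((fun x : R => x + c)%R @^-1` `]a, b]))//.
have -> : (fun x : R => x + c) @^-1` `]a, b] = `]a - c, b - c]%classic.
  by apply/seteqP; split => x /=; rewrite !in_itv/= lerBrDr ltrBlDr.
rewrite !lebesgue_measure_itv/= !lte_fin ltrD2r -!EFinD.
by have -> : b - c - (a - c) = b - a by ring.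
Qed.

Lemma measurable_mulmxr n p (M : 'M[R]_(n, p)) :
  measurable_fun setT ((fun v => v *m M) : 'rV[R]_n -> 'rV[R]_p).
Proof.
apply: measurable_fun_rV => i; rewrite /comp /rV_coord.
under eq_fun do rewrite mxE.
apply: measurable_sum => j; apply: measurable_funM => //.
exact: measurable_rV_coord.
Qed.

Lemma measurable_addr_rV n (c : 'rV[R]_n) :
  measurable_fun setT ((fun v => v + c) : 'rV[R]_n -> 'rV[R]_n).
Proof.
apply: measurable_fun_rV => i; rewrite /comp /rV_coord.
under eq_fun do rewrite mxE.
apply: measurable_funD => //; exact: measurable_rV_coord.
Qed.

Lemma lebesgue_rVD n (c : 'rV[R]_n) A : measurable A ->
  lebesgue_rV n [set v | A (v + c)] = lebesgue_rV n A.
Proof.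
move=> mA; apply/esym.
pose m : {measure set 'rV[R]_n -> \bar R} :=
  measure_function_pushforward__canonical__measure_function_Measure (lebesgue_rV n)
    (measurable_addr_rV c).
apply: (@lebesgue_rV_unique n m) => // B mB.
transitivity (lebesgue_rV n
  [set v | forall i, [set x | B i (x + c ord0 i)] (v ord0 i)]).
  rewrite /m /= /pushforward; congr (lebesgue_rV n _).
  by apply/seteqP; split=> v /= vB i; have := vB i; rewrite !mxE.
rewrite [LHS](@lebesgue_rV_box _ n (fun i => [set x | B i (x + c ord0 i)])).
  by apply: eq_bigr => i _; exact: lebesgue_measureD.
move=> i; rewrite -[X in measurable X]setTI.
have mc : measurable_fun setT ((fun x => x + c ord0 i) : measurableTypeR R -> measurableTypeR R).
  exact: measurable_funD.
exact: mc.
Qed.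

(** This property is stable under products ([scales_mul]), so it only has to be checked on the
    factors of an LUP decomposition. *)
Definition scales n (M : 'M[R]_n) := forall A : set 'rV[R]_n, measurable A ->
  lebesgue_rV n [set v | A (v *m M)] = (`|\det M|^-1%:E * lebesgue_rV n A)%E.

Lemma scales_mul n (M N : 'M[R]_n) : scales M -> scales N -> scales (M *m N).
Proof.
move=> sM sN A mA; under eq_set do rewrite mulmxA.
rewrite (sM [set v | A (v *m N)]); last first.
  by rewrite -[X in measurable X]setTI; exact: measurable_mulmxr.
by rewrite sN// muleA -EFinM det_mulmx normrM invfM mulrC.
Qed.

Lemma scales_perm n (s : {perm 'I_n}) : scales (perm_mx s).
Proof.
move=> A mA.
rewrite det_perm normr_sign invr1 mul1e; apply/esym.
have E (v : 'rV[R]_n) i : (v *m perm_mx s) ord0 i = v ord0 ((s^-1)%g i).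
  by rewrite -{1}(invgK s) -col_permE mxE.
pose m : {measure set 'rV[R]_n -> \bar R} :=
  measure_function_pushforward__canonical__measure_function_Measure (lebesgue_rV n)
    (measurable_mulmxr (perm_mx s)).
apply: (@lebesgue_rV_unique n m) => // B mB.
transitivity (lebesgue_rV n [set v | forall i, B (s i) (v ord0 i)]).
  rewrite /m /= /pushforward; congr (lebesgue_rV n _).
  apply/seteqP; split=> v /= vB i.
    by have := vB (s i); rewrite E permK.
  by rewrite E -{1}(permKV s i).
rewrite (@lebesgue_rV_box _ n (fun i => B (s i)))//.
by rewrite [RHS](reindex_inj (@perm_inj _ s)).
Qed.

Lemma rV_cons_mulmx n (p : measurableTypeR R * 'rV[R]_n) (u : R) (r : 'rV[R]_n) (M : 'M[R]_n) :
  rV_cons p *m (block_mx (const_mx u) r 0 M : 'M[R]_(1 + n)) =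
  rV_cons (p.1 * u, p.1 *: r + p.2 *m M).
Proof.
transitivity (row_mx ((const_mx p.1 : 'rV[R]_1) *m (const_mx u : 'M[R]_1) + p.2 *m 0)
    ((const_mx p.1 : 'rV[R]_1) *m r + p.2 *m M) : 'rV[R]_(1 + n)).
  exact: (mul_row_block (const_mx p.1 : 'rV[R]_1)).
rewrite /rV_cons mulmx0 addr0; congr row_mx.
  by apply/rowP => i; rewrite !mxE big_ord1 !mxE.
by congr (_ + _); apply/rowP => i; rewrite !mxE big_ord1 !mxE.
Qed.

(** Slicing along the first coordinate: on the slice at x the map is v |-> x r + v M, landing in the
    slice at x u. Translation invariance removes the shear r, [scales M] handles the slice, and the
    integral over x is rescaled by u. *)
Lemma scales_ublock n (u : R) (r : 'rV[R]_n) (M : 'M[R]_n) : u != 0 -> scales M ->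
  @scales n.+1 (block_mx (const_mx u) r 0 M : 'M[R]_(1 + n)).
Proof.
move=> u0 sM A mA.
have -> : @determinant R n.+1 (block_mx (const_mx u) r 0 M : 'M[R]_(1 + n)) = u * \det M.
  rewrite [LHS](det_ublock (const_mx u : 'M[R]_1)).
  by rewrite det_mx11 mxE.
pose X := @rV_cons R n @^-1` A.
have mX : measurable X.
  by rewrite -[X in measurable X]setTI; exact: measurable_rV_cons.
pose phi t := lebesgue_rV n (xsection X t).
have mphi : measurable_fun setT phi by exact: measurable_fun_xsection.
rewrite /= /lebesgue_rV_step /pushforward /= /product_measure1.
transitivity (\int[lebesgue_measure]_x (`|\det M|^-1%:E * phi (x * u)%R))%E.
  apply: eq_integral => x _ /=.
  rewrite (_ : xsection _ _ = [set v | [set w | xsection X (x * u) (w + x *: r)] (v *m M)]).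
    rewrite sM.
      by rewrite lebesgue_rVD//; exact: measurable_xsection.
    rewrite -[X in measurable X]setTI; apply: measurable_addr_rV => //.
    exact: measurable_xsection.
  apply/funext => v; rewrite /xsection /= !in_setE /X /preimage /=.
  by rewrite [X in A X]rV_cons_mulmx /= addrC.
have mu : measurable_fun setT ((fun x => x * u) : measurableTypeR R -> measurableTypeR R).
  exact: mulrr_measurable.
rewrite ge0_integralZl//; last first.
  exact: (measurableT_comp mphi mu).
rewrite normrM invfM mulrC EFinM -muleA; congr (_ * _)%E.
rewrite -(@ge0_integral_pushforward _ _ _ _ R _ mu lebesgue_measure setT phi)//.
pose k : {nonneg R} := NngNum (ltW (eqbRL (@invr_gt0 _ `|u|) (eqbRL (normr_gt0 u) u0))).
rewrite (@eq_measure_integral _ _ _ setT (mscale k lebesgue_measure)); last first.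
  by move=> B mB _; rewrite [LHS](lebesgue_measureZ u0 mB).
by rewrite ge0_integral_mscale.
Qed.

Lemma scales_utrig n (M : 'M[R]_n) : (forall i j : 'I_n, (j < i)%N -> M i j = 0) ->
  \det M != 0 -> scales M.
Proof.
elim: n M => [|n IHn] M tM dM.
  move=> A mA; rewrite det_mx00 normr1 invr1 mul1e; congr (lebesgue_rV _ _).
  by apply/seteqP; split => v /=; rewrite (flatmx0 M) mulmx0 thinmx0.
have e1 : @ulsubmx _ 1 n 1 n M = const_mx (M ord0 ord0).
  by apply/matrixP => i j; rewrite !mxE !ord1; congr (M _ _); exact/val_inj.
have e2 : @dlsubmx _ 1 n 1 n M = 0.
  by apply/matrixP => i j; rewrite !mxE; apply: tM; rewrite /= ord1.
have E : M = (block_mx (const_mx (M ord0 ord0)) (@ursubmx _ 1 n 1 n M) 0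
                      (@drsubmx _ 1 n 1 n M) : 'M[R]_(1 + n)).
  by rewrite -[LHS](@submxK _ 1 n 1 n M) e1 e2.
have dE : \det M = M ord0 ord0 * \det (@drsubmx _ 1 n 1 n M).
  by rewrite {1}E [LHS](det_ublock (const_mx _ : 'M[R]_1)) det_mx11 mxE.
move: dM; rewrite dE mulf_eq0 negb_or => /andP[u0 d0].
rewrite E; apply: scales_ublock => //; apply: IHn => // i j ij.
by rewrite !mxE; apply: tM; rewrite /= ltnS.
Qed.

(** Conjugation by the permutation that reverses the order of the coordinates makes a lower
    triangular matrix upper triangular. *)
Lemma scales_ltrig n (M : 'M[R]_n) : (forall i j : 'I_n, (i < j)%N -> M i j = 0) ->
  \det M != 0 -> scales M.
Proof.
move=> tM dM.
pose s : {perm 'I_n} := perm (@rev_ord_inj n).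
have wE : perm_mx s *m perm_mx s = 1%:M :> 'M[R]_n.
  rewrite -perm_mxM (_ : (s * s)%g = 1%g) ?perm_mx1//.
  by apply/permP => i; rewrite permM perm1 !permE rev_ordK.
have -> : M = perm_mx s *m (perm_mx s *m M *m perm_mx s) *m perm_mx s.
  by rewrite !mulmxA wE mul1mx -mulmxA wE mulmx1.
apply: scales_mul (scales_perm s); apply: scales_mul; first exact: scales_perm.
apply: scales_utrig; last first.
  by rewrite !det_mulmx det_perm mulrC mulrA -expr2 sqrr_sign mul1r.
have sV : (s^-1)%g = s.
  apply: (mulgI s); rewrite mulgV; apply/permP => x.
  by rewrite permM perm1 !permE rev_ordK.
have -> : perm_mx s *m M *m perm_mx s = col_perm s (row_perm s M).
  by rewrite col_permE row_permE sV.
move=> i j ij; rewrite !mxE; apply: tM.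
by rewrite !permE /=; have := ltn_ord i; lia.
Qed.

(** M is the product of a permutation matrix, a lower triangular matrix of determinant 1 and an
    upper triangular matrix, each of which [scales]. *)
Theorem lebesgue_rV_mulmx n (M : 'M[R]_n) A : \det M != 0 -> measurable A ->
  lebesgue_rV n [set v | A (v *m M)] = (`|\det M|^-1%:E * lebesgue_rV n A)%E.
Proof.
move=> dM; move: A; change (scales M).
case: n M dM => [|n] M dM; first by apply: scales_utrig => //; case.
have := cormen_lup_correct M; have := cormen_lup_perm M.
have := @cormen_lup_lower _ _ M; have := @cormen_lup_upper _ _ M.
have := cormen_lup_detL M.
case: (cormen_lup M) => -[P L] U /= dL tU tL /is_perm_mxP[s ->{P}] PM.
have E : M = perm_mx (s^-1)%g *m L *m U.
  rewrite -mulmxA [L *m U](_ : _ = perm_mx s *m M)//.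
  by rewrite mulmxA -perm_mxM mulVg perm_mx1 mul1mx.
rewrite E; apply: scales_mul; [apply: scales_mul; [exact: scales_perm|]|].
- apply: scales_ltrig; last by rewrite dL oner_eq0.
  by move=> i j ij; rewrite tL ?(ltnW ij)// (_ : i == j = false)// -val_eqE /= ltn_eqF.
- apply: scales_utrig => //.
  by move: dM; rewrite E !det_mulmx mulf_eq0 negb_or => /andP[].
Qed.

End lebesgue_rV_unique.
Lemma open_preimage_in (T U : topologicalType) (O : set T) (f : T -> U) (B : set U) :
  open O -> (forall x, O x -> {for x, continuous f}) -> open B ->
  open (O `&` f @^-1` B).
Proof.
move=> oO fc oB; rewrite openE => x [Ox Bx]; apply: filterI.
  exact: open_nbhs_nbhs.
by apply: fc => //; exact: open_nbhs_nbhs.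
Qed.

Section continuous_measurable.
Context {R : realType}.

Lemma continuous_measurable_rV n (O : set 'rV[R]_n) (f : 'rV[R]_n -> R) :
  open O -> (forall x, O x -> {for x, continuous f}) ->
  measurable_fun O (f : 'rV[R]_n -> measurableTypeR R).
Proof.
move=> oO fc; apply: (measurability _ (RGenOInfty.measurableE R)) => _ [_ [x ->] <-].
by apply: open_measurable_rV; apply: open_preimage_in => //; exact: interval_open.
Qed.

Lemma continuous_measurable_rV_rV n p (O : set 'rV[R]_n) (f : 'rV[R]_n -> 'rV[R]_p) :
  open O -> (forall x, O x -> {for x, continuous f}) -> measurable_fun O f.
Proof.
move=> oO fc; apply: measurable_fun_rV => i.
apply: continuous_measurable_rV => // x Ox.
apply: (@continuous_comp _ _ _ f (fun v : 'rV[R]_p => v ord0 i)); first exact: fc.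
exact: coord_continuous.
Qed.

End continuous_measurable.

(** * Images of measures with a density *)

Section density_measure.
Context d1 d2 (T1 : measurableType d1) (T2 : measurableType d2) {R : realType}.
Variables (mu : {measure set T1 -> \bar R}) (D : set T1) (P : T1 -> T2) (f : T1 -> R).
Hypotheses (mD : measurable D) (mP : measurable_fun D P) (mf : measurable_fun D f).
Hypothesis f0 : forall x, D x -> 0 <= f x.

(** The image under [P] of the measure [f] dmu on [D]. Only the restrictions of [P] and [f] to [D]
    matter, as suits a chart. *)
Definition density_measure (A : set T2) : \bar R :=
  (\int[mu]_(x in D `&` P @^-1` A) (f x)%:E)%E.

Let measure0 : density_measure set0 = 0%E.
Proof. by rewrite /density_measure preimage_set0 setI0 integral_set0. Qed.

Let measure_ge0 A : (0 <= density_measure A)%E.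
Proof. by apply: integral_ge0 => x [Dx _]; rewrite lee_fin f0. Qed.

Let measure_sigma_additive : semi_sigma_additive density_measure.
Proof.
move=> F mF tF mUF; rewrite /density_measure preimage_bigcup setI_bigcupr.
rewrite ge0_integral_bigcup//.
- apply: is_cvg_nneseries => n _ _.
  by apply: integral_ge0 => x [Dx _]; rewrite lee_fin f0.
- by move=> k; exact: mP.
- apply/measurable_EFinP; apply: (measurable_funS mD) => //.
  by move=> x [k _ []].
- by move=> x [k _ [Dx _]]; rewrite lee_fin f0.
- apply/trivIsetP => i j _ _ ij; move/trivIsetP : tF => /(_ i j Logic.I Logic.I ij) Fij.
  by rewrite setIACA setIid -preimage_setI Fij preimage_set0 setI0.
Qed.

HB.instance Definition _ := isMeasure.Build _ _ _ density_measure
  measure0 measure_ge0 measure_sigma_additive.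

Definition densm : {measure set T2 -> \bar R} := density_measure.

End density_measure.

(** * Differential calculus on row vectors *)

Section matrix_norm.
Context {R : realType}.

Lemma ler_mx_entry m n (M : 'M[R]_(m, n)) i j : `|M i j| <= `|M|.
Proof.
by rewrite [leRHS]/Num.norm/= mx_normrE; exact: (le_bigmax _ _ (i, j)).
Qed.

Lemma ler_mx_norm m n (M : 'M[R]_(m, n)) (c : R) : 0 <= c ->
  (forall i j, `|M i j| <= c) -> `|M| <= c.
Proof.
move=> c0 Mc; rewrite [leLHS]/Num.norm/= mx_normrE; by apply: bigmax_le => // -[i j] _.
Qed.

Lemma ler_norm_mulmx m n p (M : 'M[R]_(m, n)) (N : 'M[R]_(n, p)) :
  `|M *m N| <= n%:R * `|M| * `|N|.
Proof.
apply: ler_mx_norm => [|i j]; first by rewrite !mulr_ge0.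
rewrite mxE; apply: le_trans (ler_norm_sum _ _ _) _.
apply: (@le_trans _ _ (\sum_(k < n) `|M| * `|N|)).
  by apply: ler_sum => k _; rewrite normrM ler_pM// ler_mx_entry.
by rewrite sumr_const card_ord -mulrA mulr_natl.
Qed.

Lemma continuous_mxP (V : normedModType R) m n (f : 'M[R]_(m, n) -> V) x :
  {for x, continuous f} <->
  (forall e, 0 < e -> \forall y \near x, `|f y - f x| <= e).
Proof.
split=> [fx e e0|fx].
  have := (@cvgrPdist_le R V _ _ (nbhs_filter (x : 'M[R]_(m, n))) _ _).1 fx e e0.
  by apply: filterS => y; rewrite distrC.
apply/(@cvgrPdist_le R V _ _ (nbhs_filter (x : 'M[R]_(m, n)))) => e /fx.
by apply: filterS => y; rewrite distrC.
Qed.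

Lemma near_mx_dist m n (x : 'M[R]_(m, n)) e : 0 < e -> \forall y \near x, `|y - x| < e.
Proof.
move=> e0; apply/nbhs_ballP; exists e => //= y.
by rewrite -ball_normE /= distrC.
Qed.

Lemma mulmxr_continuous m n p (N : 'M[R]_(n, p)) :
  continuous (fun M : 'M[R]_(m, n) => M *m N).
Proof.
move=> M; apply/continuous_mxP => e e0.
have K0 : 0 < n%:R * `|N| + 1 by rewrite ltr_wpDl// mulr_ge0.
have := near_mx_dist M (divr_gt0 e0 K0); apply: filterS => M'.
rewrite ltr_pdivlMr// => /ltW MM'.
rewrite -mulmxBl; apply: le_trans (ler_norm_mulmx _ _) _.
apply: le_trans MM'.
by rewrite mulrAC mulrC ler_wpM2l// lerDl.
Qed.

End matrix_norm.

Section differential_estimate.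
Context {R : realType} {V W : normedModType R}.
Implicit Types (f : V -> W) (x : V).

Lemma diff_estimateP f x (L : {linear V -> W}) : continuous L ->
  (forall e, 0 < e -> \forall y \near x, `|f y - f x - L (y - x)| <= e * `|y - x|) <->
  differentiable f x /\ 'd f x = L :> (V -> W).
Proof.
move=> Lc; split=> [fL|[df <-] e e0].
  have fE : f \o shift x = cst (f x) + L +o_0 id.
    apply/eqaddoP => e e0; have := fL e e0.
    rewrite (near_shift 0); apply: filterS => y /=.
    by rewrite subr0 addrK !fctE /= opprD addrA.
  have dE := diff_unique Lc fE; split => //.
  by apply/diff_locallyP; rewrite dE.
have /diff_locallyP[_ /eqaddoP/(_ e e0)] := df.
rewrite [X in _ -> X](near_shift 0); apply: filterS => y /=.
by rewrite subr0 addrK !fctE /= opprD addrA.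
Qed.

End differential_estimate.

Section jacobian.
Context {R : realType}.
Implicit Types m n p : nat.

(** Differentiability together with the value of the derivative ([has_jacobianP]), as one estimate:
    a candidate matrix can be proposed and checked by epsilons. *)
Definition has_jacobian m n (f : 'rV[R]_m -> 'rV[R]_n) (x : 'rV[R]_m) (M : 'M[R]_(m, n)) :=
  forall e, 0 < e -> \forall y \near x, `|f y - f x - (y - x) *m M| <= e * `|y - x|.

Lemma diff_mulmx m n (f : 'rV[R]_m -> 'rV[R]_n) (x v : 'rV[R]_m) : 'd f x v = v *m jacobian f x.
Proof. by rewrite /jacobian mul_rV_lin1. Qed.

Lemma has_jacobianP m n (f : 'rV[R]_m -> 'rV[R]_n) (x : 'rV[R]_m) M :
  has_jacobian f x M <-> differentiable f x /\ jacobian f x = M.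
Proof.
pose L : {linear 'rV[R]_m -> 'rV[R]_n} := mulmxr M.
have Lc : continuous L by exact: mulmxr_continuous.
have [H1 H2] := diff_estimateP f x Lc.
split=> [/H1[df dE]|[df dE]].
  split => //; apply/row_matrixP => i; rewrite !rowE -diff_mulmx.
  by rewrite dE.
by apply: H2; split => //; apply/funext => v; rewrite diff_mulmx dE.
Qed.

Lemma differentiable_has_jacobian m n (f : 'rV[R]_m -> 'rV[R]_n) (x : 'rV[R]_m) :
  differentiable f x -> has_jacobian f x (jacobian f x).
Proof. by move=> df; apply/has_jacobianP. Qed.

Lemma jacobian_comp m n p (f : 'rV[R]_m -> 'rV[R]_n) (g : 'rV[R]_n -> 'rV[R]_p) (x : 'rV[R]_m) :
  differentiable f x -> differentiable g (f x) ->
  jacobian (g \o f) x = jacobian f x *m jacobian g (f x).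
Proof.
move=> df dg; apply/row_matrixP => i; rewrite !rowE -diff_mulmx.
by rewrite diff_comp//= !diff_mulmx mulmxA.
Qed.

Lemma has_jacobian_near m n (f g : 'rV[R]_m -> 'rV[R]_n) (x : 'rV[R]_m) M :
  (\forall y \near x, f y = g y) -> has_jacobian f x M -> has_jacobian g x M.
Proof.
move=> fg fM e e0; have fgx := nbhs_singleton fg; have := fM e e0.
by apply: filterS2 fg => y /= <-; rewrite -fgx.
Qed.

End jacobian.

(** * Strict differentiability and local inversion of C1 maps *)

Section strict_differentiability.
Context {R : realType}.
Implicit Types m n p : nat.

Lemma nbhs_normP m n (x : 'M[R]_(m, n)) (A : set 'M[R]_(m, n)) :
  nbhs x A <-> exists2 e, 0 < e & forall y, `|y - x| < e -> A y.
Proof.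
split=> [/nbhs_ballP[e /= e0 eA]|[e e0 eA]].
  by exists e => // y yx; apply: eA; rewrite -ball_normE /= distrC.
by apply/nbhs_ballP; exists e => // y; rewrite -ball_normE /= distrC; exact: eA.
Qed.

Lemma is_derive_line m n (f : 'rV[R]_m -> 'rV[R]_n) (y v : 'rV[R]_m) (t : R) j :
  differentiable f (t *: v + y) ->
  is_derive t (1:R) (fun s : R => f (s *: v + y) ord0 j)
    ((v *m jacobian f (t *: v + y)) ord0 j).
Proof.
move=> df.
pose l : R -> 'rV[R]_m := fun s => s *: v + y.
have dl : is_diff t l ( *:%R ^~ v).
  have -> : l = ( *:%R ^~ v) + cst y by apply/funext.
  apply: is_diff_eq.
  by rewrite addr0.
have df' : is_diff (l t) f ('d f (l t)) by exact: differentiableP.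
pose c : 'rV[R]_n -> R := fun N => N ord0 j.
have dc : differentiable c (f (l t)) by exact: differentiable_coord.
have dcE : 'd c (f (l t)) = c :> (_ -> _).
  have @L : {linear 'rV[R]_n -> R}.
    by exists c; do 2![eexists]; do ?[constructor];
      rewrite /c ?mxE// => ? *; rewrite ?mxE//; move=> ?; rewrite !mxE.
  rewrite (_ : c = L)//; apply: diff_lin; exact: coord_continuous.
have dcl : is_diff t (c \o (f \o l)) (fun s => ((s *: v) *m jacobian f (l t)) ord0 j).
  have dfl : is_diff t (f \o l) ('d f (l t) \o *:%R ^~ v) by exact: is_diff_comp.
  have [d3 d4] := dfl; apply: DiffDef; first exact: (differentiable_comp d3 dc).
  rewrite [LHS](diff_comp d3 dc) d4; apply/funext => s.
  by rewrite /= -/(f (l t)) [X in X _ = _]dcE /c diff_mulmx.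
have [d1 d2] := dcl.
have dv : derivable (c \o (f \o l)) t 1 by exact: diff_derivable.
apply: DeriveDef; first exact: dv.
by rewrite -[LHS]/('D_1 (c \o (f \o l)) t) deriveE// d2 scale1r.
Qed.

(** Balls are convex, so the mean value theorem applies on the segment from y to x, one coordinate
    at a time, to f minus its linear part at x0. The derivative of this difference is small by
    continuity of the Jacobian. *)
Lemma C1_strict m n (W : set 'rV[R]_m) (f : 'rV[R]_m -> 'rV[R]_n) x0 :
  C1_on W f -> W x0 -> forall e, 0 < e ->
  exists2 d, 0 < d & (forall x, `|x - x0| < d -> W x) /\
    forall x y, `|x - x0| < d -> `|y - x0| < d ->
    `|f x - f y - (x - y) *m jacobian f x0| <= e * `|x - y|.
Proof.
move=> [oW C1] Wx0 e e0; have [_ cJ] := C1 x0 Wx0.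
(* The norm bound for a row times a matrix loses a factor m; m + 1 keeps the denominator nonzero
   when m = 0. *)
pose e' := e / m.+1%:R.
have e'0 : 0 < e' by rewrite divr_gt0.
have /nbhs_normP[d d0 dP] : \forall x \near x0, W x /\ `|jacobian f x - jacobian f x0| <= e'.
  apply: filterI; first exact: open_nbhs_nbhs.
  exact: ((continuous_mxP _ _).1 cJ e' e'0).
exists d => //; split => [x /dP[]//|x y xd yd].
apply: ler_mx_norm => [|i j]; first by rewrite mulr_ge0 // ltW.
rewrite ord1 {i}.
pose v := x - y.
have seg (t : R) : t \in `[0, 1] -> `|t *: v + y - x0| < d.
  rewrite in_itv/= => /andP[t0 t1].
  have -> : t *: v + y - x0 = t *: (x - x0) + (1 - t) *: (y - x0).
    by rewrite /v scalerBl !scalerBr scale1r; apply/rowP => k; rewrite !mxE; ring.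
  apply: le_lt_trans (ler_normD _ _) _; rewrite !normrZ ger0_norm// ger0_norm ?subr_ge0//.
  pose M := Num.max `|x - x0| `|y - x0|.
  apply: (@le_lt_trans _ _ M); last by rewrite gt_max xd yd.
  have -> : M = t * M + (1 - t) * M by ring.
  by apply: lerD; apply: ler_wpM2l; rewrite ?subr_ge0 // le_max lexx ?orbT.
pose phi (t : R) := f (t *: v + y) ord0 j - t * (v *m jacobian f x0) ord0 j.
pose dphi (t : R) := (v *m jacobian f (t *: v + y)) ord0 j - (v *m jacobian f x0) ord0 j.
have dP' (t : R) : t \in `[0, 1] -> is_derive t 1 phi (dphi t).
  move=> /seg /dP[/C1[dft _] _].
  have d1 := is_derive_line j dft.
  have d2 : is_derive t 1 (fun s : R => s * (v *m jacobian f x0) ord0 j)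
      ((v *m jacobian f x0) ord0 j).
    set k := (v *m _) _ _; rewrite (_ : (fun s : R => _) = k \*: id).
      by apply: is_derive_eq; rewrite /GRing.scale /= mulr1.
    by apply/funext => s /=; rewrite mulrC.
  exact: (is_deriveB d1 d2).
have cphi : {within `[0, 1], continuous phi}.
  apply: derivable_within_continuous => t t01; have [d1 _] := dP' t t01; exact: d1.
have dphi' t : t \in `](0 : R), (1 : R)[ -> is_derive t (1 : R) phi (dphi t).
  by move=> t01; apply: dP'; apply: subset_itv_oo_cc.
have [c cI cE] := @MVT_segment R phi dphi 0 1 ler01 dphi' cphi.
have [_ Jc] := dP _ (seg c cI).
have -> : (f x - f y - (x - y) *m jacobian f x0) ord0 j = dphi c.
  have -> : dphi c = phi 1 - phi 0 by rewrite cE subr0 mulr1.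
  by rewrite /phi scale1r scale0r add0r /v subrK !mxE; ring.
have -> : dphi c = (v *m (jacobian f (c *: v + y) - jacobian f x0)) ord0 j.
  by rewrite mulmxBr [RHS]mxE [X in _ + X]mxE.
apply: le_trans (ler_mx_entry _ _ _) _; apply: le_trans (ler_norm_mulmx _ _) _.
apply: (@le_trans _ _ (m%:R * `|v| * e')); first by rewrite ler_wpM2l// mulr_ge0.
have -> : m%:R * `|v| * e' = (e * `|x - y|) * (m%:R / m.+1%:R) by rewrite /e'; ring.
rewrite ler_piMr//; first by rewrite mulr_ge0// ltW.
by rewrite ler_pdivrMr// mul1r ler_nat.
Qed.

End strict_differentiability.

Section local_inversion.
Context {R : realType}.
Implicit Types m n p : nat.

Lemma mulmx_norm_bound m n (M : 'M[R]_(m, n)) :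
  exists2 K, 0 < K & forall v : 'rV[R]_m, `|v *m M| <= K * `|v|.
Proof.
exists (m%:R * `|M| + 1) => [|v]; first by rewrite ltr_wpDl// mulr_ge0.
apply: le_trans (ler_norm_mulmx _ _) _.
by rewrite mulrAC ler_wpM2r// lerDl.
Qed.

(** Let K bound a right inverse N of M. Applying N to an error of at most |x - y| / (2K) costs at
    most half of |x - y|, and this half is absorbed on the left. *)
Lemma strict_lower_bound m n (f : 'rV[R]_m -> 'rV[R]_n) (M : 'M[R]_(m, n)) :
  row_free M ->
  exists2 e, 0 < e & exists2 c, 0 < c &
   (forall x y, `|f x - f y - (x - y) *m M| <= e * `|x - y| ->
     `|x - y| <= c * `|f x - f y|).
Proof.
move=> /row_freeP[N MN]; have [K K0 KN] := mulmx_norm_bound N.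
exists (2 * K)^-1; first by rewrite invr_gt0 mulr_gt0.
exists (2 * K); first by rewrite mulr_gt0.
move=> x y; set v := x - y; set w := f x - f y => h.
have hN := KN (w - v *m M).
have hw := KN w.
rewrite mulmxBl -mulmxA MN mulmx1 in hN.
have h1 : `|v| <= `|w *m N| + `|w *m N - v|.
  by rewrite -{1}(subKr (w *m N) v); exact: ler_normB.
have h2 : K * `|w - v *m M| <= `|v| / 2.
  by rewrite -ler_pdivlMl// (le_trans h)// invfM mulrA [_ * `|v|]mulrC mulrA mulrC mulrA.
lra.
Qed.

Lemma C1_lipschitz m n (W : set 'rV[R]_m) (f : 'rV[R]_m -> 'rV[R]_n) x0 :
  C1_on W f -> W x0 ->
  exists2 L, 0 < L & exists2 d, 0 < d & (forall x, `|x - x0| < d -> W x) /\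
    forall x y, `|x - x0| < d -> `|y - x0| < d -> `|f x - f y| <= L * `|x - y|.
Proof.
move=> fC Wx0; have [K K0 KN] := mulmx_norm_bound (jacobian f x0).
have [d d0 [dW dP]] := C1_strict fC Wx0 ltr01.
exists (1 + K); first by rewrite addr_gt0.
exists d => //; split => // x y xd yd.
have := dP x y xd yd; have := KN (x - y).
have : `|f x - f y| <= `|f x - f y - (x - y) *m jacobian f x0| + `|(x - y) *m jacobian f x0|.
  by rewrite -{1}(subrK ((x - y) *m jacobian f x0) (f x - f y)); exact: ler_normD.
by lra.
Qed.

Lemma C1_lower_lipschitz m n (W : set 'rV[R]_m) (f : 'rV[R]_m -> 'rV[R]_n) x0 :
  C1_on W f -> W x0 -> row_free (jacobian f x0) ->
  exists2 c, 0 < c & exists2 d, 0 < d & (forall x, `|x - x0| < d -> W x) /\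
    forall x y, `|x - x0| < d -> `|y - x0| < d -> `|x - y| <= c * `|f x - f y|.
Proof.
move=> fC Wx0 Jf; have [e e0 [c c0 cP]] := strict_lower_bound f Jf.
have [d d0 [dW dP]] := C1_strict fC Wx0 e0.
by exists c => //; exists d => //; split => // x y xd yd; apply: cP; exact: dP.
Qed.

(* The Newton-like map x |-> x - (f x - y) f'(x0)^-1 is a contraction. *)
Lemma C1_open_map n (W : set 'rV[R]_n) (f : 'rV[R]_n -> 'rV[R]_n) x0 A :
  C1_on W f -> W x0 -> jacobian f x0 \in unitmx -> nbhs x0 A ->
  nbhs (f x0) (f @` A).
Proof.
move=> fC Wx0 Jf /nbhs_normP[d1 d10 d1A].
set J := jacobian f x0 in Jf; have [K K0 KM] := mulmx_norm_bound (invmx J).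
have e0 : 0 < (2 * K)^-1 by rewrite invr_gt0 mulr_gt0.
have [d d0 [dW dP]] := C1_strict fC Wx0 e0.
pose r := Num.min d1 d / 2.
have r0 : 0 < r by rewrite divr_gt0// lt_min d10 d0.
have rd1 : r < d1 by rewrite /r ltr_pdivrMr// gt_min; rewrite ltr_pMr// ltr1n.
have rd : r < d by rewrite /r ltr_pdivrMr// gt_min orbC; rewrite ltr_pMr// ltr1n.
(* For such y the map g moves x0 by at most r / 2, and since g contracts by 1/2 it maps the closed
   ball B of radius r into itself. *)
apply/nbhs_normP; exists (r / (2 * K)); first by rewrite divr_gt0// mulr_gt0.
move=> y; rewrite distrC => yx.
pose g x := x - (f x - y) *m invmx J.
pose B : set 'rV[R]_n := [set x | `|x - x0| <= r].
have gL x x' : B x -> B x' -> `|g x - g x'| <= 2^-1 * `|x - x'|.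
  move=> Bx Bx'.
  have -> : g x - g x' = - ((f x - f x' - (x - x') *m J) *m invmx J).
    rewrite mulmxBl mulmxK// /g !mulmxBl !opprB.
    by apply/rowP => i; rewrite !mxE; ring.
  rewrite normrN; apply: le_trans (KM _) _.
  rewrite -ler_pdivlMl// mulrA -invfM mulrC [K * 2]mulrC.
  rewrite mulrC; apply: dP; first exact: le_lt_trans Bx _.
  exact: le_lt_trans Bx' _.
have gB : set_fun B B g.
  move=> x Bx; rewrite /B /=.
  have -> : g x - x0 = (g x - g x0) + (g x0 - x0) by rewrite addrA subrK.
  apply: le_trans (ler_normD _ _) _.
  have -> : g x0 - x0 = - ((f x0 - y) *m invmx J) by rewrite /g addrAC subrr add0r.
  have Bx0 : B x0 by rewrite /B /= subrr normr0 ltW.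
  have h1 := gL x x0 Bx Bx0; have h2 := KM (f x0 - y).
  have h3 : K * `|f x0 - y| <= r / 2.
    by rewrite -ler_pdivlMl// (le_trans (ltW yx))// invfM; lra.
  rewrite normrN; move: Bx; rewrite /B /=; lra.
have Bx0 : B x0 by rewrite /B /= subrr normr0 ltW.
have cB : compact B.
  apply: bounded_closed_compact.
    exists (r + `|x0|); split; first by rewrite num_real.
    move=> M rM x Bx /=; rewrite -(subrK x0 x) (le_trans (ler_normD _ _))//.
    by rewrite (le_trans _ (ltW rM))// lerD2r.
  apply: (@closed_comp _ _ (fun x : 'rV[R]_n => `|x - x0|) [set t | t <= r]); last exact: closed_le.
  move=> x _; apply/continuous_mxP => e e0'.
  have := near_mx_dist x e0'; apply: filterS => x' /ltW; apply: le_trans.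
  apply: le_trans (ler_dist_dist _ _) _.
  by rewrite opprB addrA subrK.
have hc : {within B, continuous (fun x => `|g x - x|)}.
  apply: continuous_in_subspaceT => x; rewrite in_setE => Bx.
  have fx : {for x, continuous f}.
    apply: differentiable_continuous; apply: (fC.2 _ _).1; apply: dW.
    exact: le_lt_trans Bx _.
  have c1 : {for x, continuous (fun x => f x *m invmx J)}.
    apply: (@continuous_comp _ _ _ f (fun v : 'rV[R]_n => v *m invmx J) x fx).
    exact: mulmxr_continuous.
  have gE z : g z - z = y *m invmx J - f z *m invmx J.
    by rewrite /g mulmxBl opprB [z + _]addrC addrK.
  apply/continuous_mxP => e e0'.
  have := (continuous_mxP _ _).1 c1 e e0'; apply: filterS => x'; apply: le_trans.
  apply: le_trans (ler_dist_dist _ _) _; rewrite !gE.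
  by rewrite [- (_ - _)]opprD addrACA subrr add0r opprK addrC distrC.
(* The fixed point comes from compactness rather than iteration: at a minimum p of |g x - x| on B,
   the contraction gives |g (g p) - g p| <= |g p - p| / 2, so the minimum is 0. *)
have [p] := EVT_min_rV (ex_intro _ x0 Bx0) cB hc.
rewrite in_setE => Bp pmin.
exists p; first by apply: d1A; exact: le_lt_trans Bp _.
have gp : g p = p.
  have := pmin (g p); rewrite in_setE => /(_ (gB _ Bp)) h.
  have := le_trans h (gL _ _ (gB _ Bp) Bp) => h2.
  apply/eqP; rewrite -subr_eq0 -normr_le0; lra.
have : (f p - y) *m invmx J = 0.
  by apply: oppr_inj; apply: (addrI p); rewrite -[LHS]/(g p) gp oppr0 addr0.
move=> /(congr1 (mulmx^~ J)); rewrite mulmxKV// mul0mx => /eqP.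
by rewrite subr_eq0 => /eqP.
Qed.

End local_inversion.

Section lifting.
Context {R : realType}.

(** The differentiability half of the inverse function theorem: q is only known to be continuous,
    and a right inverse of the derivative of f carries the derivative of f \o q back to q. *)
Lemma near_lipschitz_lift k m n (q : 'rV[R]_k -> 'rV[R]_m) (f : 'rV[R]_m -> 'rV[R]_n)
    z0 J N M :
  has_jacobian f (q z0) J -> J *m N = 1%:M -> {for z0, continuous q} ->
  has_jacobian (f \o q) z0 M -> has_jacobian q z0 (M *m N).
Proof.
move=> fJ JN qc fqM e e0.
have [K K0 KN] := mulmx_norm_bound N.
have [C C0 CMN] := mulmx_norm_bound (M *m N).
(* C' is the first, crude bound |q z - q z0| <= C' |z - z0|. The constant e1 serves twice: K e1 <=
   1/2 absorbs |q z - q z0| to reach this bound, then K e1 C' <= e / 2 makes the error small; e2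
   gives the other e / 2. *)
pose C' := 2 * (C + K).
have C'0 : 0 < C' by rewrite mulr_gt0// addr_gt0.
pose e1 := Num.min (2 * K)^-1 (e / (2 * K * C')).
have K20 : 0 < 2 * K by rewrite mulr_gt0.
have e10 : 0 < e1 by rewrite lt_min invr_gt0 K20 divr_gt0// mulr_gt0.
pose e2 := Num.min 1 (e / (2 * K)).
have e20 : 0 < e2 by rewrite lt_min ltr01 divr_gt0.
have h1 : \forall z \near z0, `|f (q z) - f (q z0) - (q z - q z0) *m J| <= e1 * `|q z - q z0|.
  exact: qc (fJ e1 e10).
apply: filterS2 h1 (fqM e2 e20) => z /=.
set w := q z - q z0; set u := f (q z) - f (q z0); set t := z - z0 => h1 h2.
have h3 : `|w - t *m (M *m N)| <= K * (e1 * `|w| + e2 * `|t|).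
  have -> : w - t *m (M *m N) = ((u - t *m M) - (u - w *m J)) *m N.
    have -> : u - t *m M - (u - w *m J) = w *m J - t *m M.
      by rewrite [LHS]addrC opprB addrA subrK.
    by rewrite [RHS]mulmxBl -!mulmxA JN mulmx1.
  apply: le_trans (KN _) _; apply: ler_wpM2l; first exact: ltW.
  by rewrite (le_trans (ler_normB _ _))// addrC lerD.
have h4 : `|w| <= `|w - t *m (M *m N)| + `|t *m (M *m N)|.
  by rewrite -{1}(subrK (t *m (M *m N)) w); exact: ler_normD.
have h5 := CMN t.
have Ke1 : K * e1 <= 2^-1.
  rewrite -ler_pdivlMl// /e1 ge_min; apply/orP; left.
  by rewrite invfM mulrC.
have Ke1' : K * e1 * C' <= e / 2.
  rewrite -ler_pdivlMr// -ler_pdivlMl// /e1 ge_min; apply/orP; right.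
  by rewrite le_eqVlt; apply/orP; left; apply/eqP; rewrite !invfM; ring.
have Ke2 : K * e2 <= e / 2.
  rewrite -ler_pdivlMl// /e2 ge_min; apply/orP; right.
  by rewrite le_eqVlt; apply/orP; left; apply/eqP; rewrite !invfM; ring.
have Ke2' : K * e2 <= K by rewrite ger_pMr// /e2 ge_min lexx.
have t0 : 0 <= `|t| by [].
have w0 : 0 <= `|w| by [].
have h6 : K * e1 * `|w| <= 2^-1 * `|w| by rewrite ler_wpM2r.
have h7 : K * e2 * `|t| <= K * `|t| by rewrite ler_wpM2r.
have h8 : `|w| <= C' * `|t|.
  by move: h3; rewrite mulrDr !mulrA /C' => h3; lra.
have h9 : K * e1 * `|w| <= K * e1 * (C' * `|t|) by rewrite ler_wpM2l// mulr_ge0// ltW.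
have h10 : K * e1 * C' * `|t| <= e / 2 * `|t| by rewrite ler_wpM2r.
have h11 : K * e2 * `|t| <= e / 2 * `|t| by rewrite ler_wpM2r.
move: h3 h9 h10; rewrite mulrDr !mulrA => h3 h9 h10.
by lra.
Qed.

End lifting.

Section matrix_continuity.
Context {R : realType}.

Lemma continuous_mx_coord (T : topologicalType) m n (f : T -> 'M[R]_(m, n)) (x : T) :
  (forall i j, {for x, continuous (fun y => f y i j)}) -> {for x, continuous f}.
Proof.
move=> fc A /nbhs_normP[e e0 eA].
have e20 : 0 < e / 2 by rewrite divr_gt0.
have : \forall y \near x, forall p : 'I_m * 'I_n, `|f x p.1 p.2 - f y p.1 p.2| <= e / 2.
  apply: filter_forall => -[i j] /=.
  by have /cvgrPdist_le := fc i j; apply.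
apply: filterS => y h; apply: eA.
apply: (@le_lt_trans _ _ (e / 2)); last by rewrite ltr_pdivrMr// ltr_pMr// ltr1n.
apply: ler_mx_norm; first exact: ltW.
by move=> i j; rewrite !mxE distrC; exact: (h (i, j)).
Qed.

Lemma continuous_coord (T : topologicalType) m n (f : T -> 'M[R]_(m, n)) (x : T) i j :
  {for x, continuous f} -> {for x, continuous (fun y => f y i j)}.
Proof.
move=> fc; apply: (@continuous_comp _ _ _ f (fun M : 'M[R]_(m, n) => M i j)) => //.
exact: coord_continuous.
Qed.

Lemma continuous_sum (T : topologicalType) (I : Type) (s : seq I) (P : pred I)
    (F : I -> T -> R) (x : T) :
  (forall i, P i -> {for x, continuous (F i)}) ->
  {for x, continuous (fun y => \sum_(i <- s | P i) F i y)}.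
Proof.
move=> Fc; change (continuous_at x (fun y => \sum_(i <- s | P i) F i y)); elim: s => [|i s IHs].
  under eq_fun do rewrite big_nil; exact: cst_continuous.
under eq_fun do rewrite big_cons.
case: ifPn => // Pi; apply: continuousD; [exact: Fc|exact: IHs].
Qed.

Lemma continuous_prod (T : topologicalType) (I : Type) (s : seq I) (P : pred I)
    (F : I -> T -> R) (x : T) :
  (forall i, P i -> {for x, continuous (F i)}) ->
  {for x, continuous (fun y => \prod_(i <- s | P i) F i y)}.
Proof.
move=> Fc; change (continuous_at x (fun y => \prod_(i <- s | P i) F i y)); elim: s => [|i s IHs].
  under eq_fun do rewrite big_nil; exact: cst_continuous.
under eq_fun do rewrite big_cons.
case: ifPn => // Pi; apply: continuousM; [exact: Fc|exact: IHs].
Qed.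

Lemma continuous_mulmx (T : topologicalType) m n p (f : T -> 'M[R]_(m, n))
    (g : T -> 'M[R]_(n, p)) (x : T) :
  {for x, continuous f} -> {for x, continuous g} ->
  {for x, continuous (fun y => f y *m g y)}.
Proof.
move=> fc gc; apply: continuous_mx_coord => i j.
change (continuous_at x (fun y => (f y *m g y) i j)); under eq_fun do rewrite mxE.
by apply: continuous_sum => k _; apply: continuousM; exact: continuous_coord.
Qed.

Lemma continuous_det (T : topologicalType) n (f : T -> 'M[R]_n) (x : T) :
  {for x, continuous f} -> {for x, continuous (fun y => \det (f y))}.
Proof.
move=> fc; apply: continuous_sum => s _.
apply: continuousM; first exact: cst_continuous.
by apply: continuous_prod => i _; exact: continuous_coord.
Qed.

End matrix_continuity.

(** * Change of variables *)

Section measure_le_integral.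
Context {R : realType} (k : nat).

Let r (j : nat) : R := j.+1%:R^-1.

Let r0 j : 0 < r j. Proof. by rewrite invr_gt0. Qed.

Let near_pair (O : set 'rV[R]_k) j : set ('rV[R]_k * 'rV[R]_k) :=
  [set p | [/\ O p.1, O p.2 & ball p.1 (r j) p.2]].

Let measurable_near_pair O j : measurable O -> measurable (near_pair O j).
Proof.
move=> mO; have -> : near_pair O j = (O `*` O) `&`
    (fun p => p.1 - p.2) @^-1` (ball 0 (r j)).
  apply/seteqP; split => -[x y] /=; rewrite /near_pair /= -!ball_normE /= sub0r normrN.
    by move=> [].
  by move=> [[]].
apply: measurableI; first exact: measurableX.
have mB : measurable_fun setT ((fun p => p.1 - p.2) : 'rV[R]_k * 'rV[R]_k -> 'rV[R]_k).
  apply: measurable_fun_rV => i; rewrite /comp /rV_coord.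
  under eq_fun do rewrite !mxE.
  apply: measurable_funB.
    by apply: (measurableT_comp (@measurable_rV_coord R k i)); exact: measurable_fst.
  by apply: (measurableT_comp (@measurable_rV_coord R k i)); exact: measurable_snd.
rewrite -[X in measurable X]setTI; apply: mB => //; exact: measurable_ball_rV.
Qed.

(* Averaging the indicator of O over small balls turns a bound on the measure
   of balls into a bound on the measure of O, by Tonelli and Fatou. *)
Lemma measure_le_integral (O : set 'rV[R]_k) (nu : {measure set 'rV[R]_k -> \bar R})
    (g : 'rV[R]_k -> R) (C : R) :
  open O -> (lebesgue_rV k O < +oo)%E -> (nu O < +oo)%E ->
  measurable_fun O g -> (forall y, O y -> 0 <= g y <= C) ->
  (forall y s, O y -> 0 < s -> (nu (O `&` ball y s) <= (C * (2 * s) ^+ k)%:E)%E) ->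
  (forall y e, O y -> 0 < e -> \forall s \near 0^'+,
     (nu (O `&` ball y s) <= ((g y + e) * (2 * s) ^+ k)%:E)%E) ->
  (nu O <= \int[lebesgue_rV k]_(x in O) (g x)%:E)%E.
Proof.
move=> oO lO nuO mg gC domC limg.
have mO : measurable O by exact: open_measurable_rV.
pose nO : {finite_measure set 'rV[R]_k -> \bar R} := mfrestr mO nuO.
pose w j : R := ((2 * r j) ^+ k)^-1.
have w0 j : 0 < w j by rewrite invr_gt0 exprn_gt0// mulr_gt0.
have xsE j y : O y -> xsection (near_pair O j) y = O `&` ball y (r j).
  move=> Oy; apply/seteqP; split => x; rewrite /xsection /= in_setE /near_pair/=.
    by move=> [].
  by move=> [].
have ysE j y : O y -> ysection (near_pair O j) y = O `&` ball y (r j).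
  move=> Oy; apply/seteqP; split => x; rewrite /ysection /= in_setE /near_pair/=.
    by move=> [? ? /ball_sym].
  by move=> [? /ball_sym].
have xs0 j y : ~ O y -> xsection (near_pair O j) y = set0.
  move=> Oy; apply/seteqP; split => x //; rewrite /xsection /= in_setE /near_pair/=.
  by move=> [].
have ys0 j y : ~ O y -> ysection (near_pair O j) y = set0.
  move=> Oy; apply/seteqP; split => x //; rewrite /ysection /= in_setE /near_pair/=.
  by move=> [].
(* The weight w j is the inverse volume of a ball of radius r j: f j x equals 1 as soon as this ball
   lies in O, and h j y is the mean density of nu around y. By Tonelli both have the same integral,
   namely w j times the product measure of the set of near pairs. *)
pose f j x := ((w j)%:E * lebesgue_rV k (ysection (near_pair O j) x))%E.
pose h j y := ((w j)%:E * nO (xsection (near_pair O j) y))%E.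
have mf j : measurable_fun setT (f j).
  apply: measurable_funeM; apply: measurable_fun_ysection.
  exact: measurable_near_pair.
have mh j : measurable_fun setT (h j).
  apply: measurable_funeM; apply: measurable_fun_xsection.
  exact: measurable_near_pair.
have fh j : (\int[nO]_(x in O) f j x = \int[lebesgue_rV k]_(y in O) h j y)%E.
  have -> : (\int[nO]_(x in O) f j x = \int[nO]_x f j x)%E.
    rewrite integral_mkcond; apply: eq_integral => x _; rewrite patchE.
    case: ifPn => //; rewrite notin_setE => Ox.
    by rewrite /f ys0// measure0 mule0.
  have -> : (\int[lebesgue_rV k]_(x in O) h j x = \int[lebesgue_rV k]_x h j x)%E.
    rewrite integral_mkcond; apply: eq_integral => x _; rewrite patchE.
    case: ifPn => //; rewrite notin_setE => Ox.
    by rewrite /h xs0// measure0 mule0.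
  rewrite ge0_integralZl//; last 2 first.
    by apply: measurable_fun_ysection; exact: measurable_near_pair.
    by rewrite lee_fin ltW.
  rewrite ge0_integralZl//; last 2 first.
    by apply: measurable_fun_xsection; exact: measurable_near_pair.
    by rewrite lee_fin ltW.
  congr (_ * _)%E; apply/esym.
  rewrite -[LHS]/((lebesgue_rV k \x nO)%E (near_pair O j)).
  rewrite -[RHS]/((lebesgue_rV k \x^ nO)%E (near_pair O j)).
  apply: product_measure_unique; last exact: measurable_near_pair.
  by move=> A B mA mB; exact: product_measure2E.
have near_r (Q : R -> Prop) : (\forall s \near 0^'+, Q s) -> \forall j \near \oo, Q (r j).
  move=> [e /= e0 eQ]; near=> j; apply: eQ => //=.
  rewrite sub0r normrN gtr0_norm//.
  by near: j; exact: (near_infty_natSinv_lt (PosNum e0)).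
have hE j y : O y -> h j y = ((w j)%:E * nu (O `&` ball y (r j)))%E.
  move=> Oy; rewrite /h xsE// /nO /= /mfrestr /mrestr.
  by congr (_ * nu _)%E; rewrite setIAC setIid.
(* O is open, so f j x is eventually 1 at each point of O, and Fatou bounds the mass of O from
   above. *)
have nuf : (nu O <= limn_einf (fun j => \int[nO]_(x in O) f j x))%E.
  have -> : nu O = (\int[nO]_(x in O) limn_einf (f ^~ x))%E.
    transitivity (\int[nO]_(x in O) (cst 1%E x))%E.
      by rewrite integral_cst// mul1e /nO /= /mfrestr /mrestr setIid.
    apply: eq_integral => x; rewrite in_setE => Ox.
    suff fx : f j x @[j --> \oo] --> 1%E by rewrite (cvg_limn_einf_sup fx).1.
    apply: cvg_near_cst.
    have : \forall j \near \oo, ball x (r j) `<=` O.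
      apply: (near_r (fun s => ball x s `<=` O)).
      have /nbhs_ballP[e /= e0 eO] : nbhs x O by exact: open_nbhs_nbhs.
      near=> s; apply: subset_trans eO; apply: le_ball.
      by near: s; exact: nbhs_right_le.
    apply: filterS => j jO; rewrite /f ysE// (setIidr jO) lebesgue_rV_ball//.
    by rewrite -EFinM mulVf// gt_eqF// exprn_gt0// mulr_gt0.
  by apply: fatou => // [j|j x Ox]; [exact: measurable_funTS|rewrite /f mule_ge0// lee_fin ltW].
(* Only upper bounds on h j are available, and h j itself need not converge. Its maximum with g does
   converge, to g, and is still bounded by C, so that dominated convergence applies. *)
pose H j y := maxe (h j y) (g y)%:E.
have mH j : measurable_fun O (H j).
  by apply: measurable_maxe; [exact: measurable_funTS|exact/measurable_EFinP].
have HC j y : O y -> (`|H j y| <= C%:E)%E.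
  move=> Oy; have /andP[g0 gC'] := gC y Oy.
  rewrite gee0_abs; last by rewrite /H le_max orbC lee_fin g0.
  rewrite /H ge_max lee_fin gC' andbT hE//.
  rewrite -[leRHS](_ : (w j)%:E * (C * (2 * r j) ^+ k)%:E = _)%E; last first.
    by rewrite -EFinM mulrCA mulVf ?mulr1// gt_eqF// exprn_gt0// mulr_gt0.
  by apply: lee_wpmul2l; [rewrite lee_fin ltW|exact: domC].
have iC : (lebesgue_rV k).-integrable O (cst C%:E).
  apply/integrableP; split; first exact: measurable_cst.
  by rewrite integral_cst//= lte_mul_pinfty.
have [] := @dominated_convergence _ _ R (lebesgue_rV k) O mO H (EFin \o g) (cst C%:E) mH.
- exact/measurable_EFinP.
- apply: aeW => y Oy; apply/fine_cvgP.
  have /andP[g0 _] := gC y Oy; have H0 j : (0 <= H j y)%E.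
    by rewrite /H le_max orbC lee_fin g0.
  split.
    apply: nearW => j; rewrite ge0_fin_numE// (le_lt_trans _ (ltry C))//.
    by rewrite -(gee0_abs (H0 j)); exact: HC.
  apply/cvgrPdist_le => e e0; have := near_r _ (limg y e Oy e0).
  apply: filterS => j hj.
  have Hge : (H j y <= (g y + e)%:E)%E.
    rewrite /H ge_max lee_fin lerDl (ltW e0) andbT hE//.
    rewrite -[leRHS](_ : (w j)%:E * ((g y + e) * (2 * r j) ^+ k)%:E = _)%E.
      by apply: lee_wpmul2l => //; rewrite lee_fin ltW.
    by rewrite -EFinM mulrCA mulVf ?mulr1// gt_eqF// exprn_gt0// mulr_gt0.
  have gH : ((g y)%:E <= H j y)%E by rewrite /H le_max lexx orbT.
  have : H j y \is a fin_num.
    by rewrite ge0_fin_numE// (le_lt_trans Hge) ?ltry.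
  move=> Hf; rewrite -(fineK Hf) !lee_fin in Hge gH.
  by rewrite /= distrC ger0_norm ?subr_ge0// lerBlDl.
- exact: iC.
- by apply: aeW => y j Oy; exact: HC.
move=> _ _ Hg; apply: (le_trans nuf); rewrite limn_einf_lim.
rewrite -(cvg_lim _ Hg)//; apply: lee_lim; first exact: is_cvg_einfs.
  by apply/cvg_ex; eexists; exact: Hg.
near=> j; apply: (@le_trans _ _ (\int[lebesgue_rV k]_(y in O) h j y)%E).
  by rewrite -fh; apply: ereal_inf_lbound; exists j => /=.
apply: ge0_le_integral => //.
- by move=> y _; rewrite /h mule_ge0// lee_fin ltW.
- exact: measurable_funTS.
- by move=> y Oy; rewrite /H le_max lexx.
Unshelve. all: by end_near. Qed.
End measure_le_integral.

Section change_of_variables.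
Context {R : realType} (k : nat).
Implicit Types (O V E : set 'rV[R]_k) (T S : 'rV[R]_k -> 'rV[R]_k) (d : 'rV[R]_k -> R).

Lemma lebesgue_rV_parallelotope (D : 'M[R]_k) (c : 'rV[R]_k) r :
  D \in unitmx -> 0 < r ->
  let Z := [set z | ball 0 r ((z - c) *m invmx D)] in
  measurable Z /\ lebesgue_rV k Z = (`|\det D| * (2 * r) ^+ k)%:E.
Proof.
move=> Du r0 Z.
have mA : measurable [set v : 'rV[R]_k | ball 0 r (v *m invmx D)].
  by rewrite -[X in measurable X]setTI; apply: measurable_mulmxr => //; exact: measurable_ball_rV.
split.
  by rewrite -[X in measurable X]setTI; exact: (measurable_addr_rV (- c) measurableT mA).
rewrite [LHS](lebesgue_rVD (- c) mA) lebesgue_rV_mulmx//; last 2 first.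
  by rewrite det_inv invr_eq0 -unitfE -unitmxE.
  exact: measurable_ball_rV.
by rewrite lebesgue_rV_ball// -EFinM det_inv normfV invrK.
Qed.

(** One half of the change of variables formula: [measure_le_integral] for the image of d2 dz under
    S. With D the derivative of T at y, T maps a small ball of radius s around y into a
    parallelotope of volume |det D| (2 (1 + h) s)^k; the Lipschitz bound on T provides the uniform
    domination. *)
Lemma le_integral_image O V T S d1 d2 (L C : R) :
  open O -> open V -> (lebesgue_rV k O < +oo)%E -> (lebesgue_rV k V < +oo)%E ->
  (forall x, O x -> V (T x)) -> (forall z, V z -> O (S z)) ->
  (forall x, O x -> S (T x) = x) -> (forall z, V z -> T (S z) = z) ->
  (forall z, V z -> {for z, continuous S}) ->
  (forall x, O x -> differentiable T x /\ jacobian T x \in unitmx) ->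
  0 < L -> (forall x y, O x -> O y -> `|T x - T y| <= L * `|x - y|) ->
  (forall z, V z -> {for z, continuous d2}) -> (forall z, V z -> 0 <= d2 z <= C) ->
  (forall x, O x -> d1 x = d2 (T x) * `|\det (jacobian T x)|) ->
  measurable_fun O d1 -> (forall x, O x -> d1 x <= C) ->
  (\int[lebesgue_rV k]_(z in V) (d2 z)%:E <= \int[lebesgue_rV k]_(x in O) (d1 x)%:E)%E.
Proof.
move=> oO oV lO lV TOV SVO ST TS Sc Td L0 TL d2c d2C d1E md1 d1C.
have mV : measurable V by exact: open_measurable_rV.
have mS : measurable_fun V S by exact: continuous_measurable_rV_rV.
have md2 : measurable_fun V d2 by exact: continuous_measurable_rV.
have d20 z : V z -> 0 <= d2 z by move=> /d2C/andP[].
have mpre A : measurable A -> measurable (V `&` S @^-1` A) by move=> mA; exact: mS.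
have dens_le A (Z : set 'rV[R]_k) (c : R) : measurable A -> measurable Z -> 0 <= c ->
    (forall z, V z -> A (S z) -> Z z /\ d2 z <= c) ->
    (\int[lebesgue_rV k]_(z in V `&` S @^-1` A) (d2 z)%:E <= c%:E * lebesgue_rV k Z)%E.
  move=> mA mZ c0 AZ.
  apply: (@le_trans _ _ (\int[lebesgue_rV k]_(z in V `&` S @^-1` A) cst c%:E z)%E).
    apply: ge0_le_integral => //.
    - exact: mpre.
    - by move=> z [Vz _]; rewrite lee_fin d20.
    - by apply/measurable_EFinP; apply: (measurable_funS mV _ md2) => z [].
    - by move=> z [Vz Az]; rewrite lee_fin; have [] := AZ z Vz Az.
  rewrite integral_cst; last exact: mpre.
  apply: lee_wpmul2l; first by rewrite lee_fin.
  apply: le_measure; rewrite ?in_setE//; first exact: mpre.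
  by move=> z [Vz Az]; have [] := AZ z Vz Az.
pose nu := densm (lebesgue_rV k) mV mS md2 d20.
have nuE A : nu A = (\int[lebesgue_rV k]_(z in V `&` S @^-1` A) (d2 z)%:E)%E by [].
have mO : measurable O by exact: open_measurable_rV.
have nuO : nu O = (\int[lebesgue_rV k]_(z in V) (d2 z)%:E)%E.
  rewrite nuE; congr (integral _ _ _); apply/seteqP; split => [z []//|z Vz].
  by split=> //; exact: SVO.
have nule := dens_le.
have [emO|/set0P[y0 Oy0]] := eqVneq O set0.
  have -> : V = set0.
    by apply/seteqP; split => // z /SVO; rewrite emO.
  by rewrite integral_set0 integral_ge0// => x Ox; rewrite lee_fin d1E//
    mulr_ge0// d20//; exact: TOV.
have C0 : 0 <= C by have /andP[/le_trans] := d2C _ (TOV _ Oy0); apply.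
rewrite -nuO; apply: (@measure_le_integral _ _ O nu d1 (Num.max C (C * L ^+ k))) => //.
- rewrite nuO; apply: (@le_lt_trans _ _ (C%:E * lebesgue_rV k V)%E).
    rewrite -nuO; apply: nule => // z Vz _; split => //.
    by have /andP[] := d2C z Vz.
  by apply: lte_mul_pinfty.
- move=> y Oy; rewrite le_max d1C// orTb andbT d1E// mulr_ge0// d20//.
  exact: TOV.
- move=> y s Oy s0.
  apply: (@le_trans _ _ (C%:E * lebesgue_rV k (ball (T y) (L * s)))%E).
    apply: nule => //.
    - by apply: measurableI => //; exact: measurable_ball_rV.
    - exact: measurable_ball_rV.
    move=> z Vz [SzO ySz]; split; last by have /andP[] := d2C z Vz.
    rewrite -(TS z Vz) -ball_normE /=; apply: le_lt_trans (TL _ _ Oy SzO) _.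
    by rewrite ltr_pM2l//; move: ySz; rewrite -ball_normE.
  rewrite lebesgue_rV_ball ?mulr_gt0// -EFinM lee_fin.
  rewrite (_ : 2 * (L * s) = L * (2 * s)); last by ring.
  rewrite [(L * _) ^+ k]exprMn mulrA ler_wpM2r// ?exprn_ge0//; first by rewrite ltW// mulr_gt0.
  by rewrite le_max lexx orbT.
move=> y e Oy e0.
have [Tdy TJ] := Td y Oy.
set D := jacobian T y in TJ.
have [K K0 KD] := mulmx_norm_bound (invmx D).
have Dpos : 0 < `|\det D| by rewrite normr_gt0 -unitfE -unitmxE.
(* A single h bounds both the variation of the density and the relative enlargement of the
   parallelotope; at h = 0 the left side is d1 y, so continuity provides a positive h. *)
have [h h0 hle] : exists2 h, 0 < h & (d2 (T y) + h) * `|\det D| * (1 + h) ^+ k <= d1 y + e.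
  have cp : {for 0, continuous (fun h : R => (d2 (T y) + h) * `|\det D| * (1 + h) ^+ k)}.
    apply: continuousM; first apply: continuousM.
    - by apply: continuousD; [exact: cst_continuous|exact: cvg_id].
    - exact: cst_continuous.
    - apply: (@continuous_comp _ _ _ (fun h : R => 1 + h) (fun x : R => x ^+ k)).
        by apply: continuousD; [exact: cst_continuous|exact: cvg_id].
      exact: exprn_continuous.
  have /nbhs_ballP[r /= r0 rP] : \forall h \near 0,
      (d2 (T y) + h) * `|\det D| * (1 + h) ^+ k <= d1 y + e.
    apply: (cvgr_le _ cp); rewrite !addr0 expr1n mulr1 d1E//.
    by rewrite ltrDl.
  exists (r / 2); first by rewrite divr_gt0.
  apply: rP; rewrite /ball /= sub0r normrN gtr0_norm ?divr_gt0//.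
  by rewrite ltr_pdivrMr// ltr_pMr// ltr1n.
have Tc : {for y, continuous T} by exact: differentiable_continuous.
have n1 : \forall x \near y, d2 (T x) <= d2 (T y) + h.
  have dTc : {for y, continuous (d2 \o T)}.
    by apply: continuous_comp => //; apply: d2c; exact: TOV.
  have := (continuous_mxP _ _).1 dTc h h0; apply: filterS => x /=.
  by rewrite ler_norml => /andP[_]; rewrite lerBlDl.
have n2 := differentiable_has_jacobian Tdy (divr_gt0 h0 K0).
have /nbhs_normP[r r0 rP] : \forall x \near y,
    d2 (T x) <= d2 (T y) + h /\
    `|T x - T y - (x - y) *m D| <= h / K * `|x - y| by exact: filterI.
near=> s.
have s0 : 0 < s by near: s; exact: nbhs_right_gt.
have sr : s <= r by near: s; exact: nbhs_right_le.
have h1 : 0 < (1 + h) * s by rewrite mulr_gt0// addr_gt0.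
have [mZ lZ] := lebesgue_rV_parallelotope (T y) TJ h1.
apply: (@le_trans _ _ ((d2 (T y) + h)%:E * lebesgue_rV k _)%E).
  apply: (nule _ _ _ _ mZ) => //.
  - by apply: measurableI => //; exact: measurable_ball_rV.
  - by rewrite addr_ge0 ?d20 ?ltW//; exact: TOV.
  move=> z Vz [SzO ySz].
  have ys : `|S z - y| < s by move: ySz; rewrite -ball_normE /= distrC.
  have [d2z Tz] := rP _ (lt_le_trans ys sr).
  split; last by rewrite -(TS z Vz).
  rewrite -ball_normE /= sub0r normrN -{1}(TS z Vz).
  have -> : (T (S z) - T y) *m invmx D =
      (S z - y) + (T (S z) - T y - (S z - y) *m D) *m invmx D.
    by rewrite [X in _ = _ + X]mulmxBl mulmxK// [RHS]addrC subrK.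
  apply: le_lt_trans (ler_normD _ _) _.
  have := KD (T (S z) - T y - (S z - y) *m D).
  have : K * `|T (S z) - T y - (S z - y) *m D| <= h * `|S z - y|.
    by rewrite -ler_pdivlMl// mulrA [K^-1 * h]mulrC.
  have : h * `|S z - y| <= h * s by rewrite ler_wpM2l// ltW.
  lra.
rewrite lZ -EFinM lee_fin.
have -> : (d2 (T y) + h) * (`|\det D| * (2 * ((1 + h) * s)) ^+ k) =
   (d2 (T y) + h) * `|\det D| * (1 + h) ^+ k * (2 * s) ^+ k.
  by rewrite (_ : 2 * _ = (1 + h) * (2 * s)); [rewrite exprMn; ring|ring].
by rewrite ler_wpM2r// exprn_ge0// mulr_ge0// ltW.
Unshelve. all: by end_near. Qed.

End change_of_variables.

Section image_measure.
Context {R : realType} (k : nat).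
Implicit Types (O V E : set 'rV[R]_k) (T S : 'rV[R]_k -> 'rV[R]_k) (d : 'rV[R]_k -> R).

Definition locally_lipschitz O T := forall x, O x ->
  exists2 L, 0 < L & exists2 r, 0 < r & forall y z, `|y - x| < r -> `|z - x| < r ->
    `|T y - T z| <= L * `|y - z|.

(** Both sides are measures in E. On small open sets [le_integral_image], applied to T and to its
    inverse S, makes them equal and finite; agreement on open subsets spreads to measurable ones by
    the pi-system argument, then to all E by a countable cover. *)
Lemma integral_image O V T S d1 d2 :
  open O -> open V ->
  (forall x, O x -> V (T x)) -> (forall z, V z -> O (S z)) ->
  (forall x, O x -> S (T x) = x) -> (forall z, V z -> T (S z) = z) ->
  (forall x, O x -> differentiable T x) -> (forall z, V z -> differentiable S z) ->
  locally_lipschitz O T -> locally_lipschitz V S ->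
  (forall x, O x -> {for x, continuous d1}) -> (forall z, V z -> {for z, continuous d2}) ->
  (forall x, O x -> 0 <= d1 x) -> (forall z, V z -> 0 <= d2 z) ->
  (forall x, O x -> d1 x = d2 (T x) * `|\det (jacobian T x)|) ->
  forall E, measurable E ->
  (\int[lebesgue_rV k]_(x in O `&` E) (d1 x)%:E =
   \int[lebesgue_rV k]_(z in V `&` S @^-1` E) (d2 z)%:E)%E.
Proof.
move=> oO oV TOV SVO ST TS Td Sd TL SL d1c d2c d10 d20 d1E E mE.
have Tc x : O x -> {for x, continuous T} by move=> Ox; exact: differentiable_continuous (Td x Ox).
have Sc x : V x -> {for x, continuous S} by move=> Vx; exact: differentiable_continuous (Sd x Vx).
have JTS x : O x -> jacobian T x *m jacobian S (T x) = 1%:M.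
  move=> Ox; rewrite -jacobian_comp//; [|exact: Td|by apply: Sd; exact: TOV].
  have : has_jacobian (S \o T) x 1%:M.
    apply: (@has_jacobian_near _ _ _ id).
      by apply: filterS (open_nbhs_nbhs (conj oO Ox)) => y Oy /=; rewrite ST.
    move=> e e0; apply/nbhs_normP; exists 1 => // y _; rewrite mulmx1 subrr normr0.
    by rewrite mulr_ge0 // ltW.
  by move=> /has_jacobianP[].
have JST z : V z -> jacobian S z *m jacobian T (S z) = 1%:M.
  move=> Vz; have := JTS (S z) (SVO z Vz); rewrite (TS z Vz) => h.
  exact: (mulmx1C h).
have Tu x : O x -> jacobian T x \in unitmx by move=> Ox; exact: (mulmx1_unit (JTS x Ox)).1.
have Su z : V z -> jacobian S z \in unitmx by move=> Vz; exact: (mulmx1_unit (JST z Vz)).1.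
have d2E z : V z -> d2 z = d1 (S z) * `|\det (jacobian S z)|.
  move=> Vz; rewrite d1E ?TS//; last exact: SVO.
  by rewrite -mulrA -normrM -det_mulmx mulmx1C ?JST// det1 normr1 mulr1.
have mO : measurable O by exact: open_measurable_rV.
have mV : measurable V by exact: open_measurable_rV.
have md1 : measurable_fun O d1 by exact: continuous_measurable_rV.
have md2 : measurable_fun V d2 by exact: continuous_measurable_rV.
have mS : measurable_fun V S by exact: continuous_measurable_rV_rV.
have mid : measurable_fun O (@id 'rV[R]_k) by exact: measurable_id.
pose m1 := densm (lebesgue_rV k) mO mid md1 d10.
pose m2 := densm (lebesgue_rV k) mV mS md2 d20.
rewrite -[LHS]/(m1 E) -[RHS]/(m2 E).
(* On a good set the bounds required by [le_integral_image] hold for T and for S with common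
   constants. Goodness passes to open subsets, and each point of O has a good neighbourhood. *)
pose good (B : set 'rV[R]_k) := open B /\ B `<=` O /\ exists L, exists C,
  [/\ 0 < L, (forall x y, B x -> B y -> `|T x - T y| <= L * `|x - y|),
      (forall x y, B x -> B y -> `|x - y| <= L * `|T x - T y|),
      (lebesgue_rV k B < +oo)%E /\ (lebesgue_rV k (V `&` S @^-1` B) < +oo)%E &
      (forall x, B x -> d1 x <= C /\ d2 (T x) <= C)].
have goodS B B' : open B' -> B' `<=` B -> good B -> good B'.
  move=> oB' B'B [oB [BO [L [C [L0 TL' SL' [lB lV] dC]]]]].
  have mpre X : open X -> measurable (V `&` S @^-1` X).
    by move=> oX; apply: open_measurable_rV; exact: open_preimage_in.
  split => //; split; first exact: subset_trans BO.
  exists L, C; split => //.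
  - by move=> x y /B'B Bx /B'B By; exact: TL'.
  - by move=> x y /B'B Bx /B'B By; exact: SL'.
  - split.
      apply: le_lt_trans lB; apply: le_measure; rewrite ?in_setE//; exact: open_measurable_rV.
    apply: le_lt_trans lV; apply: le_measure; rewrite ?in_setE; [exact: mpre|exact: mpre|].
    by move=> z [Vz /B'B].
  - by move=> x /B'B; exact: dC.
have good0 : good set0.
  split; first exact: open0.
  split => //; exists 1, 0; split => //.
  by rewrite preimage_set0 setI0 measure0.
have goodP x : O x -> exists2 B, good B & B x.
  move=> Ox; have [L1 L10 [r1 r10 TLx]] := TL x Ox.
  have [L2 L20 [r2 r20 SLx]] := SL (T x) (TOV x Ox).
  have nT : \forall y \near x, `|T y - T x| < r2.
    have := (continuous_mxP _ _).1 (Tc x Ox) (r2 / 2) (divr_gt0 r20 (ltr0n _ 2)).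
    by apply: filterS => y /le_lt_trans; apply; rewrite ltr_pdivrMr// ltr_pMr// ltr1n.
  have nd1 : \forall y \near x, d1 y <= d1 x + 1.
    have := (continuous_mxP _ _).1 (d1c x Ox) 1 ltr01.
    by apply: filterS => y; rewrite ler_norml => /andP[_]; rewrite lerBlDl.
  have nd2 : \forall y \near x, d2 (T y) <= d2 (T x) + 1.
    have dTc : {for x, continuous (d2 \o T)}.
      by apply: continuous_comp; [exact: Tc|apply: d2c; exact: TOV].
    have := (continuous_mxP _ _).1 dTc 1 ltr01.
    by apply: filterS => y; rewrite ler_norml => /andP[_]; rewrite lerBlDl.
  have /nbhs_normP[r r0 rP] : \forall y \near x, [/\ O y, `|y - x| < r1, `|T y - T x| < r2,
      d1 y <= d1 x + 1 & d2 (T y) <= d2 (T x) + 1].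
    have nO := open_nbhs_nbhs (conj oO Ox).
    have n12 : \forall y \near x, O y /\ `|y - x| < r1.
      by apply: filterI => //; exact: near_mx_dist.
    have n34 : \forall y \near x, d1 y <= d1 x + 1 /\ d2 (T y) <= d2 (T x) + 1.
      exact: filterI.
    by apply: filterS3 n12 nT n34 => y [? ?] ? [].
  have bP y : ball x r y -> `|y - x| < r by rewrite -ball_normE /= distrC.
  exists (ball x r); last exact: ballxx.
  split; first exact: ball_open.
  split; first by move=> y /bP /rP[].
  exists (Num.max L1 L2), (Num.max (d1 x + 1) (d2 (T x) + 1)); split.
  - by rewrite lt_max L10.
  - move=> y z /bP /rP[_ yr _ _ _] /bP /rP[_ zr _ _ _].
    apply: le_trans (TLx _ _ yr zr) _; rewrite ler_wpM2r//.
    by rewrite le_max lexx.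
  - move=> y z /bP /rP[Oy _ yr _ _] /bP /rP[Oz _ zr _ _].
    rewrite -{1}(ST y Oy) -{1}(ST z Oz); apply: le_trans (SLx _ _ yr zr) _.
    by rewrite ler_wpM2r// le_max lexx orbT.
  - split; first by rewrite lebesgue_rV_ball// ltry.
    apply: (@le_lt_trans _ _ (lebesgue_rV k (ball (T x) r2))).
      apply: le_measure; rewrite ?in_setE.
      + by apply: open_measurable_rV; apply: open_preimage_in => //; exact: ball_open.
      + exact: measurable_ball_rV.
      + move=> z [Vz /bP /rP[_ _ + _ _]]; rewrite (TS z Vz) -ball_normE /=.
        by rewrite distrC.
    by rewrite lebesgue_rV_ball// ltry.
  - by move=> y /bP /rP[_ _ _ h1 h2]; rewrite !le_max h1 h2 orbT.
have goodE B : good B -> m1 B = m2 B /\ (m1 B < +oo)%E.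
  move=> [oB [BO [L [C [L0 TLB SLB [lB lV] dC]]]]].
  pose V' := V `&` S @^-1` B.
  have oV' : open V' by exact: open_preimage_in.
  have mB : measurable B by exact: open_measurable_rV.
  have e1 : m1 B = (\int[lebesgue_rV k]_(x in B) (d1 x)%:E)%E.
    by rewrite /m1 /densm /= /density_measure preimage_id setIidr.
  have e2 : m2 B = (\int[lebesgue_rV k]_(x in V') (d2 x)%:E)%E by [].
  have TBV x : B x -> V' (T x).
    by move=> Bx; have Ox := BO _ Bx; split; [exact: TOV|rewrite /preimage /= ST].
  have V'V z : V' z -> V z by case.
  have V'B z : V' z -> B (S z) by case.
  have mdB1 : measurable_fun B d1 by exact: (measurable_funS mO BO md1).
  have mdV2 : measurable_fun V' d2 by exact: (measurable_funS mV V'V md2).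
  split.
    rewrite e1 e2; apply/eqP; rewrite eq_le; apply/andP; split.
    - apply: (@le_integral_image _ _ V' B S T d2 d1 L C) => //.
      + by move=> z /V'V; exact: TS.
      + by move=> z /BO; exact: ST.
      + by move=> z /BO; exact: Tc.
      + by move=> z /V'V Vz; split; [exact: Sd|exact: Su].
      + move=> y z Vy Vz; rewrite -{2}(TS y (V'V y Vy)) -{2}(TS z (V'V z Vz)).
        by apply: SLB; exact: V'B.
      + by move=> z /BO; exact: d1c.
      + by move=> z Bz; rewrite d10; [case: (dC z Bz)|exact: BO].
      + by move=> z /V'V; exact: d2E.
      + by move=> z Vz; rewrite -(TS z (V'V z Vz)); case: (dC _ (V'B z Vz)).
    - apply: (@le_integral_image _ _ B V' T S d1 d2 L C) => //.
      + by move=> z /BO; exact: ST.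
      + by move=> z /V'V; exact: TS.
      + by move=> z /V'V; exact: Sc.
      + by move=> z /BO Oz; split; [exact: Td|exact: Tu].
      + by move=> z /V'V; exact: d2c.
      + move=> z Vz; rewrite d20; last exact: V'V.
        by rewrite -(TS z (V'V z Vz)); case: (dC _ (V'B z Vz)).
      + by move=> z /BO; exact: d1E.
      + by move=> z Bz; case: (dC z Bz).
  rewrite e1; apply: (@le_lt_trans _ _ (\int[lebesgue_rV k]_(x in B) cst (Num.max 0 C)%:E x)%E).
    apply: ge0_le_integral => //.
    - by move=> x /BO /d10; rewrite lee_fin.
    - exact/measurable_EFinP.
    - by move=> x Bx; rewrite lee_fin le_max; case: (dC x Bx) => ->; rewrite orbT.
  by rewrite integral_cst// lte_mul_pinfty// lee_fin le_max lexx.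
have goodM B A : good B -> measurable A -> m1 (B `&` A) = m2 (B `&` A).
  move=> gB mA; have [oB _] := gB.
  have mB : measurable B by exact: open_measurable_rV.
  rewrite ![B `&` A]setIC -[LHS]/(mrestr m1 mB A) -[RHS]/(mrestr m2 mB A).
  apply: (@g_sigma_algebra_measure_unique _ R _ (@open 'rV[R]_k) _ (fun=> setT)).
  - exact: open_measurable_rV.
  - by move=> _; exact: openT.
  - by rewrite bigcup_const.
  - by move=> X Y; exact: openI.
  - move=> X oX; rewrite /mrestr /=.
    by have [] := goodE (X `&` B) (goodS B _ (openI oX oB) (@subIsetr _ _ _) gB).
  - move=> _; rewrite [ltLHS](_ : _ = m1 B); last by rewrite /= /mrestr setTI.
    by have [] := goodE B gB.
  - have <- := @rV_measurableE R k; exact: mA.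
pose g0 p := if `[<good (rat_ball p)>] then @rat_ball R k p else set0.
(* Index 0 is the complement of O, where both measures vanish; the other indices enumerate the
   rational balls that are good. *)
pose g i := if i is j.+1 then if @unpickle ('rV[rat]_k * nat)%type j is Some p then g0 p else set0
            else ~` O.
have gg p : good (g0 p) by rewrite /g0; case: ifPn => [/asboolP|].
apply: (@g_sigma_algebra_measure_unique_cover _ R _ measurable _ g).
- by [].
- case=> [|j] /=; first exact: measurableC.
  by case: unpickle => [p|//]; apply: open_measurable_rV; have [] := gg p.
- apply/seteqP; split => // x _.
  have [/goodP[B [oB Bg] Bx]|nOx] := pselect (O x); last by exists 0%N.
  have [p px pB] := rat_ball_nbhs oB Bx.
  exists (pickle p).+1 => //=; rewrite pickleK /g0.
  case: ifPn => // /asboolP; case.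
  by apply: (goodS B) => //; apply: ball_open; rewrite invr_gt0.
- move=> [|j] A mA /=.
    rewrite /m1 /m2 /= /densm /= /density_measure preimage_id setIA setICr set0I.
    rewrite (_ : _ `&` _ = set0) ?integral_set0//.
    by apply/seteqP; split => // z [Vz [/= nO _]]; apply: nO; exact: SVO.
  case: unpickle => [p|]; last by rewrite !set0I !measure0.
  apply: goodM => //; apply: mA; split => //; exact: sigma_algebra_measurable.
- by move=> X [_]; apply.
Qed.

End image_measure.

(** * Independence of the Leray measure from the chart *)

Section C1_closure.
Context {R : realType}.

Lemma continuous_near_eq (T U : topologicalType) (f g : T -> U) (x : T) :
  (\forall y \near x, f y = g y) -> {for x, continuous f} -> {for x, continuous g}.
Proof.
move=> fg fc A; rewrite -(nbhs_singleton fg) => /fc fA.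
by apply: filterS2 fg fA => y /= <-.
Qed.

Lemma jacobian_near m n (f g : 'rV[R]_m -> 'rV[R]_n) (x : 'rV[R]_m) :
  (\forall y \near x, f y = g y) -> differentiable f x ->
  differentiable g x /\ jacobian g x = jacobian f x.
Proof.
move=> fg df; apply/has_jacobianP; apply: has_jacobian_near fg _.
exact: differentiable_has_jacobian.
Qed.

Lemma has_jacobian_mulmx m n (M : 'M[R]_(m, n)) (c : 'rV[R]_n) x :
  has_jacobian (fun v => v *m M + c) x M.
Proof.
move=> e e0; apply/nbhs_normP; exists 1 => // y _.
rewrite (_ : _ - (y - x) *m M = 0); first by rewrite normr0 mulr_ge0// ltW.
by rewrite mulmxBl opprD addrACA subrr addr0 subrr.
Qed.

Lemma has_jacobian_lsubmx n1 n2 (x : 'rV[R]_(n1 + n2)) :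
  has_jacobian (@lsubmx R 1 n1 n2) x (col_mx 1%:M 0).
Proof.
move=> e e0; apply/nbhs_normP; exists 1 => // y _.
rewrite (_ : _ - (y - x) *m _ = 0); first by rewrite normr0 mulr_ge0// ltW.
by rewrite -linearB -{2}(hsubmxK (y - x)) mul_row_col mulmx1 mulmx0 addr0 subrr.
Qed.

Lemma has_jacobian_row_mx m n1 n2 (f : 'rV[R]_m -> 'rV[R]_n1) (g : 'rV[R]_m -> 'rV[R]_n2)
    (x : 'rV[R]_m) M N :
  has_jacobian f x M -> has_jacobian g x N ->
  has_jacobian (fun v => row_mx (f v) (g v)) x (row_mx M N).
Proof.
move=> fM gN e e0; apply: filterS2 (fM e e0) (gN e e0) => y fy gy.
rewrite mul_mx_row opp_row_mx add_row_mx opp_row_mx add_row_mx.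
apply: ler_mx_norm => [|i j]; first by rewrite mulr_ge0// ltW.
have [j' ->|j' ->] := split_ordP j.
  by rewrite row_mxEl; apply: le_trans (ler_mx_entry _ _ _) fy.
by rewrite row_mxEr; apply: le_trans (ler_mx_entry _ _ _) gy.
Qed.

Lemma C1_on_comp m n p (V : set 'rV[R]_n) (W : set 'rV[R]_m)
    (F : 'rV[R]_n -> 'rV[R]_p) (f : 'rV[R]_m -> 'rV[R]_n) :
  C1_on V F -> C1_on W f -> C1_on (W `&` f @^-1` V) (F \o f).
Proof.
move=> [oV FC] [oW fC].
have fc x : W x -> {for x, continuous f}.
  by move=> /fC[df _]; exact: differentiable_continuous.
have oWV : open (W `&` f @^-1` V) by exact: open_preimage_in.
split => // x [Wx Vfx]; have [df Jf] := fC x Wx; have [dF JF] := FC _ Vfx.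
split; first exact: differentiable_comp.
apply: (@continuous_near_eq _ _ (fun w => jacobian f w *m jacobian F (f w))).
  apply: filterS (open_nbhs_nbhs (conj oWV (conj Wx Vfx))) => w [Ww Vw].
  by rewrite jacobian_comp//; [have [] := fC w Ww|have [] := FC _ Vw].
apply: continuous_mulmx => //.
by apply: (@continuous_comp _ _ _ f (jacobian F)) => //; exact: fc.
Qed.

Lemma C1_on_row_mx m n1 n2 (W : set 'rV[R]_m) (f : 'rV[R]_m -> 'rV[R]_n1)
    (g : 'rV[R]_m -> 'rV[R]_n2) :
  C1_on W f -> C1_on W g -> C1_on W (fun v => row_mx (f v) (g v)).
Proof.
move=> [oW fC] [_ gC]; split => // x Wx.
have J w : W w -> differentiable (fun v => row_mx (f v) (g v)) w /\
    jacobian (fun v => row_mx (f v) (g v)) w = row_mx (jacobian f w) (jacobian g w).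
  move=> Ww; apply/has_jacobianP; apply: has_jacobian_row_mx.
    by apply: differentiable_has_jacobian; have [] := fC w Ww.
  by apply: differentiable_has_jacobian; have [] := gC w Ww.
split; first by have [] := J x Wx.
apply: (@continuous_near_eq _ _ (fun w => row_mx (jacobian f w) (jacobian g w))).
  apply: filterS (open_nbhs_nbhs (conj oW Wx)) => w Ww.
  by have [_ ->] := J w Ww.
apply: continuous_mx_coord => i j.
have [_ fc] := fC x Wx; have [_ gc] := gC x Wx.
have [j' ->|j' ->] := split_ordP j.
  apply: (@continuous_near_eq _ _ (fun w => jacobian f w i j')); last exact: continuous_coord.
  by apply: filterS (open_nbhs_nbhs (conj oW Wx)) => w _; rewrite row_mxEl.
apply: (@continuous_near_eq _ _ (fun w => jacobian g w i j')); last exact: continuous_coord.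
by apply: filterS (open_nbhs_nbhs (conj oW Wx)) => w _; rewrite row_mxEr.
Qed.

Lemma C1_on_lsubmx n1 n2 (W : set 'rV[R]_(n1 + n2)) : open W ->
  C1_on W (@lsubmx R 1 n1 n2).
Proof.
move=> oW; split => // x Wx; have J w := (has_jacobianP _ _ _).1 (@has_jacobian_lsubmx n1 n2 w).
split; first by have [] := J x.
rewrite (_ : jacobian _ = cst (col_mx 1%:M 0)); first exact: cst_continuous.
by apply/funext => w; have [] := J w.
Qed.

Lemma C1_onS m n (V W : set 'rV[R]_m) (f : 'rV[R]_m -> 'rV[R]_n) :
  open V -> V `<=` W -> C1_on W f -> C1_on V f.
Proof. by move=> oV VW [_ fC]; split => // x /VW /fC. Qed.

End C1_closure.

Section det_relation.
Context {R : realType} (k d : nat).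

(* The rows of row_mx 1 S *m A span the tangent space of the fiber in each chart, so
   the two frames A1 and A2 differ by a block triangular change of basis. *)
Lemma leray_det_relation (A1 A2 : 'M[R]_(k + d)) (J : 'M[R]_(k + d, d)) (S1 S2 : 'M[R]_(k, d))
    (T : 'M[R]_k) :
  A2 \in unitmx -> dsubmx (A1 *m J) \in unitmx -> dsubmx (A2 *m J) \in unitmx ->
  row_mx 1%:M S1 *m A1 = T *m (row_mx 1%:M S2 *m A2) ->
  row_mx 1%:M S1 *m A1 *m J = 0 -> row_mx 1%:M S2 *m A2 *m J = 0 ->
  `|\det A1| * `|\det (dsubmx (A1 *m J))|^-1 =
  `|\det A2| * `|\det (dsubmx (A2 *m J))|^-1 * `|\det T|.
Proof.
move=> A2u D1u D2u X12 X1J X2J.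
(* Multiplication by E S replaces the first k rows of a frame by tangent vectors of the fiber and
   preserves the determinant. *)
pose E S : 'M[R]_(k + d) := block_mx 1%:M S 0 1%:M.
have detE S : \det (E S) = 1 by rewrite det_ublock !det1 mulr1.
pose B1 := E S1 *m A1; pose B2 := E S2 *m A2.
have BE S A : E S *m A = col_mx (row_mx 1%:M S *m A) (dsubmx A).
  rewrite /E /block_mx mul_col_mx; congr col_mx.
  by rewrite -{1}(vsubmxK A) mul_row_col mul0mx mul1mx add0r.
have B1E : B1 = col_mx (row_mx 1%:M S1 *m A1) (dsubmx A1) by exact: BE.
have B2E : B2 = col_mx (row_mx 1%:M S2 *m A2) (dsubmx A2) by exact: BE.
have dB1 : \det B1 = \det A1 by rewrite det_mulmx detE mul1r.
have dB2 : \det B2 = \det A2 by rewrite det_mulmx detE mul1r.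
have B2u : B2 \in unitmx by rewrite unitmxE dB2 -unitmxE.
pose C := B1 *m invmx B2.
have CB : C *m B2 = B1 by rewrite /C mulmxKV.
have uC : usubmx C = row_mx T 0.
  have : usubmx C *m B2 = row_mx T 0 *m B2.
    by rewrite [LHS]mul_usub_mx CB B1E col_mxKu X12 B2E mul_row_col mul0mx addr0.
  by move=> /(congr1 (mulmx^~ (invmx B2))); rewrite !mulmxK.
have CE : C = block_mx T 0 (dlsubmx C) (drsubmx C).
  rewrite -[LHS]vsubmxK uC /block_mx; congr col_mx.
  by rewrite -[LHS]hsubmxK.
(* J kills the tangent rows, so only the lower right block of C relates the transversal derivatives
   of F; this block then cancels between [dC] and [dD], which leaves det T. *)
have D12 : dsubmx (A1 *m J) = drsubmx C *m dsubmx (A2 *m J).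
  have : dsubmx (B1 *m J) = dsubmx (C *m (B2 *m J)) by rewrite mulmxA CB.
  rewrite B1E B2E !mul_col_mx X2J CE mul_block_col !col_mxKd mulmx0 add0r.
  by rewrite block_mxKdr !mul_dsub_mx => ->.
have dC : \det A1 = \det T * \det (drsubmx C) * \det A2.
  by rewrite -dB1 -CB det_mulmx dB2; congr (_ * _); rewrite CE det_lblock -CE.
have dD : \det (dsubmx (A1 *m J)) = \det (drsubmx C) * \det (dsubmx (A2 *m J)).
  by rewrite D12 det_mulmx.
have c0 : \det (drsubmx C) != 0.
  by move: D1u; rewrite unitmxE unitfE dD mulf_eq0 negb_or => /andP[].
have d0 : \det (dsubmx (A2 *m J)) != 0 by rewrite -unitfE -unitmxE.
rewrite dD dC !normrM.
have n1 : `|\det (drsubmx C)| != 0 by rewrite normr_eq0.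
have n2 : `|\det (dsubmx (A2 *m J))| != 0 by rewrite normr_eq0.
by rewrite invfM; field; rewrite n1 n2.
Qed.

End det_relation.

(** * Regularity of the fiber in one chart *)

Section leray_chart.
Context {R : realType} (k d : nat).
Variables (F : 'rV[R]_(k + d) -> 'rV[R]_d) (y : 'rV[R]_d) (V : set 'rV[R]_(k + d)).
Hypotheses (FC : C1_on V F) (FV : F @^-1` [set y] `<=` V).

Section one_chart.
Variables (W : set 'rV[R]_(k + d)) (psi : 'rV[R]_(k + d) -> 'rV[R]_(k + d))
  (U : set 'rV[R]_k) (s : 'rV[R]_k -> 'rV[R]_d).
Hypothesis chart : leray_coordinates F y W psi U s.

Let q z := row_mx z (s z).
Let P z := psi (q z).

Let psiC : C1_on W psi. Proof. by have [[]] := chart. Qed.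
Let psi_inj : {in W &, injective psi}. Proof. by have [[]] := chart. Qed.
Let oU : open U. Proof. by have [] := chart. Qed.

Lemma chart_jac_unit w : W w -> jacobian psi w \in unitmx.
Proof. by have [[_ _ +] _ _ _] := chart => /(_ w) /[apply]; rewrite row_free_unit. Qed.

Lemma chart_graph z : U z -> W (q z) /\ F (P z) = y.
Proof.
move=> Uz; have [_ _ WF _] := chart.
have : [set row_mx z (s z) | z in U] (q z) by exists z.
by rewrite -WF => -[].
Qed.

Lemma chart_graph_uniq w : W w -> F (psi w) = y -> U (lsubmx w) /\ w = q (lsubmx w).
Proof.
move=> Ww Fw; have [_ _ WF _] := chart.
have : [set row_mx z (s z) | z in U] w by rewrite -WF.
by move=> [z Uz <-]; rewrite row_mxKl.
Qed.

Let G := W `&` psi @^-1` V.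

Let GC : C1_on G (F \o psi). Proof. exact: C1_on_comp. Qed.

Let Gq z : U z -> G (q z).
Proof.
by move=> Uz; have [Wq Fq] := chart_graph Uz; split => //; exact: FV.
Qed.

Lemma chart_jacobian_comp z : U z ->
  jacobian (F \o psi) (q z) = jacobian psi (q z) *m jacobian F (P z).
Proof.
move=> Uz; have [Wq Vq] := Gq Uz; apply: jacobian_comp.
  by have [] := psiC.2 _ Wq.
by have [] := FC.2 _ Vq.
Qed.

(** In the coordinates (z, F) the fiber is flat: H sends the graph point over z to (z, y). The
    regularity of [s] comes from inverting H, whose Jacobian is block triangular with the invertible
    block dF/dz'. *)
Let H w := row_mx (lsubmx w) (F (psi w)).

Let HC : C1_on G H.
Proof.
by apply: C1_on_row_mx => //; apply: C1_on_lsubmx; exact: GC.1.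
Qed.

Let Hq z : U z -> H (q z) = row_mx z y.
Proof. by move=> Uz; have [_ Fq] := chart_graph Uz; rewrite /H row_mxKl Fq. Qed.

Let HJ z : U z -> jacobian H (q z) \in unitmx.
Proof.
move=> Uz; have [_ _ _ /(_ z Uz) Du] := chart.
have -> : jacobian H (q z) = row_mx (col_mx 1%:M 0) (jacobian (F \o psi) (q z)).
  suff /has_jacobianP[] : has_jacobian H (q z)
      (row_mx (col_mx 1%:M 0) (jacobian (F \o psi) (q z))) by [].
  apply: has_jacobian_row_mx; first exact: has_jacobian_lsubmx.
  by apply: differentiable_has_jacobian; have [] := GC.2 _ (Gq Uz).
rewrite -(vsubmxK (jacobian (F \o psi) (q z))).
rewrite -block_mxEh unitmxE det_ublock det1 mul1r -unitmxE; exact: Du.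
Qed.

(** H is open at q z, so for z' near z the point (z', y) has a preimage in any given neighbourhood
    of q z. That preimage lies on the fiber, hence it is q z'. *)
Lemma chart_graph_continuous z : U z -> {for z, continuous q}.
Proof.
move=> Uz A Aq.
have nG : nbhs (q z) G by apply: open_nbhs_nbhs; split; [exact: GC.1|exact: Gq].
have nAG : nbhs (q z) (A `&` G) by exact: filterI.
have := C1_open_map HC (Gq Uz) (HJ Uz) nAG; rewrite Hq// => /nbhs_normP[e e0 eP].
apply/nbhs_normP; exists e => // z' z'z.
have [|w [Aw Gw] Hw] := eP (row_mx z' y).
  rewrite opp_row_mx add_row_mx subrr; apply: le_lt_trans z'z.
  apply: ler_mx_norm => // i j; have [j' ->|j' ->] := split_ordP j.
    by rewrite row_mxEl; exact: ler_mx_entry.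
  by rewrite row_mxEr mxE normr0.
have [wz' wy] := eq_row_mx Hw.
have [_ wq] := chart_graph_uniq Gw.1 wy.
by rewrite /= -wz' -wq.
Qed.

Lemma chart_graph_lipschitz z : U z ->
  exists2 L, 0 < L & exists2 r, 0 < r & forall x x', `|x - z| < r -> `|x' - z| < r ->
    U x /\ U x' /\ `|q x - q x'| <= L * `|x - x'|.
Proof.
move=> Uz.
have JHf : row_free (jacobian H (q z)) by rewrite row_free_unit HJ.
have [c c0 [e e0 [eG ec]]] := C1_lower_lipschitz HC (Gq Uz) JHf.
have qc := (continuous_mxP _ _).1 (chart_graph_continuous Uz) (e / 2) (divr_gt0 e0 (ltr0n _ 2)).
have /nbhs_normP[r r0 rP] : \forall x \near z, U x /\ `|q x - q z| <= e / 2.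
  by apply: filterI qc; apply: open_nbhs_nbhs.
have e2 : e / 2 < e by rewrite ltr_pdivrMr// ltr_pMr// ltr1n.
exists c => //; exists r => // x x' /rP[Ux qx] /rP[Ux' qx']; split => //; split => //.
apply: le_trans (ec _ _ (le_lt_trans qx e2) (le_lt_trans qx' e2)) _.
rewrite !Hq// opp_row_mx add_row_mx subrr; apply: ler_wpM2l; first exact: ltW.
apply: ler_mx_norm => // i j; have [j' ->|j' ->] := split_ordP j.
  by rewrite row_mxEl; exact: ler_mx_entry.
by rewrite row_mxEr mxE normr0.
Qed.

(** H \o q is the affine map z |-> (z, y), so [near_lipschitz_lift] differentiates q. The left block
    of the derivative is the identity because z is read off from q z; S is the derivative of [s]. *)
Lemma chart_graph_differentiable z : U z ->
  exists S, has_jacobian q z (row_mx 1%:M S).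
Proof.
move=> Uz.
have Hd : has_jacobian H (q z) (jacobian H (q z)).
  by apply: differentiable_has_jacobian; have [] := HC.2 _ (Gq Uz).
have JH := mulmxV (HJ Uz).
have Hqd : has_jacobian (H \o q) z (row_mx 1%:M 0).
  apply: (@has_jacobian_near _ _ _ (fun x => row_mx x y)).
    apply: filterS (open_nbhs_nbhs (conj oU Uz)) => x Ux /=.
    by rewrite Hq.
  apply: has_jacobian_row_mx => e e0; apply/nbhs_normP; exists 1 => // x _.
    by rewrite mulmx1 subrr normr0 mulr_ge0// ltW.
  by rewrite mulmx0 subr0 subrr normr0 mulr_ge0// ltW.
have := near_lipschitz_lift Hd JH (chart_graph_continuous Uz) Hqd.
set M := _ *m _ => qM; exists (rsubmx M).
suff <- : lsubmx M = 1%:M by rewrite hsubmxK.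
have [dq Jq] := (has_jacobianP _ _ _).1 qM.
have h1 : has_jacobian (lsubmx \o q) z 1%:M.
  move=> e e0; apply/nbhs_normP; exists 1 => // x _.
  by rewrite /= !row_mxKl mulmx1 subrr normr0 mulr_ge0// ltW.
have [dl Jl] := (has_jacobianP _ _ _).1 (@has_jacobian_lsubmx _ k d (q z)).
have [_ <-] := (has_jacobianP _ _ _).1 h1.
by rewrite jacobian_comp// Jq Jl -{2}(hsubmxK M) mul_row_col mulmx1 mulmx0 addr0.
Qed.

Lemma chart_point_continuous z : U z -> {for z, continuous P}.
Proof.
move=> Uz; have [Wq _] := chart_graph Uz.
apply: (@continuous_comp _ _ _ q psi); first exact: chart_graph_continuous.
by apply: differentiable_continuous; have [] := psiC.2 _ Wq.
Qed.

(** The rows of this Jacobian are tangent to the fiber: F is constant along P, whence the second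
    equation. *)
Lemma chart_point_jacobian z : U z -> exists S,
  has_jacobian P z (row_mx 1%:M S *m jacobian psi (q z)) /\
  row_mx 1%:M S *m jacobian psi (q z) *m jacobian F (P z) = 0.
Proof.
move=> Uz; have [S /has_jacobianP[dq Jq]] := chart_graph_differentiable Uz.
have [Wq Vq] := Gq Uz.
have dpsi : differentiable psi (q z) by have [] := psiC.2 _ Wq.
have dF : differentiable F (P z) by have [] := FC.2 _ Vq.
have JP : jacobian P z = row_mx 1%:M S *m jacobian psi (q z).
  by rewrite -Jq -jacobian_comp.
have dP : differentiable P z by exact: differentiable_comp.
exists S; split; first by apply/has_jacobianP.
rewrite -JP -jacobian_comp//.
have /has_jacobianP[] // : has_jacobian (F \o P) z 0.
apply: (@has_jacobian_near _ _ _ (cst y)).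
  by apply: filterS (open_nbhs_nbhs (conj oU Uz)) => x /chart_graph[_ <-].
move=> e e0; apply/nbhs_normP; exists 1 => // x _.
by rewrite mulmx0 subr0 subrr normr0 mulr_ge0// ltW.
Qed.

Lemma chart_point_lipschitz z : U z ->
  exists2 L, 0 < L & exists2 r, 0 < r & forall x x', `|x - z| < r -> `|x' - z| < r ->
    `|P x - P x'| <= L * `|x - x'|.
Proof.
move=> Uz; have [Wq _] := chart_graph Uz.
have [L1 L10 [r1 r10 q1]] := chart_graph_lipschitz Uz.
have [L2 L20 [e e0 [eW eL]]] := C1_lipschitz psiC Wq.
have e20 : 0 < e / 2 by rewrite divr_gt0.
have qc := (continuous_mxP _ _).1 (chart_graph_continuous Uz) (e / 2) e20.
have /nbhs_normP[r r0 rP] : \forall x \near z, `|x - z| < r1 /\ `|q x - q z| <= e / 2.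
  by apply: filterI qc; exact: near_mx_dist.
have e2 : e / 2 < e by rewrite ltr_pdivrMr// ltr_pMr// ltr1n.
exists (L2 * L1); first by rewrite mulr_gt0.
exists r => // x x' /rP[xr qx] /rP[xr' qx'].
apply: le_trans (eL _ _ (le_lt_trans qx e2) (le_lt_trans qx' e2)) _.
have [_ [_ h]] := q1 x x' xr xr'.
by rewrite -mulrA ler_wpM2l// ltW.
Qed.

Lemma leray_density_chart z : U z -> leray_density erefl F psi (q z) =
  `|\det (jacobian psi (q z))| *
  `|\det (dsubmx (jacobian psi (q z) *m jacobian F (P z)))|^-1.
Proof. by move=> Uz; rewrite /leray_density castmx_id chart_jacobian_comp. Qed.

Lemma chart_transversal z : U z ->
  dsubmx (jacobian psi (q z) *m jacobian F (P z)) \in unitmx.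
Proof.
move=> Uz; rewrite -chart_jacobian_comp//.
by have [_ _ _ /(_ z Uz)] := chart.
Qed.

Lemma leray_density_continuous z : U z ->
  {for z, continuous (fun z => leray_density erefl F psi (q z))}.
Proof.
move=> Uz.
pose dn z := `|\det (jacobian psi (q z))| *
  `|\det (dsubmx (jacobian psi (q z) *m jacobian F (P z)))|^-1.
apply: (@continuous_near_eq _ _ dn).
  apply: filterS (open_nbhs_nbhs (conj oU Uz)) => x Ux.
  by rewrite leray_density_chart.
have [Wq Vq] := Gq Uz.
have c1 : {for z, continuous (fun x => jacobian psi (q x))}.
  apply: (@continuous_comp _ _ _ q (jacobian psi)).
    exact: chart_graph_continuous.
  by have [] := psiC.2 _ Wq.
have c2 : {for z, continuous (fun x => jacobian F (P x))}.
  apply: (@continuous_comp _ _ _ P (jacobian F)).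
    exact: chart_point_continuous.
  by have [] := FC.2 _ Vq.
have c3 := continuous_mulmx c1 c2.
have c4 : {for z, continuous (fun x => dsubmx (jacobian psi (q x) *m jacobian F (P x)))}.
  apply: continuous_mx_coord => i j.
  apply: (@continuous_near_eq _ _
    (fun x => (jacobian psi (q x) *m jacobian F (P x)) (rshift k i) j)).
    by apply: filterS (open_nbhs_nbhs (conj oU Uz)) => x _; rewrite [RHS]mxE.
  by apply: continuous_coord; exact: c3.
have nc (f : 'rV[R]_k -> R) : {for z, continuous f} -> {for z, continuous (fun x => `|f x|)}.
  move=> fc; apply: (@continuous_comp _ _ _ f Num.norm) => //; exact: norm_continuous.
apply: continuousM; first by apply: nc; exact: continuous_det.
apply: continuousV; last by apply: nc; exact: continuous_det.
by rewrite normr_eq0 -unitfE -unitmxE; exact: chart_transversal.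
Qed.

Definition chart_inv x := xget 0 [set w | W w /\ psi w = x].

Lemma chart_invK w : W w -> chart_inv (psi w) = w.
Proof.
move=> Ww; have [Wi e] : [set w' | W w' /\ psi w' = psi w] (chart_inv (psi w)).
  by apply: xgetPex; exists w.
by apply: psi_inj; rewrite ?in_setE.
Qed.

Lemma chart_image_open : open (psi @` W).
Proof.
rewrite openE => _ [w Ww <-]; apply: (C1_open_map psiC Ww (chart_jac_unit Ww)).
by apply: open_nbhs_nbhs; split => //; exact: psiC.1.
Qed.

Lemma chart_inv_continuous w : W w -> {for psi w, continuous chart_inv}.
Proof.
move=> Ww A; rewrite chart_invK// => Aw.
have nAW : nbhs w (A `&` W).
  by apply: filterI => //; apply: open_nbhs_nbhs; split => //; exact: psiC.1.
have := C1_open_map psiC Ww (chart_jac_unit Ww) nAW.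
by apply: filterS => _ [w' [Aw' Ww'] <-] /=; rewrite chart_invK.
Qed.

End one_chart.
End leray_chart.

(** * Transition maps between two charts *)

Section transition.
Context {R : realType} (k d : nat).
Variables (F : 'rV[R]_(k + d) -> 'rV[R]_d) (y : 'rV[R]_d) (V : set 'rV[R]_(k + d)).
Hypotheses (FC : C1_on V F) (FV : F @^-1` [set y] `<=` V).

Definition chart_point (psi : 'rV[R]_(k + d) -> 'rV[R]_(k + d))
  (s : 'rV[R]_k -> 'rV[R]_d) z := psi (row_mx z (s z)).

Definition chart_dens psi (s : 'rV[R]_k -> 'rV[R]_d) z :=
  leray_density (erefl (k + d)%N) F psi (row_mx z (s z)).

Definition overlap U1 psi1 s1 (W2 : set 'rV[R]_(k + d)) (psi2 : 'rV[R]_(k + d) -> 'rV[R]_(k + d)) :=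
  U1 `&` chart_point psi1 s1 @^-1` (psi2 @` W2).

(** The parameter, in the second chart, of the fiber point whose parameter in the first chart is z;
    meaningful on [overlap]. *)
Definition transition psi1 s1 (W2 : set 'rV[R]_(k + d)) psi2 z : 'rV[R]_k :=
  lsubmx (chart_inv W2 psi2 (chart_point psi1 s1 z)).

Section two_charts.
Variables (W1 : set 'rV[R]_(k + d)) (psi1 : 'rV[R]_(k + d) -> 'rV[R]_(k + d))
  (U1 : set 'rV[R]_k) (s1 : 'rV[R]_k -> 'rV[R]_d).
Variables (W2 : set 'rV[R]_(k + d)) (psi2 : 'rV[R]_(k + d) -> 'rV[R]_(k + d))
  (U2 : set 'rV[R]_k) (s2 : 'rV[R]_k -> 'rV[R]_d).
Hypothesis chart1 : leray_coordinates F y W1 psi1 U1 s1.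
Hypothesis chart2 : leray_coordinates F y W2 psi2 U2 s2.

Let O1 := overlap U1 psi1 s1 W2 psi2.
Let P1 := chart_point psi1 s1.
Let P2 := chart_point psi2 s2.
Let T := transition psi1 s1 W2 psi2.
Let I2 := chart_inv W2 psi2.

Lemma transition_spec z : O1 z ->
  [/\ U2 (T z), P2 (T z) = P1 z & I2 (P1 z) = row_mx (T z) (s2 (T z))].
Proof.
move=> [Uz [w Ww wP]]; have [_ Fz] := chart_graph chart1 Uz.
have Iw : I2 (P1 z) = w by rewrite /I2 -[P1 z]wP (chart_invK chart2).
have [|Uw wE] := chart_graph_uniq chart2 Ww; first by rewrite wP.
have TE : T z = lsubmx w by rewrite /T /transition -/(I2 _) -/(P1 z) Iw.
rewrite TE; split => //; last by rewrite Iw.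
by rewrite /P2 /chart_point -wE.
Qed.

Lemma overlap_open : open O1.
Proof.
apply: open_preimage_in; first by have [] := chart1.
  by move=> z Uz; exact: (chart_point_continuous FC FV chart1 Uz).
exact: (chart_image_open chart2).
Qed.

Let Q z := I2 (P1 z).

Let Qc z : O1 z -> {for z, continuous Q}.
Proof.
move=> [Uz [w Ww wP]]; apply: (@continuous_comp _ _ _ P1 I2).
  exact: (chart_point_continuous FC FV chart1 Uz).
by rewrite [P1 z](esym wP); exact: (chart_inv_continuous chart2 Ww).
Qed.

Let QW z : O1 z -> W2 (Q z) /\ psi2 (Q z) = P1 z.
Proof.
move=> Oz; have [Uz P2E QE] := transition_spec Oz.
by rewrite /Q QE; split; [have [] := chart_graph chart2 Uz|exact: P2E].
Qed.

(** The lift Q of P1 through psi2 is continuous, hence differentiable by [near_lipschitz_lift], and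
    T is its first block. Differentiating P2 \o T = P1 then relates the two tangent frames in the
    form required by [leray_det_relation]. *)
Lemma transition_jacobian z : O1 z -> exists S1 S2,
  [/\ differentiable T z,
      row_mx 1%:M S1 *m jacobian psi1 (row_mx z (s1 z)) =
      jacobian T z *m (row_mx 1%:M S2 *m jacobian psi2 (row_mx (T z) (s2 (T z)))),
      row_mx 1%:M S1 *m jacobian psi1 (row_mx z (s1 z)) *m jacobian F (P1 z) = 0 &
      row_mx 1%:M S2 *m jacobian psi2 (row_mx (T z) (s2 (T z))) *m jacobian F (P1 z) = 0].
Proof.
move=> Oz; have [Uz _] := Oz; have [UT P2E QE] := transition_spec Oz.
have [S1 [J1 Z1]] := chart_point_jacobian FC FV chart1 Uz.
have [S2 [J2 Z2]] := chart_point_jacobian FC FV chart2 UT.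
exists S1, S2.
have [WQ psiQ] := QW Oz.
have dpsi : differentiable psi2 (Q z) by have [[[_ C] _ _] _ _ _] := chart2; have [] := C _ WQ.
have nO : nbhs z O1 by apply: open_nbhs_nbhs; split => //; exact: overlap_open.
have hQ : has_jacobian (psi2 \o Q) z (row_mx 1%:M S1 *m jacobian psi1 (row_mx z (s1 z))).
  apply: has_jacobian_near J1; apply: filterS nO => x /QW[_ e].
  by rewrite /= e.
have := near_lipschitz_lift (differentiable_has_jacobian dpsi)
  (mulmxV (chart_jac_unit chart2 WQ)) (Qc Oz) hQ.
move=> /has_jacobianP[dQ _].
have [dl _] := (has_jacobianP _ _ _).1 (@has_jacobian_lsubmx R k d (Q z)).
have dT : differentiable T z.
  exact: (differentiable_comp dQ dl).
have [dP2 JP2] := (has_jacobianP _ _ _).1 J2.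
have [dP1 JP1] := (has_jacobianP _ _ _).1 J1.
have JT : jacobian P1 z = jacobian T z *m jacobian P2 (T z).
  rewrite -[RHS](jacobian_comp dT dP2).
  have nP : \forall x \near z, (P2 \o T) x = P1 x.
    by apply: filterS nO => x /transition_spec[_ e _]; exact: e.
  exact: (jacobian_near nP (differentiable_comp dT dP2)).2.
split; [exact: dT| |exact: Z1|rewrite -P2E; exact: Z2].
by rewrite -JP1 -JP2; exact: JT.
Qed.

Lemma transition_lipschitz : locally_lipschitz O1 T.
Proof.
move=> z Oz; have [Uz _] := Oz; have [WQ _] := QW Oz.
have [L L0 [r1 r10 PL]] := chart_point_lipschitz FC FV chart1 Uz.
have [[pC _ _] _ _ _] := chart2.
have Jf : row_free (jacobian psi2 (Q z)).
  by rewrite row_free_unit; exact: (chart_jac_unit chart2 WQ).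
have [c c0 [e e0 [eW eL]]] := C1_lower_lipschitz pC WQ Jf.
have e20 : 0 < e / 2 by rewrite divr_gt0.
have e2 : e / 2 < e by rewrite ltr_pdivrMr// ltr_pMr// ltr1n.
have qc := (continuous_mxP _ _).1 (Qc Oz) (e / 2) e20.
have nO : nbhs z O1 by apply: open_nbhs_nbhs; split => //; exact: overlap_open.
have nr := near_mx_dist z r10.
have /nbhs_normP[r r0 rP] : \forall x \near z, [/\ O1 x, `|x - z| < r1 & `|Q x - Q z| <= e / 2].
  by apply: filterS3 nO nr qc => x.
exists (c * L); first by rewrite mulr_gt0.
exists r => // x x' /rP[Ox xr Qx] /rP[Ox' xr' Qx'].
have h1 := eL _ _ (le_lt_trans Qx e2) (le_lt_trans Qx' e2).
have h2 := PL _ _ xr xr'.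
apply: (@le_trans _ _ `|Q x - Q x'|).
  rewrite -[T x]/(lsubmx (Q x)) -[T x']/(lsubmx (Q x')) -linearB.
  by apply: ler_mx_norm => // i j; rewrite mxE; exact: ler_mx_entry.
apply: le_trans h1 _; rewrite -mulrA; apply: ler_wpM2l; first exact: ltW.
have [_ ->] := QW Ox; have [_ ->] := QW Ox'; exact: h2.
Qed.

Lemma transition_dens z : O1 z ->
  chart_dens psi1 s1 z = chart_dens psi2 s2 (T z) * `|\det (jacobian T z)|.
Proof.
move=> Oz; have [Uz _] := Oz; have [UT P2E _] := transition_spec Oz.
have [S1 [S2 [_ E1 E2 E3]]] := transition_jacobian Oz.
rewrite /chart_dens (leray_density_chart FC FV chart1 Uz) (leray_density_chart FC FV chart2 UT).
rewrite -[psi2 _]/(P2 (T z)) P2E -[psi1 _]/(P1 z).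
have [Wq2 _] := chart_graph chart2 UT.
apply: leray_det_relation E1 E2 E3.
- exact: (chart_jac_unit chart2 Wq2).
- exact: (chart_transversal FC FV chart1 Uz).
- by have := chart_transversal FC FV chart2 UT; rewrite -[psi2 _]/(P2 (T z)) P2E.
Qed.

End two_charts.

Lemma transitionK W1 psi1 U1 s1 W2 psi2 U2 s2 z :
  leray_coordinates F y W1 psi1 U1 s1 -> leray_coordinates F y W2 psi2 U2 s2 ->
  overlap U1 psi1 s1 W2 psi2 z ->
  overlap U2 psi2 s2 W1 psi1 (transition psi1 s1 W2 psi2 z) /\
  transition psi2 s2 W1 psi1 (transition psi1 s1 W2 psi2 z) = z.
Proof.
move=> c1 c2 Oz; have [Uz _] := Oz; have [UT P2E _] := transition_spec c1 c2 Oz.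
have [Wq _] := chart_graph c1 Uz.
split.
  split => //; rewrite /preimage /= P2E.
  by exists (row_mx z (s1 z)).
rewrite {1}/transition P2E /chart_point (chart_invK c1)//.
by rewrite row_mxKl.
Qed.

Definition chart_measure U psi s (A : set 'rV[R]_(k + d)) : \bar R :=
  (\int[lebesgue_rV k]_(z in U `&` [set z | A (chart_point psi s z)])
      (chart_dens psi s z)%:E)%E.

(** A lies in both images, so both integrals live on the overlaps, which the transition maps
    exchange; [transition_dens] is the density relation that [integral_image] asks for. *)
Theorem chart_measure_agree W1 psi1 U1 s1 W2 psi2 U2 s2 A :
  leray_coordinates F y W1 psi1 U1 s1 -> leray_coordinates F y W2 psi2 U2 s2 ->
  measurable A -> A `<=` psi1 @` W1 -> A `<=` psi2 @` W2 ->
  chart_measure U1 psi1 s1 A = chart_measure U2 psi2 s2 A.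
Proof.
move=> c1 c2 mA A1 A2.
pose O1 := overlap U1 psi1 s1 W2 psi2; pose O2 := overlap U2 psi2 s2 W1 psi1.
pose T := transition psi1 s1 W2 psi2; pose S := transition psi2 s2 W1 psi1.
have oO1 : open O1 by exact: overlap_open c1 c2.
have oO2 : open O2 by exact: overlap_open c2 c1.
have mO1 : measurable O1 by exact: open_measurable_rV.
pose E := O1 `&` chart_point psi1 s1 @^-1` A.
have mE : measurable E.
  apply: (@continuous_measurable_rV_rV R k (k + d) O1 (chart_point psi1 s1)) => //.
  by move=> z [Uz _]; exact: (chart_point_continuous FC FV c1 Uz).
have dens0 psi s z : 0 <= chart_dens psi s z.
  by rewrite /chart_dens /leray_density mulr_ge0// invr_ge0.
have h : (\int[lebesgue_rV k]_(x in O1 `&` E) (chart_dens psi1 s1 x)%:E =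
          \int[lebesgue_rV k]_(z in O2 `&` S @^-1` E) (chart_dens psi2 s2 z)%:E)%E.
  apply: (@integral_image R k O1 O2 T S) => //.
  - by move=> z /(transitionK c1 c2)[].
  - by move=> z /(transitionK c2 c1)[].
  - by move=> z /(transitionK c1 c2)[].
  - by move=> z /(transitionK c2 c1)[].
  - by move=> z /(transition_jacobian c1 c2)[? [? []]].
  - by move=> z /(transition_jacobian c2 c1)[? [? []]].
  - exact: transition_lipschitz c1 c2.
  - exact: transition_lipschitz c2 c1.
  - by move=> z [Uz _]; exact: (leray_density_continuous FC FV c1 Uz).
  - by move=> z [Uz _]; exact: (leray_density_continuous FC FV c2 Uz).
  - by move=> z; exact: (transition_dens c1 c2).
rewrite /chart_measure.
have -> : U1 `&` [set z | A (chart_point psi1 s1 z)] = O1 `&` E.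
  apply/seteqP; split => [z [Uz Az]|z [_ [[Uz _] Az]]]; last by split.
  have Oz : O1 z by split; [exact: Uz|exact: A2].
  by split; [exact: Oz|split; [exact: Oz|exact: Az]].
rewrite h; congr (integral _ _ _).
apply/seteqP; split => [z [zO2 [SzO1 Az]]|z [Uz Az]].
  split; first exact: zO2.1.
  move: Az; rewrite /preimage /=.
  by have [_ -> _] := transition_spec c2 c1 zO2.
have zO2 : O2 z by split; [exact: Uz|exact: A1].
have [_ PE _] := transition_spec c2 c1 zO2.
have [SzO1 _] := transitionK c2 c1 zO2.
split; [exact: zO2|split; [exact: SzO1|]].
by rewrite /preimage /= PE.
Qed.

End transition.

(** * Calculus of C1 maps *)

Section C1_algebra.
Context {R : realType}.

Lemma C1_on_jacobian m n (W : set 'rV[R]_m) (f : 'rV[R]_m -> 'rV[R]_n)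
    (M : 'rV[R]_m -> 'M[R]_(m, n)) :
  open W -> (forall x, W x -> has_jacobian f x (M x)) ->
  (forall x, W x -> {for x, continuous M}) -> C1_on W f.
Proof.
move=> oW fM Mc; split => // x Wx.
have [df _] := (has_jacobianP _ _ _).1 (fM x Wx); split; first exact: df.
apply: (continuous_near_eq _ (Mc x Wx)).
apply: filterS (open_nbhs_nbhs (conj oW Wx)) => w Ww.
by have [_ ->] := (has_jacobianP _ _ _).1 (fM w Ww).
Qed.

Lemma C1_on_has_jacobian m n (W : set 'rV[R]_m) (f : 'rV[R]_m -> 'rV[R]_n) x :
  C1_on W f -> W x -> has_jacobian f x (jacobian f x).
Proof. by move=> [_ fC] /fC[df _]; exact: differentiable_has_jacobian. Qed.

Lemma C1_on_continuous m n (W : set 'rV[R]_m) (f : 'rV[R]_m -> 'rV[R]_n) x :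
  C1_on W f -> W x -> {for x, continuous f}.
Proof. by move=> [_ fC] /fC[df _]; exact: differentiable_continuous. Qed.

Lemma has_jacobian_comp m n p (f : 'rV[R]_m -> 'rV[R]_n) (g : 'rV[R]_n -> 'rV[R]_p)
    (x : 'rV[R]_m) M N :
  has_jacobian f x M -> has_jacobian g (f x) N -> has_jacobian (g \o f) x (M *m N).
Proof.
move=> /has_jacobianP[df <-] /has_jacobianP[dg <-]; apply/has_jacobianP.
by split; [exact: differentiable_comp|exact: jacobian_comp].
Qed.

Lemma C1_on_linear m n (W : set 'rV[R]_m) (M : 'M[R]_(m, n)) (c : 'rV[R]_n) :
  open W -> C1_on W (fun v => v *m M + c).
Proof.
move=> oW; apply: (C1_on_jacobian (M := cst M) oW) => x _; first exact: has_jacobian_mulmx.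
exact: cst_continuous.
Qed.

Lemma has_jacobian_lin m n (f : 'rV[R]_m -> 'rV[R]_n) (M : 'M[R]_(m, n)) x :
  (forall v, f v = v *m M) -> has_jacobian f x M.
Proof.
move=> fE; have -> : f = fun v => v *m M + 0 by apply/funext => v; rewrite addr0.
exact: has_jacobian_mulmx.
Qed.

Lemma C1_on_lin m n (W : set 'rV[R]_m) (f : 'rV[R]_m -> 'rV[R]_n) (M : 'M[R]_(m, n)) :
  open W -> (forall v, f v = v *m M) -> C1_on W f.
Proof.
move=> oW fE; have -> : f = fun v => v *m M + 0 by apply/funext => v; rewrite addr0.
exact: C1_on_linear.
Qed.

Lemma has_jacobianD m n (f g : 'rV[R]_m -> 'rV[R]_n) (x : 'rV[R]_m) M N :
  has_jacobian f x M -> has_jacobian g x N ->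
  has_jacobian (fun v => f v + g v) x (M + N).
Proof.
move=> fM gN e e0; have e2 : 0 < e / 2 by rewrite divr_gt0.
apply: filterS2 (fM _ e2) (gN _ e2) => y fy gy.
have -> : f y + g y - (f x + g x) - (y - x) *m (M + N) =
    (f y - f x - (y - x) *m M) + (g y - g x - (y - x) *m N).
  rewrite mulmxDr; move: (_ *m M) (_ *m N) => s t.
  by apply/rowP => i; rewrite !mxE; ring.
apply: le_trans (ler_normD _ _) _; rewrite [e in e * _]splitr mulrDl.
exact: lerD.
Qed.

Section bilinear.
Variables (n1 n2 p : nat) (Bl : 'rV[R]_n2 -> 'M[R]_(n1, p)) (Br : 'rV[R]_n1 -> 'M[R]_(n2, p)).
Variable K : R.
Hypothesis BE : forall (u : 'rV[R]_n1) (v : 'rV[R]_n2), u *m Bl v = v *m Br u.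
Hypothesis K0 : 0 < K.
Hypothesis BK : forall (u : 'rV[R]_n1) (v : 'rV[R]_n2), `|u *m Bl v| <= K * `|u| * `|v|.

Let Bladd (u : 'rV[R]_n1) (v v' : 'rV[R]_n2) : u *m Bl (v - v') = u *m Bl v - u *m Bl v'.
Proof. by rewrite !BE mulmxBl. Qed.

Lemma has_jacobian_bilinear m (f : 'rV[R]_m -> 'rV[R]_n1) (g : 'rV[R]_m -> 'rV[R]_n2) x M N :
  has_jacobian f x M -> has_jacobian g x N ->
  has_jacobian (fun v => f v *m Bl (g v)) x (M *m Bl (g x) + N *m Br (f x)).
Proof.
move=> fM gN e e0.
(* C collects the coefficients of the four error terms below, whose sum is then at most r C |y - x|
   with r = e / C / 2. *)
pose C := K * (`|f x| + `|g x| + 1 + m%:R * `|M|).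
have C0 : 0 < C.
  by rewrite mulr_gt0// ltr_wpDr ?mulr_ge0// ltr_wpDl// addr_ge0.
have eC : 0 < e / C / 2 by rewrite !divr_gt0.
have gc : {for x, continuous g}.
  by have [dg _] := (has_jacobianP _ _ _).1 gN; exact: differentiable_continuous.
have g1 := (continuous_mxP _ _).1 gc _ eC.
have g2 := (continuous_mxP _ _).1 gc 1 ltr01.
have g3 : \forall y \near x, `|g y - g x| <= e / C / 2 /\ `|g y - g x| <= 1.
  by exact: filterI.
apply: filterS3 (fM _ eC) (gN _ eC) g3 => y fy gy [gy1 gy2].
have -> : f y *m Bl (g y) - f x *m Bl (g x) - (y - x) *m (M *m Bl (g x) + N *m Br (f x)) =
    (f y - f x - (y - x) *m M) *m Bl (g x) + f x *m Bl (g y - g x - (y - x) *m N) +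
    ((f y - f x - (y - x) *m M) *m Bl (g y - g x) + (y - x) *m M *m Bl (g y - g x)).
  rewrite mulmxDr (mulmxA _ N) !mulmxA.
  rewrite -(BE (f x) ((y - x) *m N)) !Bladd !mulmxBl.
  set a := f y *m Bl (g y); set b := f x *m Bl (g x); set c := f y *m Bl (g x).
  set d := f x *m Bl (g y).
  apply/rowP => i; rewrite !mxE.
  move: (y *m M) (x *m M) => s t.
  by ring.
apply: le_trans (ler_normD _ _) _.
apply: le_trans (lerD (ler_normD _ _) (ler_normD _ _)) _.
have h1 := BK (f y - f x - (y - x) *m M) (g x).
have h2 := BK (f x) (g y - g x - (y - x) *m N).
have h3 := BK (f y - f x - (y - x) *m M) (g y - g x).
have h4 := BK ((y - x) *m M) (g y - g x).
apply: le_trans (lerD (lerD h1 h2) (lerD h3 h4)) _.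
have h5 := ler_norm_mulmx (y - x) M.
set r := e / C / 2 in fy gy gy1 eC.
set Y := `|y - x| in fy gy h5 *.
have Y0 : 0 <= Y by rewrite /Y.
set u := `|f y - f x - (y - x) *m M| in fy *.
set w := `|g y - g x - (y - x) *m N| in gy *.
set q := `|(y - x) *m M| in h5 *.
set t := `|g y - g x| in gy1 gy2 *.
have u0 : 0 <= u by rewrite /u.
have t0 : 0 <= t by rewrite /t.
have E1 : K * u * `|g x| <= K * (r * Y) * `|g x|.
  by apply: ler_wpM2r => //; apply: ler_wpM2l; [exact: ltW|exact: fy].
have E2 : K * `|f x| * w <= K * `|f x| * (r * Y).
  by apply: ler_wpM2l => //; rewrite mulr_ge0// ltW.
have E3 : K * u * t <= K * (r * Y) * 1.
  by apply: ler_pM => //; [rewrite mulr_ge0// ltW|apply: ler_wpM2l; [exact: ltW|exact: fy]].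
have E4 : K * q * t <= K * (m%:R * Y * `|M|) * r.
  have q0 : 0 <= q by rewrite /q.
  apply: ler_pM => //; first exact: (mulr_ge0 (ltW K0) q0).
  by apply: ler_wpM2l; [exact: ltW|exact: h5].
apply: le_trans (lerD (lerD E1 E2) (lerD E3 E4)) _.
have -> : K * (r * Y) * `|g x| + K * `|f x| * (r * Y) +
    (K * (r * Y) * 1 + K * (m%:R * Y * `|M|) * r) = r * C * Y by rewrite /C; ring.
apply: ler_wpM2r => //; rewrite /r mulrAC divfK ?gt_eqF//.
by rewrite ler_pdivrMr// ler_pMr// ler1n.
Qed.

Lemma C1_on_bilinear m (W : set 'rV[R]_m) (f : 'rV[R]_m -> 'rV[R]_n1) (g : 'rV[R]_m -> 'rV[R]_n2) :
  continuous Bl -> continuous Br -> C1_on W f -> C1_on W g ->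
  C1_on W (fun v => f v *m Bl (g v)).
Proof.
move=> Blc Brc fC gC.
apply: (C1_on_jacobian (M := fun x => jacobian f x *m Bl (g x) + jacobian g x *m Br (f x))).
- exact: fC.1.
- by move=> x Wx; apply: has_jacobian_bilinear; exact: C1_on_has_jacobian Wx.
move=> x Wx; apply: continuousD; apply: continuous_mulmx.
- by have [] := fC.2 x Wx.
- by apply: (@continuous_comp _ _ _ g Bl); [exact: (C1_on_continuous gC Wx)|exact: Blc].
- by have [] := gC.2 x Wx.
- by apply: (@continuous_comp _ _ _ f Br); [exact: (C1_on_continuous fC Wx)|exact: Brc].
Qed.

End bilinear.
End C1_algebra.

Section C1_scalars.
Context {R : realType}.

Lemma continuous_entry m n i j : continuous (fun M : 'M[R]_(m, n) => M i j).
Proof. by move=> x; exact: (@continuous_coord _ _ _ _ id x i j). Qed.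

Lemma trmx_continuous m n : continuous (@trmx R m n).
Proof.
move=> x; apply: continuous_mx_coord => i j.
change (continuous_at x (fun M : 'M[R]_(m, n) => M^T i j)); under eq_fun do rewrite mxE.
exact: continuous_entry.
Qed.

Lemma ler_norm_trmx m n (M : 'M[R]_(m, n)) : `|M^T| <= `|M|.
Proof. by apply: ler_mx_norm => // i j; rewrite mxE; exact: ler_mx_entry. Qed.

Lemma dotC n (u v : 'rV[R]_n) : u *m v^T = v *m u^T.
Proof. by rewrite -[LHS]trmxK trmx_mul trmxK [LHS]mx11_scalar mxE -mx11_scalar. Qed.

Lemma dot_bound n (u v : 'rV[R]_n) : `|u *m v^T| <= n.+1%:R * `|u| * `|v|.
Proof.
apply: le_trans (ler_norm_mulmx _ _) _; apply: ler_pM;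
  [by rewrite mulr_ge0|by []| |exact: ler_norm_trmx].
by apply: ler_wpM2r => //; rewrite ler_nat.
Qed.

Lemma has_jacobian_dot m n (f g : 'rV[R]_m -> 'rV[R]_n) x M N :
  has_jacobian f x M -> has_jacobian g x N ->
  has_jacobian (fun v => f v *m (g v)^T) x (M *m (g x)^T + N *m (f x)^T).
Proof.
exact: (@has_jacobian_bilinear R n n 1 (@trmx R 1 n) (@trmx R 1 n) n.+1%:R (@dotC n)
  (ltr0Sn _ _) (@dot_bound n)).
Qed.

Lemma C1_on_dot m n (W : set 'rV[R]_m) (f g : 'rV[R]_m -> 'rV[R]_n) :
  C1_on W f -> C1_on W g -> C1_on W (fun v => f v *m (g v)^T).
Proof.
apply: (@C1_on_bilinear R n n 1 (@trmx R 1 n) (@trmx R 1 n) n.+1%:R) => //;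
  [exact: dotC|exact: dot_bound|exact: trmx_continuous|exact: trmx_continuous].
Qed.

Let scalar_entry n (a : 'rV[R]_1) : 'M[R]_n := (a ord0 ord0)%:M.

Let scaleE n (a : 'rV[R]_1) (v : 'rV[R]_n) : a *m v = v *m scalar_entry n a.
Proof. by rewrite {1}[a]mx11_scalar mul_scalar_mx /scalar_entry mul_mx_scalar. Qed.

Let scale_bound n (a : 'rV[R]_1) (v : 'rV[R]_n) : `|a *m v| <= 1 * `|a| * `|v|.
Proof. exact: ler_norm_mulmx. Qed.

Let scalar_entry_continuous n : continuous (@scalar_entry n).
Proof.
move=> x; apply: continuous_mx_coord => i j.
have -> : (fun a : 'rV[R]_1 => scalar_entry n a i j) =
    (fun a : 'rV[R]_1 => a ord0 ord0 * (i == j)%:R).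
  by apply/funext => a; rewrite /scalar_entry mxE mulr_natr.
have c2 : {for x, continuous (fun a : 'rV[R]_1 => (i == j)%:R : R)} by exact: cst_continuous.
exact: (continuousM (@continuous_entry 1 1 ord0 ord0 x) c2).
Qed.

Lemma has_jacobian_scale m n (a : 'rV[R]_m -> 'rV[R]_1) (f : 'rV[R]_m -> 'rV[R]_n) x M N :
  has_jacobian a x M -> has_jacobian f x N ->
  has_jacobian (fun v => a v *m f v) x (M *m f x + N *m (a x ord0 ord0)%:M).
Proof.
exact: (@has_jacobian_bilinear R 1 n n id (@scalar_entry n) 1 (@scaleE n) ltr01
  (@scale_bound n)).
Qed.

Lemma C1_on_scale m n (W : set 'rV[R]_m) (a : 'rV[R]_m -> 'rV[R]_1) (f : 'rV[R]_m -> 'rV[R]_n) :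
  C1_on W a -> C1_on W f -> C1_on W (fun v => a v *m f v).
Proof.
apply: (@C1_on_bilinear R 1 n n id (@scalar_entry n) 1 (@scaleE n) ltr01 (@scale_bound n)).
  by move=> ?; exact: cvg_id.
exact: scalar_entry_continuous.
Qed.

Lemma C1_onD m n (W : set 'rV[R]_m) (f g : 'rV[R]_m -> 'rV[R]_n) :
  C1_on W f -> C1_on W g -> C1_on W (fun v => f v + g v).
Proof.
move=> fC gC; apply: (C1_on_jacobian (M := fun x => jacobian f x + jacobian g x)).
- exact: fC.1.
- by move=> x Wx; apply: has_jacobianD; exact: C1_on_has_jacobian Wx.
by move=> x Wx; apply: continuousD; [have [] := fC.2 x Wx|have [] := gC.2 x Wx].
Qed.

(** Real functions are turned into maps of row vectors of length 1, so that [jacobian], [C1_on] and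
    the chain rule apply to them as well. *)
Definition lift_scalar (phi : R -> R) (u : 'rV[R]_1) : 'rV[R]_1 := const_mx (phi (u ord0 ord0)).

Lemma has_jacobian_scalar (phi : R -> R) (u : 'rV[R]_1) (c : R) :
  is_derive (u ord0 ord0) (1 : R) phi c -> has_jacobian (lift_scalar phi) u (const_mx c).
Proof.
move=> h e e0.
have d : differentiable phi (u ord0 ord0).
  by apply/derivable1_diffP; have [] := h.
have dE : 'd phi (u ord0 ord0) = *:%R^~ c :> (R -> R).
  by rewrite (diff1E d) derive1E; have [_ ->] := h.
have := (diff_estimateP phi (u ord0 ord0) (diff_continuous d)).2 (conj d erefl) e e0.
move=> /nbhs_ballP[r r0 rP]; apply/nbhs_normP; exists r => // y yu.
have e00 (A : 'rV[R]_1) : `|A| = `|A ord0 ord0|.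
  apply/le_anti/andP; split; last exact: ler_mx_entry.
  by apply: ler_mx_norm => // i j; rewrite !ord1.
rewrite !e00 !mxE big_ord1 !mxE; rewrite e00 !mxE in yu.
have := rP (y ord0 ord0); rewrite dE; apply.
by rewrite -ball_normE /= distrC.
Qed.

Lemma C1_on_scalar (O : set R) (phi dphi : R -> R) : open O ->
  (forall x, O x -> is_derive x (1 : R) phi (dphi x)) ->
  (forall x, O x -> {for x, continuous dphi}) ->
  C1_on [set u : 'rV[R]_1 | O (u ord0 ord0)] (lift_scalar phi).
Proof.
move=> oO dO cO; apply: (C1_on_jacobian (M := fun u => const_mx (dphi (u ord0 ord0)))).
- by apply: open_comp => // u _; exact: continuous_entry.
- by move=> u Ou; apply: has_jacobian_scalar; exact: dO.
move=> u Ou; apply: continuous_mx_coord => i j.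
have -> : (fun a : 'rV[R]_1 => (const_mx (dphi (a ord0 ord0)) : 'M[R]_1) i j) =
    (fun a => dphi (a ord0 ord0)) by apply/funext => a; rewrite mxE.
apply: (@continuous_comp _ _ _ (fun u : 'rV[R]_1 => u ord0 ord0) dphi).
  exact: continuous_entry.
exact: cO.
Qed.

Lemma C1_on_sqrt :
  C1_on [set u : 'rV[R]_1 | 0 < u ord0 ord0] (lift_scalar Num.sqrt).
Proof.
apply: (@C1_on_scalar [set x | 0 < x] Num.sqrt (fun x => (2 * Num.sqrt x)^-1)).
- exact: open_gt.
move=> x x0; apply: continuousV; first by rewrite mulf_neq0// gt_eqF// sqrtr_gt0.
by apply: continuousM; [exact: cst_continuous|exact: sqrt_continuous].
Qed.

Lemma C1_on_inv :
  C1_on [set u : 'rV[R]_1 | 0 < u ord0 ord0] (lift_scalar GRing.inv).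
Proof.
apply: (@C1_on_scalar [set x | 0 < x] GRing.inv (fun x => - x ^- 2)).
- exact: open_gt.
- move=> x x0; have := @is_deriveV R id x 1 1 _ (is_derive_id _ _).
  by rewrite /= scaler1; apply; rewrite gt_eqF.
move=> x x0; apply: continuousN; apply: continuousV; first by rewrite expf_neq0// gt_eqF.
exact: exprn_continuous.
Qed.

Lemma has_jacobian_sqrt (u : 'rV[R]_1) : 0 < u ord0 ord0 ->
  has_jacobian (lift_scalar Num.sqrt) u (const_mx (2 * Num.sqrt (u ord0 ord0))^-1).
Proof. by move=> u0; apply: has_jacobian_scalar; exact: is_derive1_sqrt. Qed.

End C1_scalars.

(** * The Euclidean norm and the length map *)

Section euclidean_norm.
Context {R : realType}.

Lemma dotE n (u v : 'rV[R]_n) : (u *m v^T) ord0 ord0 = \sum_i u ord0 i * v ord0 i.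
Proof. by rewrite mxE; apply: eq_bigr => i _; rewrite mxE. Qed.

Lemma enormE n (v : 'rV[R]_n) : enorm v = Num.sqrt ((v *m v^T) ord0 ord0).
Proof. by rewrite dotE. Qed.

Lemma enorm_ge0 n (v : 'rV[R]_n) : 0 <= enorm v.
Proof. exact: sqrtr_ge0. Qed.

Lemma enorm_sqr n (v : 'rV[R]_n) : enorm v ^+ 2 = (v *m v^T) ord0 ord0.
Proof. by rewrite enormE sqr_sqrtr// dotE sumr_ge0// => i _; exact: sqr_ge0. Qed.

Lemma dot_enorm n (v : 'rV[R]_n) : v *m v^T = (enorm v ^+ 2)%:M.
Proof. by rewrite enorm_sqr -mx11_scalar. Qed.

Lemma enorm_eq0 n (v : 'rV[R]_n) : (enorm v == 0) = (v == 0).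
Proof.
apply/eqP/eqP => [v0|->]; last by rewrite enormE mul0mx mxE sqrtr0.
have : enorm v ^+ 2 = 0 by rewrite v0 expr0n.
rewrite enorm_sqr dotE => /eqP; rewrite psumr_eq0; last by move=> i _; exact: sqr_ge0.
move=> /allP h; apply/rowP => i; rewrite mxE.
by have := h i (mem_index_enum i); rewrite /= mulf_eq0 orbb => /eqP.
Qed.

Lemma enorm_gt0 n (v : 'rV[R]_n) : (0 < enorm v) = (v != 0).
Proof. by rewrite lt0r enorm_ge0 andbT enorm_eq0. Qed.

Lemma enorm_uniq n (v : 'rV[R]_n) c : 0 <= c -> (v *m v^T) ord0 ord0 = c ^+ 2 -> enorm v = c.
Proof. by move=> c0; rewrite enormE => ->; rewrite sqrtr_sqr ger0_norm. Qed.

Lemma enormZ n (c : R) (v : 'rV[R]_n) : enorm (c *: v) = `|c| * enorm v.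
Proof.
apply: enorm_uniq; first by rewrite mulr_ge0// enorm_ge0.
rewrite exprMn enorm_sqr real_normK ?num_real// !dotE mulr_sumr.
by apply: eq_bigr => i _; rewrite !mxE; ring.
Qed.

Lemma enorm_row_mx n1 n2 (u : 'rV[R]_n1) (v : 'rV[R]_n2) :
  enorm (row_mx u v) ^+ 2 = enorm u ^+ 2 + enorm v ^+ 2.
Proof. by rewrite !enorm_sqr tr_row_mx mul_row_col [LHS]mxE. Qed.

Lemma enorm_orthogonal m n (v : 'rV[R]_m) (A : 'M[R]_(m, n)) : A *m A^T = 1%:M ->
  enorm (v *m A) = enorm v.
Proof. by move=> AA; rewrite !enormE trmx_mul mulmxA -(mulmxA v) AA mulmx1. Qed.

Lemma enorm11 (a : 'rV[R]_1) : enorm a = `|a ord0 ord0|.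
Proof.
apply: enorm_uniq => //; rewrite dotE big_ord1 real_normK ?num_real//.
Qed.

Lemma const_mx11 (c : R) : (const_mx c : 'rV[R]_1) = c%:M.
Proof. by apply/rowP => i; rewrite !mxE !ord1 eqxx. Qed.

Lemma mulmx_delta_col n (v : 'rV[R]_n) i : v *m delta_mx i ord0 = const_mx (v ord0 i) :> 'rV[R]_1.
Proof.
rewrite const_mx11 [LHS]mx11_scalar; congr (_%:M).
rewrite mxE (bigD1 i)//= big1 ?addr0 => [|j ji]; first by rewrite [X in _ * X]mxE !eqxx mulr1.
by rewrite [X in _ * X]mxE (negbTE ji) mulr0.
Qed.

Lemma mul_const_mx11 n (c : R) (v : 'rV[R]_n) : (const_mx c : 'rV[R]_1) *m v = c *: v.
Proof. by rewrite const_mx11 mul_scalar_mx. Qed.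

Lemma open_neq0 m n : open [set v : 'M[R]_(m, n) | v != 0].
Proof.
rewrite openE => v v0; apply/nbhs_normP; exists `|v| => [|y]; first by rewrite normr_gt0.
by move=> yv /=; apply: contraTneq yv => ->; rewrite sub0r normrN ltxx.
Qed.

Lemma has_jacobian_id n (x : 'rV[R]_n) : has_jacobian id x 1%:M.
Proof. by apply: has_jacobian_lin => v; rewrite mulmx1. Qed.

Lemma C1_on_id n (W : set 'rV[R]_n) : open W -> C1_on W id.
Proof. by move=> oW; apply: (C1_on_lin (M := 1%:M)) => // v; rewrite mulmx1. Qed.

Lemma has_jacobian_enorm n (v : 'rV[R]_n) : v != 0 ->
  has_jacobian (fun v => const_mx (enorm v) : 'rV[R]_1) v ((enorm v)^-1 *: v^T).
Proof.
move=> v0; have v0' : 0 < (v *m v^T) ord0 ord0 by rewrite -enorm_sqr exprn_gt0// enorm_gt0.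
have h := has_jacobian_comp (has_jacobian_dot (has_jacobian_id v) (has_jacobian_id v))
  (has_jacobian_sqrt v0').
have -> : (fun v : 'rV[R]_n => const_mx (enorm v) : 'rV[R]_1) =
    lift_scalar Num.sqrt \o (fun v : 'rV[R]_n => v *m v^T).
  by apply/funext => w; rewrite /= /lift_scalar -enormE.
have -> : (enorm v)^-1 *: v^T = (1%:M *m v^T + 1%:M *m v^T) *m
   (const_mx (2 * Num.sqrt ((v *m v^T) ord0 ord0))^-1 : 'M[R]_1).
  rewrite -enormE const_mx11 mul_mx_scalar !mul1mx; apply/matrixP => i j; rewrite !mxE.
  by field; rewrite enorm_eq0.
exact: h.
Qed.

Lemma C1_on_enorm n :
  C1_on [set v | v != 0] (fun v : 'rV[R]_n => const_mx (enorm v) : 'rV[R]_1).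
Proof.
have -> : (fun v : 'rV[R]_n => const_mx (enorm v) : 'rV[R]_1) =
    lift_scalar Num.sqrt \o (fun v : 'rV[R]_n => v *m v^T).
  by apply/funext => w; rewrite /= /lift_scalar -enormE.
have idC := @C1_on_id n _ (@open_neq0 1 n).
have h := C1_on_comp C1_on_sqrt (C1_on_dot idC idC).
apply: C1_onS h; first exact: open_neq0.
move=> v v0; split; first exact: v0.
by rewrite /preimage /= -enorm_sqr exprn_gt0// enorm_gt0.
Qed.

Lemma C1_on_comp_in m n p (V : set 'rV[R]_n) (W : set 'rV[R]_m)
    (F : 'rV[R]_n -> 'rV[R]_p) (f : 'rV[R]_m -> 'rV[R]_n) :
  C1_on V F -> C1_on W f -> (forall w, W w -> V (f w)) -> C1_on W (F \o f).
Proof.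
move=> FC fC Wf; apply: C1_onS (C1_on_comp FC fC); first exact: fC.1.
by move=> w Ww; split; [exact: Ww|exact: Wf].
Qed.

Lemma C1_on_enorm_comp m n (W : set 'rV[R]_m) (f : 'rV[R]_m -> 'rV[R]_n) :
  C1_on W f -> (forall w, W w -> f w != 0) ->
  C1_on W (fun v => const_mx (enorm (f v)) : 'rV[R]_1).
Proof. by move=> fC f0; exact: (C1_on_comp_in (@C1_on_enorm n) fC f0). Qed.

Lemma lsubmx_linear n1 n2 (v : 'rV[R]_(n1 + n2)) : lsubmx v = v *m col_mx 1%:M 0.
Proof. by rewrite -{2}(hsubmxK v) mul_row_col mulmx1 mulmx0 addr0. Qed.

Lemma rsubmx_linear n1 n2 (v : 'rV[R]_(n1 + n2)) : rsubmx v = v *m col_mx 0 1%:M.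
Proof. by rewrite -{2}(hsubmxK v) mul_row_col mulmx1 mulmx0 add0r. Qed.

Lemma has_jacobian_coord m n (f : 'rV[R]_m -> 'rV[R]_n) (x : 'rV[R]_m) (M : 'M[R]_(m, n)) :
  (forall j, has_jacobian (fun v => const_mx (f v ord0 j) : 'rV[R]_1) x (col j M)) ->
  has_jacobian f x M.
Proof.
move=> H e e0.
have /nbhs_normP[a a0 aP] : \forall y \near x, forall j : 'I_n,
   `|(const_mx (f y ord0 j) : 'rV[R]_1) - const_mx (f x ord0 j) - (y - x) *m col j M| <=
   e * `|y - x|.
  by apply: (@filter_forall _ _ _ (nbhs x)) => j; exact: H.
apply/nbhs_normP; exists a => // y /aP yP.
apply: ler_mx_norm => [|i j]; first by rewrite mulr_ge0// ltW.
apply: le_trans (yP j); apply: le_trans (ler_mx_entry _ ord0 ord0).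
rewrite !mxE ord1 le_eqVlt; apply/orP; left; apply/eqP; congr (`| _ - _ |).
by apply: eq_bigr => k _; rewrite !mxE.
Qed.

Lemma C1_on_coord m n (W : set 'rV[R]_m) (f : 'rV[R]_m -> 'rV[R]_n) : open W ->
  (forall j, C1_on W (fun v => const_mx (f v ord0 j) : 'rV[R]_1)) -> C1_on W f.
Proof.
move=> oW fC.
have H x : W x -> has_jacobian f x
    (\matrix_(i, j) jacobian (fun v => const_mx (f v ord0 j) : 'rV[R]_1) x i ord0).
  move=> Wx; apply: has_jacobian_coord => j.
  rewrite (_ : col j _ = jacobian (fun v => const_mx (f v ord0 j) : 'rV[R]_1) x).
    exact: (C1_on_has_jacobian (fC j) Wx).
  by apply/colP => i; rewrite !mxE.
apply: C1_on_jacobian oW H _ => x Wx.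
apply: continuous_mx_coord => i j.
have -> : (fun y => (\matrix_(i < m, j < n)
      jacobian (fun v => const_mx (f v ord0 j) : 'rV[R]_1) y i ord0) i j) =
    (fun y => jacobian (fun v => const_mx (f v ord0 j) : 'rV[R]_1) y i ord0).
  by apply/funext => y; rewrite mxE.
by apply: continuous_coord; have [] := (fC j).2 x Wx.
Qed.

(** The open set on which the three norms are C1. It contains the fiber because the side lengths are
    positive ([fiber_length_domain]). *)
Definition length_domain n : set 'rV[R]_(n + n) :=
  [set x | [/\ lsubmx x != 0, rsubmx x != 0 & lsubmx x + rsubmx x != 0]].

Lemma open_linear_neq0 m n (M : 'M[R]_(m, n)) : open [set v : 'rV[R]_m | v *m M != 0].
Proof. by apply: open_comp (@open_neq0 1 n) => v _; exact: mulmxr_continuous. Qed.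

Lemma length_domain_open n : open (@length_domain n).
Proof.
have -> : @length_domain n = [set v | v *m col_mx 1%:M 0 != 0] `&`
    ([set v | v *m col_mx 0 1%:M != 0] `&` [set v | v *m (col_mx 1%:M 0 + col_mx 0 1%:M) != 0]).
  apply/seteqP; split => v.
    move=> [a b c]; split; last split.
    - by rewrite /= -lsubmx_linear.
    - by rewrite /= -rsubmx_linear.
    - by rewrite /= mulmxDr -lsubmx_linear -rsubmx_linear.
  move=> [a [b c]]; split.
  - by rewrite lsubmx_linear.
  - by rewrite rsubmx_linear.
  - by rewrite lsubmx_linear rsubmx_linear -mulmxDr.
by apply: openI; [|apply: openI]; exact: open_linear_neq0.
Qed.

Lemma C1_on_length_map n : C1_on (@length_domain n) (@length_map R n).
Proof.
have oD := @length_domain_open n.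
apply: (C1_on_coord oD) => j.
have lC := C1_on_lin oD (@lsubmx_linear n n).
have rC := C1_on_lin oD (@rsubmx_linear n n).
have : [\/ j = 0, j = 1 | j = 2].
  by case: j => -[|[|[|//]]] ?; [apply: Or31|apply: Or32|apply: Or33]; exact/val_inj.
move=> [->|->|->].
- have -> : (fun v => const_mx (@length_map R n v ord0 0) : 'rV[R]_1) =
    (fun v => const_mx (enorm (lsubmx v))) by apply/funext => v; rewrite mxE.
  by apply: C1_on_enorm_comp lC _ => v [].
- have -> : (fun v => const_mx (@length_map R n v ord0 1) : 'rV[R]_1) =
    (fun v => const_mx (enorm (rsubmx v))) by apply/funext => v; rewrite mxE.
  by apply: C1_on_enorm_comp rC _ => v [].
- have -> : (fun v => const_mx (@length_map R n v ord0 2) : 'rV[R]_1) =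
    (fun v => const_mx (enorm (lsubmx v + rsubmx v))) by apply/funext => v; rewrite mxE.
  by apply: (C1_on_enorm_comp (C1_onD lC rC)) => v [].
Qed.

End euclidean_norm.

(** * Hemispheres as graphs over the unit ball *)

Section hemisphere.
Context {R : realType} (d : nat).
Implicit Types (x : 'rV[R]_d) (c : R).

Lemma unit_ballP x : unit_ball x <-> (x *m x^T) ord0 ord0 < 1.
Proof.
rewrite -enorm_sqr /unit_ball /=; split => [x1|].
  by rewrite expr_lt1// enorm_ge0.
by rewrite expr_lt1// enorm_ge0.
Qed.

Lemma unit_ball_open : open (@unit_ball R d).
Proof.
have -> : @unit_ball R d = [set x : 'rV[R]_d | (x *m x^T) ord0 ord0 < 1].
  by apply/seteqP; split => x /unit_ballP.
apply: (open_comp (f := fun x : 'rV[R]_d => (x *m x^T) ord0 ord0) _ (@open_lt _ 1)).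
move=> x _; apply: (continuous_coord (f := fun x : 'rV[R]_d => x *m x^T)).
exact: (C1_on_continuous (C1_on_dot (C1_on_id openT) (C1_on_id openT)) (I : setT x)).
Qed.

Definition height x := Num.sqrt (1 - enorm x ^+ 2).

Lemma height_gt0 x : unit_ball x -> 0 < height x.
Proof. by move=> /unit_ballP x1; rewrite sqrtr_gt0 subr_gt0 enorm_sqr. Qed.

Lemma height_sqr x : unit_ball x -> height x ^+ 2 = 1 - enorm x ^+ 2.
Proof. by move=> /unit_ballP x1; rewrite sqr_sqrtr// subr_ge0 enorm_sqr ltW. Qed.

Lemma hemisphere_last c x : hemisphere c x ord0 (rshift d ord0) = c * height x.
Proof. by rewrite row_mxEr mxE. Qed.

Lemma enorm_hemisphere c x : c ^+ 2 = 1 -> unit_ball x -> enorm (hemisphere c x) = 1.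
Proof.
move=> c1 Bx; apply: enorm_uniq => //; rewrite -enorm_sqr enorm_row_mx enorm11 !mxE.
rewrite real_normK ?num_real// exprMn c1 mul1r height_sqr// expr1n.
by rewrite addrC subrK.
Qed.

Lemma hemisphere_surj (u : 'rV[R]_(d + 1)) : enorm u = 1 -> 0 < u ord0 (rshift d ord0) ->
  unit_ball (lsubmx u) /\ hemisphere 1 (lsubmx u) = u.
Proof.
move=> u1 u0.
have uE : enorm u ^+ 2 = enorm (lsubmx u) ^+ 2 + u ord0 (rshift d ord0) ^+ 2.
  by rewrite -{1}(hsubmxK u) enorm_row_mx enorm11 mxE real_normK ?num_real.
have hE : 1 - enorm (lsubmx u) ^+ 2 = u ord0 (rshift d ord0) ^+ 2.
  by rewrite -(expr1n R 2) -{1}u1 uE addrC addKr.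
split; first by apply/unit_ballP; rewrite -subr_gt0 -enorm_sqr hE exprn_gt0.
rewrite -{2}(hsubmxK u) /hemisphere; congr row_mx.
apply/rowP => i; rewrite !mxE hE mul1r sqrtr_sqr gtr0_norm//.
by congr (u _ _); rewrite !ord1.
Qed.

Lemma has_jacobian_hemisphere c x : unit_ball x ->
  has_jacobian (hemisphere c) x (row_mx 1%:M (- (c / height x) *: x^T)).
Proof.
move=> Bx; apply: has_jacobian_row_mx; first exact: has_jacobian_id.
have h1 := has_jacobian_comp (has_jacobian_dot (has_jacobian_id x) (has_jacobian_id x))
  (has_jacobian_mulmx (- 1%:M) 1%:M (x *m x^T)).
have h2 := has_jacobian_comp h1.
have e (y : 'rV[R]_d) : (y *m y^T *m (- 1%:M) + 1%:M : 'rV[R]_1) ord0 ord0 = 1 - enorm y ^+ 2.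
  by rewrite mulmxN mulmx1 enorm_sqr addrC !mxE eqxx.
have p : 0 < (x *m x^T *m (- 1%:M) + 1%:M : 'rV[R]_1) ord0 ord0.
  by rewrite e subr_gt0 enorm_sqr; apply/unit_ballP.
have h3 := has_jacobian_comp (h2 _ _ _ (has_jacobian_sqrt p)) (has_jacobian_mulmx (c%:M) 0 _).
have -> : (fun v : 'rV[R]_d => const_mx (c * Num.sqrt (1 - enorm v ^+ 2)) : 'rV[R]_1) =
   (fun v => v *m c%:M + 0) \o (lift_scalar Num.sqrt \o
      ((fun v => v *m - 1%:M + 1%:M) \o (fun v : 'rV[R]_d => v *m v^T))).
  apply/funext => v /=; rewrite addr0 /lift_scalar e !const_mx11 mul_mx_scalar.
  by rewrite scale_scalar_mx.
have -> : - (c / height x) *: x^T = (1%:M *m x^T + 1%:M *m x^T) *m (- 1%:M) *m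
    (const_mx (2 * Num.sqrt ((x *m x^T *m (- 1%:M) + 1%:M : 'rV[R]_1) ord0 ord0))^-1 : 'M[R]_1) *m
    c%:M.
  rewrite e !mul1mx mulmxN mulmx1 const_mx11 !mul_mx_scalar -/(height x).
  apply/matrixP => i j; rewrite !mxE; field.
  by rewrite gt_eqF// height_gt0.
exact: h3.
Qed.

Lemma continuous_height x : unit_ball x -> {for x, continuous height}.
Proof.
move=> Bx; have := has_jacobian_hemisphere 1 Bx => /has_jacobianP[df _].
have -> : height = (fun x => hemisphere 1 x ord0 (rshift d ord0)).
  by apply/funext => y; rewrite hemisphere_last mul1r.
by apply: continuous_coord; exact: differentiable_continuous.
Qed.

Lemma C1_on_hemisphere c : C1_on (@unit_ball R d) (hemisphere c).
Proof.
apply: (C1_on_jacobian unit_ball_open (has_jacobian_hemisphere c)) => x Bx.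
apply: continuous_mx_coord => i j; have [j' ->|j' ->] := split_ordP j.
  have -> : (fun y => (row_mx 1%:M (- (c / height y) *: y^T) : 'M[R]_(d, d + 1)) i (lshift 1 j')) =
      cst ((1%:M : 'M[R]_d) i j').
    by apply/funext => y; rewrite row_mxEl.
  exact: cst_continuous.
have -> : (fun y => (row_mx 1%:M (- (c / height y) *: y^T) : 'M[R]_(d, d + 1)) i (rshift d j')) =
    (fun y => - (c / height y) * y ord0 i).
  by apply/funext => y; rewrite row_mxEr !mxE ord1.
apply: continuousM; last exact: continuous_entry.
apply: continuousN; apply: continuousM; first exact: cst_continuous.
by apply: continuousV; [rewrite gt_eqF// height_gt0|exact: continuous_height].
Qed.

Lemma jacobian_hemisphere c x : unit_ball x ->
  jacobian (hemisphere c) x = row_mx 1%:M (- (c / height x) *: x^T).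
Proof. by move=> Bx; have [_] := (has_jacobianP _ _ _).1 (has_jacobian_hemisphere c Bx). Qed.

Lemma hemisphere_tangent c x : c ^+ 2 = 1 -> unit_ball x ->
  jacobian (hemisphere c) x *m (hemisphere c x)^T = 0.
Proof.
move=> c1 Bx; rewrite jacobian_hemisphere// tr_row_mx mul_row_col mul1mx const_mx11 tr_scalar_mx.
rewrite mul_mx_scalar scalerA mulrN -/(height x).
have -> : c * height x * (c / height x) = c ^+ 2.
  by field; rewrite gt_eqF// height_gt0.
by rewrite c1 scaleN1r subrr.
Qed.

(** Completing the tangent frame J by the unit normal w gives a square matrix B. Its Gram matrix is
    that of J bordered by 1, and a block elimination gives det B = c / height. *)
Lemma det_hemisphere_gram c x : c ^+ 2 = 1 -> unit_ball x ->
  \det (jacobian (hemisphere c) x *m (jacobian (hemisphere c) x)^T) = height x ^- 2.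
Proof.
move=> c1 Bx; have h0 : height x != 0 by rewrite gt_eqF// height_gt0.
pose J := jacobian (hemisphere c) x; pose w := hemisphere c x.
have JE : J = row_mx 1%:M (- (c / height x) *: x^T) by exact: jacobian_hemisphere.
have wE : w = row_mx x (c * height x)%:M by rewrite /w /hemisphere const_mx11.
have T : J *m w^T = 0 by exact: hemisphere_tangent.
pose B : 'M[R]_(d + 1) := col_mx J w.
have BB : B *m B^T = block_mx (J *m J^T) 0 0 1%:M.
  have T' : w *m J^T = 0 by rewrite -[LHS]trmxK trmx_mul trmxK T trmx0.
  rewrite tr_col_mx mul_col_row T T'.
  by rewrite dot_enorm enorm_hemisphere// expr1n.
have dB : \det B = c / height x.
  have -> : B = block_mx 1%:M 0 x 1%:M *m
      block_mx 1%:M (- (c / height x) *: x^T) 0 (c / height x)%:M.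
    rewrite mulmx_block !mul1mx !mul0mx !addr0 !mulmx1 /B JE wE /block_mx.
    congr col_mx; congr row_mx.
    rewrite -scalemxAr dot_enorm scale_scalar_mx -raddfD; congr (_%:M).
    have -> : enorm x ^+ 2 = 1 - height x ^+ 2 by rewrite height_sqr// opprB addrC subrK.
    by field.
  by rewrite det_mulmx det_lblock det_ublock !det1 det_scalar1 !mul1r.
have : \det B * \det B = \det (J *m J^T).
  by rewrite -{2}det_tr -det_mulmx BB det_ublock det1 mulr1.
move=> <-; rewrite dB; move: c1 => /eqP; rewrite sqrf_eq1 => /orP[]/eqP ->; field => //.
Qed.

Lemma param_volume_hemisphere c : c ^+ 2 = 1 ->
  param_volume (@unit_ball R d) (hemisphere c) =
  (\int[lebesgue_rV d]_(x in @unit_ball R d) ((height x)^-1)%:E)%E.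
Proof.
move=> c1; apply: eq_integral => x; rewrite in_setE => Bx.
rewrite det_hemisphere_gram// -exprVn sqrtr_sqr ger0_norm//.
by rewrite invr_ge0 ltW// height_gt0.
Qed.

End hemisphere.

Lemma vol_sphereE (R : realType) d :
  vol_sphere R d =
  (2%:E * \int[lebesgue_rV d]_(x in @unit_ball R d) ((height x)^-1)%:E)%E.
Proof.
rewrite /vol_sphere !param_volume_hemisphere ?sqrrN ?expr1n//.
have -> : (2%:E = 1%:E + 1%:E :> \bar R)%E by rewrite -EFinD.
by rewrite ge0_muleDl ?mul1e// lee_fin.
Qed.

Section linear_maps.
Context {R : realType}.

Lemma C1_on_mulmxr m p q (W : set 'rV[R]_m) (f : 'rV[R]_m -> 'rV[R]_p) (A : 'M[R]_(p, q)) :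
  C1_on W f -> C1_on W (fun v => f v *m A).
Proof.
move=> fC; apply: (@C1_on_comp_in R m p q setT W (fun v => v *m A) f) => //.
by apply: (C1_on_lin (M := A)) => //; exact: openT.
Qed.

Lemma C1_on_cst m p (W : set 'rV[R]_m) (c : 'rV[R]_p) : open W -> C1_on W (fun=> c).
Proof.
move=> oW; apply: (C1_on_jacobian (M := fun=> 0) oW) => x _.
  move=> e e0; apply/nbhs_normP; exists 1 => // y _.
  by rewrite subrr mulmx0 subrr normr0 mulr_ge0// ltW.
exact: cst_continuous.
Qed.

Lemma orthogonal_unit m (A : 'M[R]_m) : A *m A^T = 1%:M -> `|\det A| = 1.
Proof.
move=> AA; have : \det A ^+ 2 = 1 by rewrite expr2 -{2}det_tr -det_mulmx AA det1.
by move=> /eqP; rewrite sqrf_eq1 => /orP[]/eqP ->; rewrite ?normrN normr1.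
Qed.

Lemma orthogonal_tr m (A : 'M[R]_m) : A *m A^T = 1%:M -> A^T *m A = 1%:M.
Proof. exact: mulmx1C. Qed.

End linear_maps.

(** * Polar charts of pairs of vectors *)

Section straighten.
Context {R : realType} (d : nat).
Let n := (d + 1)%N.
Implicit Types (u v : 'rV[R]_(d + 1)) (A N : 'M[R]_(d + 1)).

Definition last_coord u : R := u ord0 (rshift d ord0).
Definition last_axis : 'rV[R]_(d + 1) := row_mx 0 1%:M.

Lemma dot_last_axis u : u *m last_axis^T = (last_coord u)%:M.
Proof.
rewrite -{1}(hsubmxK u) /last_axis tr_row_mx mul_row_col trmx0 mulmx0 add0r tr_scalar_mx mulmx1.
by rewrite [LHS]mx11_scalar mxE.
Qed.

Lemma last_coord_axis : last_coord last_axis = 1.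
Proof. by rewrite /last_coord /last_axis row_mxEr mxE. Qed.

Lemma enorm_last_axis : enorm last_axis = 1.
Proof.
by apply: enorm_uniq => //; rewrite dot_last_axis mxE eqxx last_coord_axis expr1n.
Qed.

Definition upper : set 'rV[R]_(d + 1) := [set u | 0 < last_coord u].

Lemma upper_neq0 u : upper u -> u != 0.
Proof. by apply: contraTneq => ->; rewrite /upper /= /last_coord mxE ltxx. Qed.

Definition mirror_axis u := u + enorm u *: last_axis.

Lemma mirror_axis_neq0 u : upper u -> mirror_axis u != 0.
Proof.
move=> u0; apply: upper_neq0; rewrite /upper /= /mirror_axis.
rewrite {1}/last_coord mxE [X in _ + X]mxE -!/(last_coord _) last_coord_axis mulr1.
by rewrite ltr_pwDl// enorm_ge0.
Qed.

(* The reflection that maps u to - |u| e, with e the last basis vector. *)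
Definition mirror u : 'M[R]_(d + 1) :=
  1%:M - (2 / enorm (mirror_axis u) ^+ 2) *: ((mirror_axis u)^T *m mirror_axis u).

Lemma mirror_sym u : (mirror u)^T = mirror u.
Proof. by rewrite /mirror linearB /= linearZ /= trmx_mul trmxK trmx1. Qed.

Lemma mulmx_mirror u v : v *m mirror u =
  v - (2 / enorm (mirror_axis u) ^+ 2) *: (v *m (mirror_axis u)^T *m mirror_axis u).
Proof. by rewrite /mirror mulmxBr mulmx1 -scalemxAr mulmxA. Qed.

Lemma mirrorK u : upper u -> mirror u *m mirror u = 1%:M.
Proof.
move=> /mirror_axis_neq0; rewrite -enorm_gt0 => u0; rewrite /mirror.
set v := mirror_axis u in u0 *; set c := 2 / _.
rewrite mulmxBl mul1mx mulmxBr mulmx1 -scalemxAl -scalemxAr mulmxA -(mulmxA v^T v) dot_enorm.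
rewrite mul_mx_scalar -scalemxAl scalerA scalerA.
have -> : c * (c * enorm v ^+ 2) = c + c by rewrite /c; field; rewrite gt_eqF.
by rewrite scalerDl opprB addrK subrK.
Qed.

Lemma mirror_orthogonal u : upper u -> mirror u *m (mirror u)^T = 1%:M.
Proof. by rewrite mirror_sym; exact: mirrorK. Qed.

(** For the mirror vector v = u + |u| e one has |v|^2 = 2 (u . v), so the reflection subtracts
    exactly v from u. *)
Lemma mirror_self u : upper u -> u *m mirror u = - (enorm u *: last_axis).
Proof.
move=> u0; have := mirror_axis_neq0 u0; rewrite -enorm_gt0 => v0.
have uv : u *m (mirror_axis u)^T = (enorm u * (enorm u + last_coord u))%:M.
  rewrite /mirror_axis linearD /= linearZ /= mulmxDr dot_enorm -scalemxAr dot_last_axis.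
  by rewrite scale_scalar_mx -raddfD /= mulrDr expr2.
have vv : enorm (mirror_axis u) ^+ 2 = 2 * (enorm u * (enorm u + last_coord u)).
  rewrite enorm_sqr {1}/mirror_axis mulmxDl uv -scalemxAl.
  rewrite /mirror_axis linearD /= linearZ /= mulmxDr -scalemxAr dot_enorm enorm_last_axis.
  by rewrite dotC dot_last_axis !mxE eqxx !mulr1n expr1n; ring.
have e0 : enorm u * (enorm u + last_coord u) != 0.
  by apply/eqP => e; have := exprn_gt0 2 v0; rewrite vv e mulr0 ltxx.
rewrite mulmx_mirror uv mul_scalar_mx scalerA vv.
rewrite (_ : _ * _ = 1); last by field; move: e0; rewrite mulf_eq0 negb_or => /andP[-> ->].
by rewrite scale1r /mirror_axis opprD addrA subrr sub0r.
Qed.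

(* Reflecting the second vector along with the first one makes |xi|, |eta| and
   |xi + eta| depend only on the coordinates along and across the last axis. *)
Definition straighten N A (x : 'rV[R]_(n + n)) : 'rV[R]_(n + n) :=
  row_mx (lsubmx x *m A) (rsubmx x *m N *m mirror (lsubmx x) *m A).

Definition upper_domain : set 'rV[R]_(n + n) := [set x | upper (lsubmx x)].

Lemma upper_domain_open : open upper_domain.
Proof.
apply: (open_comp (f := fun x : 'rV[R]_(n + n) => last_coord (lsubmx x)) _ (@open_gt _ 0)).
move=> x _; have -> : (fun x : 'rV[R]_(n + n) => last_coord (lsubmx x)) =
  (fun x => x ord0 (lshift n (rshift d ord0))) by apply/funext => y; rewrite /last_coord mxE.
exact: continuous_entry.
Qed.

Lemma C1_on_straighten N A : C1_on upper_domain (straighten N A).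
Proof.
have oD := upper_domain_open.
have lC := C1_on_lin oD (@lsubmx_linear R n n).
have rC := C1_on_lin oD (@rsubmx_linear R n n).
have aC : C1_on upper_domain (fun x => mirror_axis (lsubmx x)).
  have -> : (fun x : 'rV[R]_(n + n) => mirror_axis (lsubmx x)) =
     (fun x => lsubmx x + (const_mx (enorm (lsubmx x)) : 'rV[R]_1) *m last_axis).
    by apply/funext => x; rewrite mul_const_mx11.
  have eC : C1_on upper_domain (fun x => const_mx (enorm (lsubmx x)) : 'rV[R]_1).
    by apply: (C1_on_enorm_comp lC) => w; exact: upper_neq0.
  exact: (C1_onD lC (C1_on_scale eC (C1_on_cst last_axis oD))).
apply: (C1_on_row_mx (C1_on_mulmxr A lC)).
apply: C1_on_mulmxr.
have -> : (fun x : 'rV[R]_(n + n) => rsubmx x *m N *m mirror (lsubmx x)) =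
    (fun x => rsubmx x *m N +
       lift_scalar GRing.inv (mirror_axis (lsubmx x) *m (mirror_axis (lsubmx x))^T) *m
       (rsubmx x *m N *m (mirror_axis (lsubmx x))^T *m (mirror_axis (lsubmx x) *m (- 2)%:M))).
  apply/funext => x; rewrite mulmx_mirror /lift_scalar -enorm_sqr mul_const_mx11.
  by rewrite mul_mx_scalar -scalemxAr scalerA -scaleNr; congr (_ + _ *: _); ring.
have rNC := C1_on_mulmxr N rC.
have iC : C1_on upper_domain (fun x =>
    lift_scalar GRing.inv (mirror_axis (lsubmx x) *m (mirror_axis (lsubmx x))^T)).
  apply: (C1_on_comp_in (@C1_on_inv R) (C1_on_dot aC aC)) => x Dx.
  by rewrite /= -enorm_sqr exprn_gt0// enorm_gt0 mirror_axis_neq0.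
exact: (C1_onD rNC (C1_on_scale iC (C1_on_scale (C1_on_dot rNC aC) (C1_on_mulmxr (- 2)%:M aC)))).
Qed.

(** The first component depends on xi only and the second is linear in eta, so the Jacobian is block
    triangular. X, the derivative of the mirror in xi, stays implicit since the determinant does not
    see it. *)
Lemma straighten_jacobian N A x : upper_domain x ->
  exists X, jacobian (straighten N A) x =
    block_mx A X 0 (N *m mirror (lsubmx x) *m A).
Proof.
move=> Dx; have hJ := C1_on_has_jacobian (C1_on_straighten N A) Dx.
set J := jacobian _ _ in hJ *.
have lJ : lsubmx J = col_mx A 0.
  have h1 := has_jacobian_comp hJ (@has_jacobian_lsubmx R n n _).
  have [_ e1] := (has_jacobianP _ _ _).1 h1.
  have h2 : has_jacobian (@lsubmx R 1 n n \o straighten N A) x (col_mx A 0).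
    apply: has_jacobian_lin => v; rewrite /= /straighten row_mxKl lsubmx_linear -mulmxA.
    by rewrite mul_col_mx mul1mx mul0mx.
  have [_ e2] := (has_jacobianP _ _ _).1 h2.
  rewrite -e2 e1 -{2}(hsubmxK J) mul_row_col mulmx1 mulmx0 addr0; exact: erefl.
have dJ : dsubmx J = row_mx 0 (N *m mirror (lsubmx x) *m A).
  (* The affine slice through x on which xi is frozen; along it [straighten] is affine, which gives
     the lower rows of J. *)
  pose j z := (z - rsubmx x) *m (row_mx 0 1%:M : 'M[R]_(n, n + n)) + x.
  have jE z : j z = row_mx (lsubmx x) z.
    rewrite /j mul_mx_row mulmx0 mulmx1 -{2}(hsubmxK x) add_row_mx add0r subrK; exact: erefl.
  have hj : has_jacobian j (rsubmx x) (row_mx 0 1%:M).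
    have -> : j = fun z => z *m row_mx 0 1%:M + (x - rsubmx x *m row_mx 0 1%:M).
      by apply/funext => z; rewrite /j mulmxBl -addrA; congr (_ + _); rewrite addrC.
    exact: has_jacobian_mulmx.
  have jx : j (rsubmx x) = x by rewrite jE hsubmxK.
  have h1 : has_jacobian (straighten N A \o j) (rsubmx x) (row_mx 0 1%:M *m J).
    by apply: has_jacobian_comp hj _; rewrite jx.
  have h2 : has_jacobian (straighten N A \o j) (rsubmx x)
      (row_mx 0 (N *m mirror (lsubmx x) *m A)).
    have -> : straighten N A \o j = fun z =>
      z *m row_mx 0 (N *m mirror (lsubmx x) *m A) + row_mx (lsubmx x *m A) 0.
      apply/funext => z; rewrite /= jE /straighten row_mxKl row_mxKr mul_mx_row mulmx0.
      by rewrite add_row_mx add0r addr0 !mulmxA.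
    exact: has_jacobian_mulmx.
  have [_ e1] := (has_jacobianP _ _ _).1 h1.
  have [_ e2] := (has_jacobianP _ _ _).1 h2.
  rewrite -e2 e1 -{2}(vsubmxK J) mul_row_col mul0mx mul1mx add0r; exact: erefl.
exists (ursubmx J); rewrite -[LHS]submxK /ulsubmx /dlsubmx /drsubmx.
rewrite dJ row_mxKr row_mxKl -/(ursubmx J).
have uA : usubmx (lsubmx J) = A by rewrite lJ col_mxKu.
congr block_mx; rewrite -uA; apply/matrixP => a b; rewrite !mxE; exact: erefl.
Qed.

Lemma straighten_jacobian_det N A x : N *m N^T = 1%:M -> A *m A^T = 1%:M -> upper_domain x ->
  `|\det (jacobian (straighten N A) x)| = 1.
Proof.
move=> NN AA Dx; have [X ->] := straighten_jacobian N A Dx.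
rewrite det_ublock !det_mulmx !normrM !orthogonal_unit ?mulr1//.
exact: mirror_orthogonal.
Qed.

Lemma straighten_inj N A x y : N *m N^T = 1%:M -> A *m A^T = 1%:M ->
  upper_domain x -> upper_domain y -> straighten N A x = straighten N A y -> x = y.
Proof.
move=> NN AA Dx Dy /eq_row_mx[e1 e2].
have e3 : lsubmx x = lsubmx y.
  by rewrite -[LHS]mulmx1 -AA mulmxA e1 -mulmxA AA mulmx1.
rewrite -(hsubmxK x) -(hsubmxK y) e3; congr row_mx.
move: e2; rewrite e3 => /(congr1 (mulmx^~ A^T)); rewrite -!mulmxA AA !mulmx1 !mulmxA.
move=> /(congr1 (mulmx^~ (mirror (lsubmx y)))); rewrite -!mulmxA (mirrorK Dy) !mulmx1.
by move=> /(congr1 (mulmx^~ N^T)); rewrite -!mulmxA NN !mulmx1.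
Qed.

(** The mirror is an involution, so xi is itself the mirror image of - |xi| e. The sum of the two
    components is therefore the image of eta N - |xi| e under an isometry. *)
Lemma length_map_straighten N A x : N *m N^T = 1%:M -> A *m A^T = 1%:M -> upper_domain x ->
  length_map (straighten N A x) =
  \row_(i < 3) [:: enorm (lsubmx x); enorm (rsubmx x);
     enorm (rsubmx x *m N - enorm (lsubmx x) *: last_axis)]`_i.
Proof.
move=> NN AA Dx; apply/rowP => i; rewrite !mxE /straighten row_mxKl row_mxKr.
have -> : lsubmx x *m A + rsubmx x *m N *m mirror (lsubmx x) *m A =
    (rsubmx x *m N - enorm (lsubmx x) *: last_axis) *m mirror (lsubmx x) *m A.
  rewrite -(mirror_self Dx) [_ *m N + _]addrC (mulmxDl _ _ (mirror _)) -(mulmxA (lsubmx x)).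
  by rewrite (mirrorK Dx) mulmx1 mulmxDl.
by rewrite !enorm_orthogonal//; exact: mirror_orthogonal.
Qed.

End straighten.

(** * Gram matrices of polar frames *)

Section gram.
Context {R : realType}.

(** The Gram determinant is meaningful without identifying the two expressions of the dimension, so
    it is what gets computed; the cast enters only through this square. *)
Lemma det_castmx_sqr m n (e : m = n) (J : 'M[R]_(m, n)) :
  \det (castmx (e, erefl n) J) ^+ 2 = \det (J *m J^T).
Proof. by case: n / e J => J; rewrite castmx_id det_mulmx det_tr. Qed.

Lemma castmx_mulmx m n p q (e : m = n) (M : 'M[R]_(m, p)) (N : 'M[R]_(p, q)) :
  castmx (e, erefl q) (M *m N) = castmx (e, erefl p) M *m N.
Proof. by case: n / e; rewrite !castmx_id. Qed.

(** X is the derivative of a radius c times a unit vector v: its radial part E v and its tangential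
    part are orthogonal, so the cross terms vanish. *)
Lemma scaled_frame_gram m p n (E : 'cV[R]_m) (P : 'M[R]_(m, p)) (J : 'M[R]_(p, n))
    (v : 'rV[R]_n) c : v *m v^T = 1%:M -> J *m v^T = 0 ->
  let X := E *m v + P *m J *m c%:M in
  X *m X^T = E *m E^T + P *m (c ^+ 2 *: (J *m J^T)) *m P^T.
Proof.
move=> vv Jv /=; have vJ : v *m J^T = 0 by rewrite -[LHS]trmxK trmx_mul trmxK Jv trmx0.
rewrite mul_mx_scalar; set X := P *m J.
rewrite linearD /= linearZ /= mulmxDl !mulmxDr trmx_mul -!scalemxAl -!scalemxAr.
have -> : E *m v *m (v^T *m E^T) = E *m E^T by rewrite mulmxA -(mulmxA E) vv mulmx1.
have -> : X *m (v^T *m E^T) = 0 by rewrite /X !mulmxA -(mulmxA P) Jv mulmx0 mul0mx.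
have -> : E *m v *m X^T = 0 by rewrite /X trmx_mul !mulmxA -(mulmxA E) vJ mulmx0 mul0mx.
rewrite !scaler0 addr0 add0r; congr (_ + _).
by rewrite /X trmx_mul -scalemxAl !mulmxA scalerA -expr2.
Qed.

Lemma sandwich_u m p q n (P : 'M[R]_(m, n)) (M : 'M[R]_n) :
  col_mx P (0 : 'M[R]_(p, n)) *m M *m (col_mx P (0 : 'M[R]_(q, n)))^T =
  block_mx (P *m M *m P^T) 0 0 0.
Proof. by rewrite mul_col_mx mul0mx tr_col_mx trmx0 mul_col_row !mul0mx mulmx0. Qed.

Lemma sandwich_d m p q n (P : 'M[R]_(m, n)) (M : 'M[R]_n) :
  col_mx (0 : 'M[R]_(p, n)) P *m M *m (col_mx (0 : 'M[R]_(q, n)) P)^T =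
  block_mx 0 0 0 (P *m M *m P^T).
Proof. by rewrite mul_col_mx mul0mx tr_col_mx trmx0 mul_col_row !mul0mx mulmx0. Qed.

End gram.

(** * Polar coordinates of a straightened pair, in dimension n = l + 2 *)

Section polar.
Context {R : realType} (l : nat).
Implicit Types w : 'rV[R]_(l + 1 + l + 3).

Definition polar_x w : 'rV[R]_(l + 1) := lsubmx (lsubmx w).
Definition polar_y w : 'rV[R]_l := rsubmx (lsubmx w).
(** For i = 0, 1, 2 these are rho, p and q. *)
Definition polar_t i w : R := rsubmx w ord0 i.

Let Px : 'M[R]_(l + 1 + l + 3, l + 1) := col_mx (col_mx 1%:M 0) 0.
Let Py : 'M[R]_(l + 1 + l + 3, l) := col_mx (col_mx 0 1%:M) 0.
Let Et (i : 'I_3) : 'cV[R]_(l + 1 + l + 3) := col_mx 0 (delta_mx i ord0).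

Lemma polar_x_linear w : polar_x w = w *m Px.
Proof.
rewrite -{2}(hsubmxK w) -(hsubmxK (lsubmx w)) !mul_row_col mulmx1 !mulmx0 !addr0.
exact: erefl.
Qed.

Lemma polar_y_linear w : polar_y w = w *m Py.
Proof.
rewrite -{2}(hsubmxK w) -(hsubmxK (lsubmx w)) !mul_row_col mulmx1 !mulmx0 addr0 add0r.
exact: erefl.
Qed.

Lemma polar_t_linear i w : (const_mx (polar_t i w) : 'rV[R]_1) = w *m Et i.
Proof.
by rewrite -{2}(hsubmxK w) mul_row_col mulmx0 add0r mulmx_delta_col.
Qed.

Definition polar_domain : set 'rV[R]_(l + 1 + l + 3) :=
  [set w | [/\ unit_ball (polar_x w), unit_ball (polar_y w), 0 < polar_t 0 w & 0 < polar_t 2 w]].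

Definition polar w : 'rV[R]_((l + 1 + 1) + (l + 1 + 1)) :=
  row_mx ((const_mx (polar_t 0 w) : 'rV[R]_1) *m hemisphere 1 (polar_x w))
    (row_mx ((const_mx (polar_t 2 w) : 'rV[R]_1) *m hemisphere 1 (polar_y w))
      (const_mx (polar_t 1 w))).

Lemma open_linear_preimage m n (f : 'rV[R]_m -> 'rV[R]_n) M (A : set 'rV[R]_n) :
  (forall v, f v = v *m M) -> open A -> open (f @^-1` A).
Proof.
move=> fE oA; have -> : f = fun v => v *m M by apply/funext.
by apply: open_comp => // v _; exact: mulmxr_continuous.
Qed.

Lemma polar_domain_open : open polar_domain.
Proof.
have -> : polar_domain = (polar_x @^-1` @unit_ball R (l + 1)) `&` (polar_y @^-1` @unit_ball R l) `&`
   (((fun w => const_mx (polar_t 0 w)) @^-1` [set u : 'rV[R]_1 | 0 < u ord0 ord0]) `&`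
    ((fun w => const_mx (polar_t 2 w)) @^-1` [set u : 'rV[R]_1 | 0 < u ord0 ord0])).
  apply/seteqP; split => w.
    by move=> [a b c d]; split; split => //; rewrite /preimage /= mxE.
  by move=> [[a b]]; rewrite /preimage /= !mxE => -[c d]; split.
have o : open [set u : 'rV[R]_1 | 0 < u ord0 ord0] := (@C1_on_sqrt R).1.
apply: openI; apply: openI.
- exact: (open_linear_preimage polar_x_linear (@unit_ball_open R _)).
- exact: (open_linear_preimage polar_y_linear (@unit_ball_open R _)).
- exact: (open_linear_preimage (polar_t_linear 0) o).
- exact: (open_linear_preimage (polar_t_linear 2) o).
Qed.

Lemma C1_on_polar : C1_on polar_domain polar.
Proof.
have oD := polar_domain_open.
have tC i := C1_on_lin oD (polar_t_linear i).
have xC : C1_on polar_domain (fun w => hemisphere 1 (polar_x w)).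
  by apply: (C1_on_comp_in (@C1_on_hemisphere R (l + 1) 1) (C1_on_lin oD polar_x_linear)) => w [].
have yC : C1_on polar_domain (fun w => hemisphere 1 (polar_y w)).
  by apply: (C1_on_comp_in (@C1_on_hemisphere R l 1) (C1_on_lin oD polar_y_linear)) => w [].
exact: (C1_on_row_mx (C1_on_scale (tC 0) xC) (C1_on_row_mx (C1_on_scale (tC 2) yC) (tC 1))).
Qed.

Let one_sqr : (1 : R) ^+ 2 = 1. Proof. exact: expr1n. Qed.

(** The Gram matrix is block diagonal: t0^2 and t2^2 times the Gram matrices of the two hemispheres,
    and an identity block of size 3 to which rho, q and p contribute one diagonal entry each. *)
Lemma polar_gram w : polar_domain w ->
  \det (jacobian polar w *m (jacobian polar w)^T) =
  (polar_t 0 w ^+ (l + 1) * polar_t 2 w ^+ l / height (polar_x w) / height (polar_y w)) ^+ 2.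
Proof.
move=> [Bx By t0 t2].
set wx := hemisphere 1 (polar_x w); set wy := hemisphere 1 (polar_y w).
set Jx := jacobian (hemisphere 1) (polar_x w); set Jy := jacobian (hemisphere 1) (polar_y w).
have xx : wx *m wx^T = 1%:M by rewrite dot_enorm enorm_hemisphere ?expr1n.
have yy : wy *m wy^T = 1%:M by rewrite dot_enorm enorm_hemisphere ?expr1n.
have Jxx : Jx *m wx^T = 0 by exact: (hemisphere_tangent one_sqr Bx).
have Jyy : Jy *m wy^T = 0 by exact: (hemisphere_tangent one_sqr By).
have ht i : has_jacobian (fun w => const_mx (polar_t i w) : 'rV[R]_1) w (Et i).
  exact: (has_jacobian_lin _ (polar_t_linear i)).
have hx : has_jacobian (fun w => hemisphere 1 (polar_x w)) w (Px *m Jx).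
  apply: has_jacobian_comp (has_jacobian_lin _ polar_x_linear) _.
  by apply: (C1_on_has_jacobian (@C1_on_hemisphere R _ 1) Bx).
have hy : has_jacobian (fun w => hemisphere 1 (polar_y w)) w (Py *m Jy).
  apply: has_jacobian_comp (has_jacobian_lin _ polar_y_linear) _.
  by apply: (C1_on_has_jacobian (@C1_on_hemisphere R _ 1) By).
have := has_jacobian_row_mx (has_jacobian_scale (ht 0) hx)
  (has_jacobian_row_mx (has_jacobian_scale (ht 2) hy) (ht 1)).
move=> /has_jacobianP[_ ->].
rewrite !tr_row_mx !mul_row_col !mxE !scaled_frame_gram//.
have PxE (M : 'M[R]_(l + 1)) : Px *m M *m Px^T = block_mx (block_mx M 0 0 0) 0 0 0.
  by rewrite /Px !sandwich_u mul1mx trmx1 mulmx1.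
have PyE (M : 'M[R]_l) : Py *m M *m Py^T = block_mx (block_mx 0 0 0 M) 0 0 0.
  by rewrite /Py sandwich_u sandwich_d mul1mx trmx1 mulmx1.
have EE i : Et i *m (Et i)^T = block_mx 0 0 0 (delta_mx i i).
  by rewrite -[X in X *m _]mulmx1 /Et sandwich_d !mulmx1 trmx_delta mul_delta_mx.
have D3 : delta_mx 0 0 + (delta_mx 2 2 + delta_mx 1 1) = 1%:M :> 'M[R]_3.
  apply/matrixP => i j; rewrite !mxE -!val_eqE /=.
  case: i => -[|[|[|//]]] ? /=; case: j => -[|[|[|//]]] ? /=;
  by rewrite ?addr0 ?add0r.
rewrite !EE PxE PyE !add_block_mx !add0r !addr0 D3 add_block_mx !add0r !addr0.
rewrite !det_ublock det1 mulr1 !detZ !det_hemisphere_gram//.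
rewrite !(exprAC _ 2); move: (_ ^+ (l + 1)) (_ ^+ l) => a b.
by rewrite !exprMn !exprVn; ring.
Qed.
End polar.

Section polar_inverse.
Context {R : realType} (l : nat).
Implicit Types (w : 'rV[R]_(l + 1 + l + 3)) (v : 'rV[R]_((l + 1 + 1) + (l + 1 + 1))).

Definition polar_range v : Prop := upper (lsubmx v) /\ upper (lsubmx (rsubmx v)).

Definition unit_dir n (u : 'rV[R]_n) := (enorm u)^-1 *: u.

Definition polar_inv v : 'rV[R]_(l + 1 + l + 3) :=
  row_mx (row_mx (lsubmx (unit_dir (lsubmx v))) (lsubmx (unit_dir (lsubmx (rsubmx v)))))
    (\row_(i < 3) [:: enorm (lsubmx v); last_coord (rsubmx v); enorm (lsubmx (rsubmx v))]`_i).

Lemma unit_dirZ n (u : 'rV[R]_n) c : 0 < c -> enorm u = 1 ->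
  enorm (c *: u) = c /\ unit_dir (c *: u) = u.
Proof.
move=> c0 u1; have e : enorm (c *: u) = c by rewrite enormZ u1 mulr1 gtr0_norm.
by split => //; rewrite /unit_dir e scalerA mulVf ?scale1r// gt_eqF.
Qed.

Lemma unit_dir_hemisphere d (u : 'rV[R]_(d + 1)) : upper u ->
  [/\ unit_ball (lsubmx (unit_dir u)), hemisphere 1 (lsubmx (unit_dir u)) = unit_dir u &
      enorm u *: unit_dir u = u].
Proof.
move=> u0; have e0 : 0 < enorm u by rewrite enorm_gt0 upper_neq0.
have e1 : enorm (unit_dir u) = 1 by rewrite /unit_dir enormZ gtr0_norm ?invr_gt0// mulVf ?gt_eqF.
have d0 : 0 < unit_dir u ord0 (rshift d ord0) by rewrite mxE mulr_gt0// invr_gt0.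
have [ub hE] := hemisphere_surj e1 d0.
by split => //; rewrite /unit_dir scalerA mulfV ?scale1r// gt_eqF.
Qed.

Lemma polarE w : polar w = row_mx (polar_t 0 w *: hemisphere 1 (polar_x w))
    (row_mx (polar_t 2 w *: hemisphere 1 (polar_y w)) (const_mx (polar_t 1 w))).
Proof. by rewrite /polar !mul_const_mx11. Qed.

Lemma polar_invK w : polar_domain w -> polar_inv (polar w) = w.
Proof.
move=> [Bx By t0 t2].
have one_sqr : (1 : R) ^+ 2 = 1 by exact: expr1n.
have [e1 u1] := unit_dirZ t0 (enorm_hemisphere one_sqr Bx).
have [e2 u2] := unit_dirZ t2 (enorm_hemisphere one_sqr By).
rewrite /polar_inv polarE row_mxKl row_mxKr row_mxKl e1 e2 u1 u2 !row_mxKl.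
rewrite -[RHS]hsubmxK -[lsubmx w in RHS]hsubmxK; congr row_mx.
apply/rowP => i; rewrite mxE /last_coord row_mxEr.
rewrite [const_mx _ _ _]mxE /polar_t.
by case: i => -[|[|[|//]]] ? /=; congr (rsubmx w _ _); exact: val_inj.
Qed.

Lemma polar_inj w w' : polar_domain w -> polar_domain w' -> polar w = polar w' -> w = w'.
Proof. by move=> Dw Dw' e; rewrite -(polar_invK Dw) e polar_invK. Qed.

Lemma polar_in_range w : polar_domain w -> polar_range (polar w).
Proof.
move=> [Bx By t0 t2]; rewrite /polar_range polarE row_mxKl row_mxKr row_mxKl.
by split; rewrite /upper /= /last_coord mxE hemisphere_last mul1r mulr_gt0// height_gt0.
Qed.

Lemma polar_surj v : polar_range v -> polar_domain (polar_inv v) /\ polar (polar_inv v) = v.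
Proof.
move=> [v1 v2]; have [b1 h1 e1] := unit_dir_hemisphere v1.
have [b2 h2 e2] := unit_dir_hemisphere v2.
have xE : polar_x (polar_inv v) = lsubmx (unit_dir (lsubmx v)).
  by rewrite /polar_x /polar_inv !row_mxKl.
have yE : polar_y (polar_inv v) = lsubmx (unit_dir (lsubmx (rsubmx v))).
  by rewrite /polar_y /polar_inv row_mxKl row_mxKr.
have t0 : polar_t 0 (polar_inv v) = enorm (lsubmx v) by rewrite /polar_t row_mxKr mxE.
have t1 : polar_t 1 (polar_inv v) = last_coord (rsubmx v) by rewrite /polar_t row_mxKr mxE.
have t2 : polar_t 2 (polar_inv v) = enorm (lsubmx (rsubmx v)) by rewrite /polar_t row_mxKr mxE.
split; first by split; rewrite ?xE ?yE ?t0 ?t2// enorm_gt0 upper_neq0.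
rewrite polarE xE yE t0 t1 t2 h1 h2 e1 e2 -[RHS]hsubmxK; congr row_mx.
rewrite -[RHS]hsubmxK; congr row_mx.
by apply/rowP => i; rewrite mxE [RHS]mxE (ord1 i).
Qed.

Section bipolar.
Variables (A : 'M[R]_(l + 1 + 1)) (B : 'M[R]_(l + 1)).
Hypotheses (AA : A *m A^T = 1%:M) (BB : B *m B^T = 1%:M).

(** B turns the hemisphere of omega' within the hyperplane orthogonal to the last axis, hence leaves
    p and the three lengths unchanged. *)
Let N : 'M[R]_(l + 1 + 1) := block_mx B 0 0 1%:M.

Let NN : N *m N^T = 1%:M.
Proof.
rewrite /N tr_block_mx !trmx0 trmx1 mulmx_block !mulmx0 !mul0mx !addr0 add0r BB mulmx1.
by rewrite -scalar_mx_block.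
Qed.

Definition bipolar w := straighten N A (polar w).

Let upper_polar w : polar_domain w -> upper_domain (polar w).
Proof. by move=> /polar_in_range[]. Qed.

Lemma C1_on_bipolar : C1_on (@polar_domain R l) bipolar.
Proof. exact: (C1_on_comp_in (C1_on_straighten N A) (@C1_on_polar R l) upper_polar). Qed.

Lemma bipolar_jacobian_det (e : (l + 1 + l + 3 = (l + 1 + 1) + (l + 1 + 1))%N) w : polar_domain w ->
  `|\det (castmx (e, erefl _) (jacobian bipolar w))| =
  polar_t 0 w ^+ (l + 1) * polar_t 2 w ^+ l / height (polar_x w) / height (polar_y w).
Proof.
move=> Dw; have [Bx By t0 t2] := Dw.
have dS : differentiable (straighten N A) (polar w).
  by have [] := (C1_on_straighten N A).2 _ (upper_polar Dw).
have dP : differentiable (@polar R l) w by have [] := (@C1_on_polar R l).2 _ Dw.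
have -> : jacobian bipolar w = jacobian (@polar R l) w *m jacobian (straighten N A) (polar w).
  exact: (jacobian_comp dP dS).
rewrite castmx_mulmx det_mulmx normrM (straighten_jacobian_det NN AA (upper_polar Dw)) mulr1.
have := det_castmx_sqr e (jacobian (@polar R l) w); rewrite polar_gram//.
move: (\det _) => D /(congr1 Num.sqrt); rewrite !sqrtr_sqr => ->; apply: ger0_norm.
by rewrite !mulr_ge0 ?invr_ge0 ?exprn_ge0 ?sqrtr_ge0// ltW.
Qed.

Lemma bipolar_inj : {in @polar_domain R l &, injective bipolar}.
Proof.
move=> w w'; rewrite !in_setE => Dw Dw' e; apply: (polar_inj Dw Dw').
exact: (straighten_inj NN AA (upper_polar Dw) (upper_polar Dw') e).
Qed.

(** The vector zeta recovered from v by undoing A and the mirror, but not B: it does not depend on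
    the second half of the chart index. *)
Definition straightened v : 'rV[R]_(l + 1 + 1) := rsubmx v *m A^T *m mirror (lsubmx v *m A^T).

Lemma bipolar_image v : (bipolar @` @polar_domain R l) v <->
  upper (lsubmx v *m A^T) /\ upper (lsubmx (straightened v) *m B^T).
Proof.
have NT (z : 'rV[R]_(l + 1 + 1)) : z *m N^T = row_mx (lsubmx z *m B^T) (rsubmx z).
  by rewrite -{1}(hsubmxK z) /N tr_block_mx !trmx0 trmx1 mul_row_block !mulmx0 addr0 add0r mulmx1.
split => [[w Dw <-]|[v1 v2]].
  have [r1 r2] := polar_in_range Dw.
  rewrite /bipolar /straightened /straighten row_mxKl row_mxKr -!mulmxA AA mulmx1.
  rewrite !mulmxA -(mulmxA _ A) AA mulmx1 -(mulmxA _ (mirror _)) (mirrorK r1) mulmx1.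
  split => //.
  rewrite -{1}(hsubmxK (rsubmx (polar w))) /N mul_row_block !mulmx0 addr0 row_mxKl.
  by rewrite -mulmxA BB mulmx1.
pose z := row_mx (lsubmx v *m A^T) (straightened v *m N^T).
have [|Dw wz] := @polar_surj z.
  by split; rewrite /z ?row_mxKl ?row_mxKr ?NT ?row_mxKl.
exists (polar_inv z) => //; rewrite /bipolar wz /straighten /z row_mxKl row_mxKr.
rewrite -!mulmxA (orthogonal_tr AA) mulmx1 (mulmxA N^T) (orthogonal_tr NN) mul1mx.
rewrite /straightened !mulmxA -(mulmxA _ (mirror _) (mirror _)) (mirrorK v1) mulmx1 -mulmxA.
by rewrite (orthogonal_tr AA) mulmx1 hsubmxK.
Qed.

Lemma length_map_bipolar w : polar_domain w ->
  length_map (bipolar w) = \row_(i < 3) [:: polar_t 0 w;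
     Num.sqrt (polar_t 2 w ^+ 2 + polar_t 1 w ^+ 2);
     Num.sqrt (polar_t 2 w ^+ 2 + (polar_t 1 w - polar_t 0 w) ^+ 2)]`_i.
Proof.
move=> Dw; rewrite (length_map_straighten NN AA (upper_polar Dw)).
have [Bx By t0 t2] := Dw.
have one_sqr : (1 : R) ^+ 2 = 1 by exact: expr1n.
have [e1 _] := unit_dirZ t0 (enorm_hemisphere one_sqr Bx).
have [e2 _] := unit_dirZ t2 (enorm_hemisphere one_sqr By).
have en m (x : 'rV[R]_m) a : enorm x ^+ 2 = a -> enorm x = Num.sqrt a.
  by move=> <-; rewrite sqrtr_sqr ger0_norm// enorm_ge0.
rewrite polarE row_mxKl row_mxKr e1.
apply/rowP => i; rewrite !mxE; congr nth; congr [:: _; _; _].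
  by apply: en; rewrite enorm_row_mx enorm11 mxE e2 real_normK ?num_real.
have -> : polar_t 0 w *: last_axis (l + 1) =
    row_mx 0 (const_mx (polar_t 0 w)) :> 'rV[R]_(l + 1 + 1).
  apply/rowP => j; rewrite mxE /last_axis; have [j' ->|j' ->] := split_ordP j.
    by rewrite !row_mxEl !mxE mulr0.
  by rewrite !row_mxEr !mxE (ord1 j') mulr1.
apply: en; rewrite /N mul_row_block !mulmx0 addr0 add0r mulmx1.
rewrite opp_row_mx add_row_mx subr0 enorm_row_mx enorm_orthogonal// e2 enorm11.
by rewrite real_normK ?num_real// !mxE.
Qed.

End bipolar.
End polar_inverse.

Section small_det.
Context {R : realType}.

Lemma det_mx2 (M : 'M[R]_2) : \det M = M 0 0 * M 1 1 - M 0 1 * M 1 0.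
Proof.
rewrite (expand_det_row _ ord0) !big_ord_recl big_ord0 addr0 /cofactor !det_mx11.
rewrite !mxE /= expr0 expr1 mul1r mulN1r mulrN.
by congr (M _ _ * M _ _ - M _ _ * M _ _); exact: val_inj.
Qed.

Lemma det_mx3_col0 (M : 'M[R]_3) : M 1 0 = 0 -> M 2 0 = 0 ->
  \det M = M 0 0 * (M 1 1 * M 2 2 - M 1 2 * M 2 1).
Proof.
move=> M1 M2; rewrite (expand_det_col _ ord0) !big_ord_recl big_ord0.
have e1 : lift ord0 ord0 = 1 :> 'I_3 by exact: val_inj.
have e2 : lift ord0 (lift ord0 ord0) = 2 :> 'I_3 by exact: val_inj.
rewrite e1 e2 M1 M2 !mul0r !addr0 /cofactor det_mx2 expr0 mul1r !mxE.
have -> : lift ord0 0 = 1 :> 'I_3 by exact: val_inj.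
by have -> : lift ord0 1 = 2 :> 'I_3 by exact: val_inj.
Qed.

End small_det.

(** * The bipolar charts as Leray coordinates and their density *)

Section leray_bipolar.
Context {R : realType} (l : nat).
Variables (A : 'M[R]_(l + 1 + 1)) (B : 'M[R]_(l + 1)).
Hypotheses (AA : A *m A^T = 1%:M) (BB : B *m B^T = 1%:M).
Variables (r p q : R).
Hypotheses (r0 : 0 < r) (q0 : 0 < q).

(* The triangle has a side of length r and height q over it; p is minus the
   component of the second side along the first one. *)
Definition tri_lengths (r p q : R) : 'rV[R]_3 :=
  \row_(i < 3) [:: r; Num.sqrt (q ^+ 2 + p ^+ 2); Num.sqrt (q ^+ 2 + (p - r) ^+ 2)]`_i.

Definition tri_coords (r p q : R) : 'rV[R]_3 := \row_(i < 3) [:: r; p; q]`_i.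

Lemma tri_lengths_inj (r' p' q' : R) : 0 < q' ->
  tri_lengths r' p' q' = tri_lengths r p q -> [/\ r' = r, p' = p & q' = q].
Proof.
move=> q'0 e; have e0 := congr1 (fun M : 'rV[R]_3 => M ord0 0) e.
have e1 := congr1 (fun M : 'rV[R]_3 => M ord0 1 ^+ 2) e.
have e2 := congr1 (fun M : 'rV[R]_3 => M ord0 2 ^+ 2) e.
move: e0 e1 e2; rewrite !mxE /= !sqr_sqrtr ?addr_ge0 ?sqr_ge0// => -> e1 e2.
(* The squares of the last two lengths differ by 2 p r - r^2, which determines p since r is
   nonzero. *)
have pp : p' = p.
  have rn : r != 0 by rewrite gt_eqF.
  apply: (mulfI rn); lra.
split; [exact: erefl|exact: pp|].
move: e1; rewrite pp => /addIr /eqP; rewrite eqf_sqr => /orP[/eqP //|/eqP qq].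
by move: q'0; rewrite qq oppr_gt0 => /lt_trans /(_ q0); rewrite ltxx.
Qed.

Definition ball_pair : set 'rV[R]_(l + 1 + l) :=
  [set z | unit_ball (lsubmx z) /\ unit_ball (rsubmx z)].

Lemma ball_pair_open : open ball_pair.
Proof.
have -> : ball_pair = (lsubmx @^-1` @unit_ball R (l + 1)) `&` (rsubmx @^-1` @unit_ball R l).
  by [].
apply: openI.
- exact: (open_linear_preimage (@lsubmx_linear R _ _) (@unit_ball_open R _)).
- exact: (open_linear_preimage (@rsubmx_linear R _ _) (@unit_ball_open R _)).
Qed.

Lemma polar_coords_row (z : 'rV[R]_(l + 1 + l)) (t : 'rV[R]_3) :
  [/\ polar_x (row_mx z t) = lsubmx z, polar_y (row_mx z t) = rsubmx z &
      forall i, polar_t i (row_mx z t) = t ord0 i].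
Proof. by rewrite /polar_x /polar_y /polar_t row_mxKl row_mxKr. Qed.

Lemma length_map_bipolarE w : polar_domain w ->
  length_map (bipolar A B w) = tri_lengths (polar_t 0 w) (polar_t 1 w) (polar_t 2 w).
Proof. by move=> Dw; rewrite (length_map_bipolar AA BB Dw). Qed.

Lemma bipolar_fiber :
  @polar_domain R l `&` [set w | length_map (bipolar A B w) = tri_lengths r p q] =
  [set row_mx z (tri_coords r p q) | z in ball_pair].
Proof.
apply/seteqP; split => w.
  move=> [Dw]; rewrite /= length_map_bipolarE//.
  have [Bx By t0 t2] := Dw.
  move=> /(tri_lengths_inj t2)[e0 e1 e2].
  exists (lsubmx w); first by split.
  rewrite -[RHS]hsubmxK; congr row_mx; apply/rowP => i; rewrite [LHS]mxE.
  case: i => -[|[|[|//]]] ? /=; rewrite -?e0 -?e1 -?e2 /polar_t;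
    by congr (rsubmx w _ _); exact: val_inj.
move=> [z [Bx By] <-].
have [xE yE tE] := polar_coords_row z (tri_coords r p q).
have Dz : polar_domain (row_mx z (tri_coords r p q)).
  by split; rewrite ?xE ?yE ?tE ?mxE.
by split => //; rewrite /= length_map_bipolarE// !tE !mxE.
Qed.

Definition lengths_map (t : 'rV[R]_3) : 'rV[R]_3 := tri_lengths (t ord0 0) (t ord0 1) (t ord0 2).

Lemma has_jacobian_hypot m (f g : 'rV[R]_m -> R) (x : 'rV[R]_m) (M N : 'cV[R]_m) :
  has_jacobian (fun v => const_mx (f v) : 'rV[R]_1) x M ->
  has_jacobian (fun v => const_mx (g v) : 'rV[R]_1) x N ->
  0 < f x ^+ 2 + g x ^+ 2 ->
  has_jacobian (fun v => const_mx (Num.sqrt (f v ^+ 2 + g v ^+ 2)) : 'rV[R]_1) x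
    ((Num.sqrt (f x ^+ 2 + g x ^+ 2))^-1 *: (f x *: M + g x *: N)).
Proof.
move=> fM gN fg0.
have en v : enorm (row_mx (const_mx (f v) : 'rV[R]_1) (const_mx (g v) : 'rV[R]_1)) =
    Num.sqrt (f v ^+ 2 + g v ^+ 2).
  apply: enorm_uniq; first exact: sqrtr_ge0.
  rewrite -enorm_sqr enorm_row_mx !enorm11 !mxE !real_normK ?num_real// sqr_sqrtr//.
  by rewrite addr_ge0// sqr_ge0.
have v0 : row_mx (const_mx (f x) : 'rV[R]_1) (const_mx (g x) : 'rV[R]_1) != 0.
  by rewrite -enorm_gt0 en sqrtr_gt0.
have := has_jacobian_comp (has_jacobian_row_mx fM gN) (has_jacobian_enorm v0).
rewrite en -scalemxAr tr_row_mx mul_row_col !const_mx11 !tr_scalar_mx !mul_mx_scalar.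
apply: has_jacobian_near; apply/nbhs_normP; exists 1 => // y _.
by rewrite /= en const_mx11.
Qed.

(** The first length is the coordinate r itself. What remains is the minor of (p, q) against the
    other lengths s1 and s2, namely (p q - (p - r) q) / (s1 s2) = r q / (s1 s2). *)
Lemma lengths_map_jacobian (t : 'rV[R]_3) : 0 < t ord0 2 ->
  exists2 J, has_jacobian lengths_map t J &
    \det J = t ord0 2 * t ord0 0 / lengths_map t ord0 1 / lengths_map t ord0 2.
Proof.
move=> t2.
pose E (i : 'I_3) : 'cV[R]_3 := delta_mx i ord0.
have hE i : has_jacobian (fun t : 'rV[R]_3 => const_mx (t ord0 i) : 'rV[R]_1) t (E i).
  by apply: has_jacobian_lin => v; rewrite mulmx_delta_col.
have hE10 :
    has_jacobian (fun t : 'rV[R]_3 => const_mx (t ord0 1 - t ord0 0) : 'rV[R]_1) t (E 1 - E 0).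
  apply: has_jacobian_lin => v; rewrite mulmxBr !mulmx_delta_col.
  by apply/rowP => i; rewrite !mxE.
have p1 : 0 < t ord0 2 ^+ 2 + t ord0 1 ^+ 2 by rewrite ltr_pwDl ?sqr_ge0// exprn_gt0.
have p2 : 0 < t ord0 2 ^+ 2 + (t ord0 1 - t ord0 0) ^+ 2 by rewrite ltr_pwDl ?sqr_ge0// exprn_gt0.
pose D1 := (Num.sqrt (t ord0 2 ^+ 2 + t ord0 1 ^+ 2))^-1 *: (t ord0 2 *: E 2 + t ord0 1 *: E 1).
pose D2 := (Num.sqrt (t ord0 2 ^+ 2 + (t ord0 1 - t ord0 0) ^+ 2))^-1 *:
  (t ord0 2 *: E 2 + (t ord0 1 - t ord0 0) *: (E 1 - E 0)).
have h1 : has_jacobian (fun v : 'rV[R]_3 => const_mx (lengths_map v ord0 1) : 'rV[R]_1) t D1.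
  have := has_jacobian_hypot (hE 2) (hE 1) p1.
  have -> : (fun v : 'rV[R]_3 => const_mx (lengths_map v ord0 1) : 'rV[R]_1) =
      (fun v => const_mx (Num.sqrt (v ord0 2 ^+ 2 + v ord0 1 ^+ 2))).
    by apply/funext => v; rewrite [lengths_map _ _ _]mxE.
  by [].
have h2 : has_jacobian (fun v : 'rV[R]_3 => const_mx (lengths_map v ord0 2) : 'rV[R]_1) t D2.
  have := has_jacobian_hypot (hE 2) hE10 p2.
  have -> : (fun v : 'rV[R]_3 => const_mx (lengths_map v ord0 2) : 'rV[R]_1) =
      (fun v => const_mx (Num.sqrt (v ord0 2 ^+ 2 + (v ord0 1 - v ord0 0) ^+ 2))).
    by apply/funext => v; rewrite [lengths_map _ _ _]mxE.
  by [].
have h0 : has_jacobian (fun v : 'rV[R]_3 => const_mx (lengths_map v ord0 0) : 'rV[R]_1) t (E 0).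
  have -> : (fun v : 'rV[R]_3 => const_mx (lengths_map v ord0 0) : 'rV[R]_1) =
      (fun v => const_mx (v ord0 0)).
    by apply/funext => v; rewrite [lengths_map _ _ _]mxE.
  exact: hE.
pose J : 'M[R]_3 := \matrix_(i, j) [:: E 0 i ord0; D1 i ord0; D2 i ord0]`_j.
exists J.
  apply: has_jacobian_coord => j.
  have -> : col j J = [:: E 0; D1; D2]`_j.
    apply/colP => i; rewrite !mxE; case: j => -[|[|[|//]]] ? /=; rewrite ?mxE//.
  have : [\/ j = 0, j = 1 | j = 2].
    by case: j => -[|[|[|//]]] ?; [apply: Or31|apply: Or32|apply: Or33]; exact/val_inj.
  by move=> [->|->|->]; [exact: h0|exact: h1|exact: h2].
rewrite det_mx3_col0 ?mxE//=.
by field; rewrite !gt_eqF// sqrtr_gt0.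
Qed.

Let dims : (l + 1 + l + 3 = (l + 1 + 1) + (l + 1 + 1))%N. Proof. by lia. Qed.

Lemma height_pos m (x : 'rV[R]_m) : unit_ball x -> height x != 0.
Proof. by move=> /height_gt0 h; rewrite gt_eqF. Qed.

Lemma bipolar_coordinates : local_coordinates (@polar_domain R l) (bipolar A B).
Proof.
split; [exact: C1_on_bipolar|exact: bipolar_inj|] => w Dw.
have D0 : \det (jacobian (bipolar A B) w *m (jacobian (bipolar A B) w)^T) != 0.
  rewrite -(det_castmx_sqr dims) expf_neq0// -normr_eq0 bipolar_jacobian_det//.
  have [Bx By t0 t2] := Dw.
  by rewrite !mulf_neq0 ?expf_neq0 ?invr_eq0 ?height_pos// gt_eqF.
move: D0; rewrite -unitfE -unitmxE; set J := jacobian _ _ => Ju.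
apply/row_freeP; exists (J^T *m invmx (J *m J^T)); rewrite mulmxA; exact: mulmxV.
Qed.

Lemma bipolar_length_jacobian w : polar_domain w ->
  `|\det (dsubmx (jacobian (@length_map R (l + 1 + 1) \o bipolar A B) w))| =
  polar_t 2 w * polar_t 0 w / lengths_map (rsubmx w) ord0 1 / lengths_map (rsubmx w) ord0 2.
Proof.
move=> Dw; have [Bx By t0 t2] := Dw.
have [J hJ dJ] := @lengths_map_jacobian (rsubmx w) t2.
have h1 := has_jacobian_comp (has_jacobian_lin w (@rsubmx_linear R _ 3)) hJ.
have h2 : has_jacobian (@length_map R (l + 1 + 1) \o bipolar A B) w (col_mx 0 1%:M *m J).
  apply: has_jacobian_near h1; apply: filterS (open_nbhs_nbhs (conj (@polar_domain_open R l) Dw)).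
  by move=> x Dx; rewrite /= length_map_bipolarE.
have [_ ->] := (has_jacobianP _ _ _).1 h2.
rewrite mul_col_mx mul0mx mul1mx col_mxKd dJ; apply: ger0_norm.
have s1 : 0 <= lengths_map (rsubmx w) ord0 1 by rewrite mxE; exact: sqrtr_ge0.
have s2 : 0 <= lengths_map (rsubmx w) ord0 2 by rewrite mxE; exact: sqrtr_ge0.
by apply: divr_ge0 s2; apply: divr_ge0 s1; exact: mulr_ge0 (ltW t2) (ltW t0).
Qed.

Lemma ball_pair_domain z : ball_pair z -> polar_domain (row_mx z (tri_coords r p q)).
Proof.
move=> [Bx By]; have [xE yE tE] := polar_coords_row z (tri_coords r p q).
by split; rewrite ?xE ?yE ?tE ?mxE.
Qed.

Lemma tri_lengths_gt0 : 0 < tri_lengths r p q ord0 1 /\ 0 < tri_lengths r p q ord0 2.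
Proof. by rewrite !mxE /= !sqrtr_gt0 !ltr_pwDl ?sqr_ge0// exprn_gt0. Qed.

Lemma lengths_map_coords (z : 'rV[R]_(l + 1 + l)) :
  lengths_map (rsubmx (row_mx z (tri_coords r p q))) = tri_lengths r p q.
Proof. by rewrite row_mxKr /lengths_map !mxE. Qed.

Lemma bipolar_chart :
  leray_coordinates (@length_map R (l + 1 + 1)) (tri_lengths r p q) (@polar_domain R l)
    (bipolar A B) ball_pair (fun=> tri_coords r p q).
Proof.
split; [exact: bipolar_coordinates|exact: ball_pair_open|exact: bipolar_fiber|] => z Uz.
have Dz := ball_pair_domain Uz; have [Bx By t0 t2] := Dz.
have [l1 l2] := tri_lengths_gt0.
rewrite unitmxE unitfE -normr_eq0 bipolar_length_jacobian// lengths_map_coords.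
by rewrite !mulf_neq0 ?invr_eq0// gt_eqF.
Qed.

(** Regrouping of r^(l+1) q^l s1 s2 / (r q). The power of r q is an integer power because its
    exponent l - 1 = n - 3 is -1 when n = 2. *)
Lemma bipolar_density (e : (l + 1 + l + 3 = (l + 1 + 1) + (l + 1 + 1))%N) z : ball_pair z ->
  leray_density e (@length_map R (l + 1 + 1)) (bipolar A B) (row_mx z (tri_coords r p q)) =
  (r * tri_lengths r p q ord0 1 * tri_lengths r p q ord0 2 * (r * q) ^ (l%:Z - 1)) *
  ((height (lsubmx z))^-1 * (height (rsubmx z))^-1).
Proof.
move=> Uz; have Dz := ball_pair_domain Uz; have [Bx By t0 t2] := Dz.
have [l1 l2] := tri_lengths_gt0.
rewrite /leray_density (bipolar_jacobian_det AA BB)// bipolar_length_jacobian// lengths_map_coords.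
have [-> -> tE] := polar_coords_row z (tri_coords r p q); rewrite !tE !mxE /=.
have rq0 : r * q != 0 by rewrite mulf_neq0// gt_eqF.
rewrite expfzDr// -[(r * q) ^ l%:Z]exprnP exprMn exprD expr1.
have -> : (r * q) ^ (- 1) = (r * q)^-1 by [].
set s1 := Num.sqrt _; set s2 := Num.sqrt _.
have s10 : s1 != 0 by move: l1; rewrite mxE /= => l1; rewrite gt_eqF.
have s20 : s2 != 0 by move: l2; rewrite mxE /= => l2; rewrite gt_eqF.
move: (height_pos Bx) (height_pos By); rewrite /polar_x /polar_y row_mxKl => hx hy.
move: (r ^+ l) (q ^+ l) => a b.
field; rewrite s10 s20 hx hy !gt_eqF//.
Qed.

End leray_bipolar.

(** * Leray measure from an atlas *)

Section leray_transport.
Context {R : realType}.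

(** Transport of the results for ambient dimension k + d along the equality with m. The rank is full
    because a d x d block of the product of the Jacobians of psi and F is invertible. *)
Lemma leray_chart_facts (k d m : nat) (e : (k + d = m)%N) (F : 'rV[R]_m -> 'rV[R]_d) y V W psi U s :
  C1_on V F -> F @^-1` [set y] `<=` V -> @leray_coordinates R m d k F y W psi U s ->
  [/\ forall z, U z -> {for z, continuous (fun z => psi (row_mx z (s z)))},
      forall z, U z -> {for z, continuous (fun z => leray_density e F psi (row_mx z (s z)))},
      open (psi @` W) &
      forall z, U z -> [/\ W (row_mx z (s z)), F (psi (row_mx z (s z))) = y &
        \rank (jacobian F (psi (row_mx z (s z)))) = d]].
Proof.
case: m / e F V psi => F V psi FC FV c; split.
- by move=> z Uz; exact: (chart_point_continuous FC FV c Uz).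
- by move=> z Uz; exact: (leray_density_continuous FC FV c Uz).
- exact: (chart_image_open c).
move=> z Uz; have [Wz Fz] := chart_graph c Uz; split => //.
apply/eqP; rewrite eqn_leq rank_leq_col /=.
have Tu := chart_transversal FC FV c Uz.
set J := jacobian F _ in Tu *; set K := jacobian psi _ in Tu.
have := mxrankS (submxMl K J); apply: leq_trans.
have dM (M : 'M[R]_(k + d, d)) : (dsubmx M <= M)%MS.
  by rewrite -[X in (_ <= X)%MS]vsubmxK -addsmxE addsmxSr.
by rewrite -[X in (X <= _)%N](mxrank_unit Tu); apply: mxrankS; exact: dM.
Qed.

Lemma leray_chart_agree (k d m : nat) (e : (k + d = m)%N) (F : 'rV[R]_m -> 'rV[R]_d) y V
    W1 psi1 U1 s1 W2 psi2 U2 s2 A :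
  C1_on V F -> F @^-1` [set y] `<=` V ->
  @leray_coordinates R m d k F y W1 psi1 U1 s1 -> @leray_coordinates R m d k F y W2 psi2 U2 s2 ->
  measurable A -> A `<=` psi1 @` W1 -> A `<=` psi2 @` W2 ->
  (\int[lebesgue_rV k]_(z in U1 `&` [set z | A (psi1 (row_mx z (s1 z)))])
     (leray_density e F psi1 (row_mx z (s1 z)))%:E =
   \int[lebesgue_rV k]_(z in U2 `&` [set z | A (psi2 (row_mx z (s2 z)))])
     (leray_density e F psi2 (row_mx z (s2 z)))%:E)%E.
Proof.
case: m / e F V psi1 psi2 A => F V psi1 psi2 A FC FV c1 c2 mA A1 A2.
exact: (chart_measure_agree FC FV c1 c2 mA A1 A2).
Qed.

(** Nothing is known about F outside V, but the fiber lies in V and is V minus an open set. *)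
Lemma C1_fiber_measurable (m d : nat) (F : 'rV[R]_m -> 'rV[R]_d) y V :
  C1_on V F -> F @^-1` [set y] `<=` V -> measurable (F @^-1` [set y]).
Proof.
move=> FC FV.
have oO : open (V `&` F @^-1` (~` [set y])).
  apply: open_preimage_in; first exact: FC.1.
    by move=> x Vx; exact: (C1_on_continuous FC Vx).
  rewrite openE => v vy; have : v - y != 0 by rewrite subr_eq0; apply/eqP.
  rewrite -normr_gt0 => vy0; apply/nbhs_normP; exists `|v - y| => // u uv /= uy.
  by move: uv; rewrite uy distrC ltxx.
have -> : F @^-1` [set y] = V `\` (V `&` F @^-1` (~` [set y])).
  apply/seteqP; split => x; first by move=> Fx; split; [exact: FV|move=> [_ h]; exact: h].
  by move=> [Vx h]; apply: contrapT => Fx; apply: h.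
by apply: measurableD; apply: open_measurable_rV => //; exact: FC.1.
Qed.

End leray_transport.

Lemma null_bigsetU d (T : measurableType d) (R : realType) (nu : {measure set T -> \bar R})
    (J : Type) (s : seq J) (N : J -> set T) :
  (forall j, measurable (N j)) -> (forall j, nu (N j) = 0%E) ->
  nu (\big[setU/set0]_(j <- s) N j) = 0%E.
Proof.
move=> mN N0; elim: s => [|j s IH]; first by rewrite big_nil measure0.
by rewrite big_cons measureU0//; exact: bigsetU_measurable.
Qed.

Section atlas.
Context {R : realType} (k d m : nat) (e : (k + d = m)%N).
Variables (F : 'rV[R]_m -> 'rV[R]_d) (y : 'rV[R]_d) (V : set 'rV[R]_m).
Hypotheses (FC : C1_on V F) (FV : F @^-1` [set y] `<=` V).

Record lchart := LChart {
  lc_W : set 'rV[R]_(k + d);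
  lc_psi : 'rV[R]_(k + d) -> 'rV[R]_m;
  lc_U : set 'rV[R]_k;
  lc_s : 'rV[R]_k -> 'rV[R]_d;
  lc_coords : leray_coordinates F y lc_W lc_psi lc_U lc_s }.

Definition lc_point c z := lc_psi c (row_mx z (lc_s c z)).
Definition lc_density c z := leray_density e F (lc_psi c) (row_mx z (lc_s c z)).
Definition lc_image c : set 'rV[R]_m := lc_psi c @` lc_W c.

Let lc_mU c : measurable (lc_U c).
Proof. by apply: open_measurable_rV; have [_ oU _ _] := lc_coords c. Qed.

Let lc_mP c : measurable_fun (lc_U c) (lc_point c).
Proof.
apply: continuous_measurable_rV_rV; first by have [_ oU _ _] := lc_coords c.
by have [h _ _ _] := leray_chart_facts e FC FV (lc_coords c).
Qed.

Let lc_mf c : measurable_fun (lc_U c) (lc_density c : _ -> measurableTypeR R).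
Proof.
apply: continuous_measurable_rV; first by have [_ oU _ _] := lc_coords c.
by have [_ h _ _] := leray_chart_facts e FC FV (lc_coords c).
Qed.

Let lc_f0 c z : lc_U c z -> 0 <= lc_density c z.
Proof. by move=> _; rewrite mulr_ge0// invr_ge0. Qed.

Definition lc_measure c : {measure set 'rV[R]_m -> \bar R} :=
  densm (lebesgue_rV k) (@lc_mU c) (@lc_mP c) (@lc_mf c) (@lc_f0 c).

Lemma lc_measureE c A : lc_measure c A =
  (\int[lebesgue_rV k]_(z in lc_U c `&` [set z | A (lc_point c z)]) (lc_density c z)%:E)%E.
Proof. by []. Qed.

Lemma lc_measure_null c A (Z : set 'rV[R]_k) : measurable A -> measurable Z ->
  lebesgue_rV k Z = 0%E -> (forall z, lc_U c z -> A (lc_point c z) -> Z z) ->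
  lc_measure c A = 0%E.
Proof.
move=> mA mZ Z0 AZ; rewrite lc_measureE.
have mD : measurable (lc_U c `&` [set z | A (lc_point c z)]) by exact: (@lc_mP c (@lc_mU c) _ mA).
apply: null_set_integral => //.
  by apply/measurable_EFinP; apply: (measurable_funS (@lc_mU c) _ (@lc_mf c)) => z [].
by apply: (subset_measure0 mD mZ _ Z0) => z [Uz Az]; exact: AZ.
Qed.

Lemma lc_image_measurable c : measurable (lc_image c).
Proof.
by apply: open_measurable_rV; have [_ _ h _] := leray_chart_facts e FC FV (lc_coords c).
Qed.

Lemma lc_point_image c z : lc_U c z -> lc_image c (lc_point c z) /\ F (lc_point c z) = y.
Proof.
have [_ _ _ h] := leray_chart_facts e FC FV (lc_coords c).
by move=> /h[Wz Fz _]; split => //; exists (row_mx z (lc_s c z)).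
Qed.

Lemma lc_measure_ext c A B : (forall z, lc_U c z -> A (lc_point c z) <-> B (lc_point c z)) ->
  lc_measure c A = lc_measure c B.
Proof.
move=> AB; rewrite !lc_measureE; congr (integral _ _ _).
by apply/seteqP; split => z [Uz /= Az]; split => //=; apply/(AB _ Uz).
Qed.

Lemma lc_measure_agree c c' A : measurable A -> A `<=` lc_image c -> A `<=` lc_image c' ->
  lc_measure c A = lc_measure c' A.
Proof. exact: (leray_chart_agree e FC FV (lc_coords c) (lc_coords c')). Qed.

Lemma lc_measure_fiberC c : lc_measure c (~` (F @^-1` [set y])) = 0%E.
Proof.
rewrite (lc_measure_ext (B := set0)) ?measure0// => z /lc_point_image[_ Fz].
by split => // h; apply: h.
Qed.

Variables (n : nat) (base : nat -> lchart).
Hypothesis base_disj : forall i j, (i < n)%N -> (j < n)%N -> i != j ->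
  lc_image (base i) `&` lc_image (base j) = set0.
Variables (J : finType) (aux : J -> lchart) (N : J -> set 'rV[R]_m).
Hypotheses (mN : forall j, measurable (N j)) (Nsub : forall j, N j `<=` lc_image (aux j))
  (N0 : forall j, lc_measure (aux j) (N j) = 0%E).
Hypothesis cover : forall x, F x = y ->
  (exists2 i, (i < n)%N & lc_image (base i) x) \/ exists j, N j x.

(** Applied twice: to the measure of a single chart, for the existence of the Leray measure, and to
    an arbitrary Leray measure, for the volume of the fiber. *)
Lemma atlas_sum (nu : {measure set 'rV[R]_m -> \bar R}) A : measurable A ->
  nu (~` (F @^-1` [set y]) `&` A) = 0%E -> (forall j, nu (N j `&` A) = 0%E) ->
  nu A = (\sum_(i < n) nu (lc_image (base i) `&` A))%E.
Proof.
move=> mA A0 AN.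
have mfib := C1_fiber_measurable FC FV.
pose G i := lc_image (base i) `&` A.
pose B := \big[setU/set0]_(i < n) G i.
have BE : B = \bigcup_(i in `I_n) G i by rewrite bigcup_mkord.
have mi i : measurable (G i).
  by apply: measurableI => //; exact: lc_image_measurable.
have mB : measurable B by apply: bigsetU_measurable.
have BA : B `<=` A by rewrite BE => x [i _ []].
have sumB : nu B = (\sum_(i < n) nu (G i))%E.
  rewrite /B measure_bigsetU_ord//; apply/trivIsetP => i j _ _ ij.
  by rewrite setIACA base_disj ?set0I.
rewrite -sumB; apply/eqP; rewrite eq_le; apply/andP; split;
  last by apply: le_measure; rewrite ?in_setE.
pose Z := (~` (F @^-1` [set y]) `&` A) `|` \big[setU/set0]_(j <- index_enum J) (N j `&` A).
have mZ : measurable Z.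
  apply: measurableU; first by apply: measurableI => //; exact: measurableC.
  by apply: bigsetU_measurable => j _; exact: measurableI.
have ABZ : A `<=` B `|` Z.
  move=> x Ax; have [Fx|Fx] := pselect (F x = y); last by right; left.
  have [[i lti ix]|[j Njx]] := cover Fx.
    by left; rewrite BE; exists i.
  by right; right; rewrite -bigcup_seq; exists j => //=; rewrite mem_index_enum.
have Z0 : nu Z = 0%E.
  rewrite /Z measureU0//.
  - by apply: measurableI => //; exact: measurableC.
  - by apply: bigsetU_measurable => j _; exact: measurableI.
  - by apply: null_bigsetU => j; [exact: measurableI|exact: AN].
have -> : nu B = nu (B `|` Z) by rewrite measureU0.
by apply: le_measure; rewrite ?in_setE//; exact: measurableU.
Qed.

Definition atlas_measure : {measure set 'rV[R]_m -> \bar R} :=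
  msum (fun i => lc_measure (base i)) n.

Lemma atlas_measureE A : atlas_measure A = (\sum_(i < n) lc_measure (base i) A)%E.
Proof. by []. Qed.

Lemma lc_measure_sum c A : measurable A -> A `<=` lc_image c ->
  lc_measure c A = atlas_measure A.
Proof.
move=> mA Ac; rewrite (atlas_sum mA).
- rewrite atlas_measureE; apply: eq_bigr => i _.
  rewrite (@lc_measure_agree c (base i)).
  + by apply: lc_measure_ext => z /lc_point_image[? _]; split => [[]|].
  + by apply: measurableI => //; exact: lc_image_measurable.
  + by move=> x [_ /Ac].
  + by move=> x [].
- rewrite (lc_measure_ext (B := set0)) ?measure0// => z /lc_point_image[_ Fz].
  by split => // -[h _]; apply: h.
(* N j is known to be null only in its own chart aux j. The part of it inside A lies in the images
   of both charts, so their agreement transfers the nullity to c. *)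
move=> j; rewrite (@lc_measure_agree c (aux j)).
- apply/eqP; rewrite eq_le measure_ge0 andbT -(N0 j); apply: le_measure; rewrite ?in_setE//.
  exact: measurableI.
- exact: measurableI.
- by move=> x [_ /Ac].
- by move=> x [/Nsub].
Qed.

Lemma atlas_is_leray : regular_value F y -> is_leray_measure F y atlas_measure.
Proof.
move=> rF; split => //.
  by rewrite atlas_measureE big1// => i _; exact: lc_measure_fiberC.
move=> k' e' W psi U s.
(* The definition quantifies over the dimension of the chart, but m and d determine it. *)
have kk : k' = k by apply/eqP; rewrite -(eqn_add2r d) e e'.
subst k'; rewrite (eq_irrelevance e' e) => c A mA Ac.
by rewrite -(@lc_measure_sum (LChart c) A).
Qed.

Lemma leray_measure_fiber (mu : {measure set 'rV[R]_m -> \bar R}) : is_leray_measure F y mu ->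
  mu (F @^-1` [set y]) =
  (\sum_(i < n) \int[lebesgue_rV k]_(z in lc_U (base i)) (lc_density (base i) z)%:E)%E.
Proof.
move=> [_ mu0 muE].
have muc c A : measurable A -> A `<=` lc_image c -> mu A = lc_measure c A.
  by move=> mA Ac; rewrite (muE _ e _ _ _ _ (lc_coords c)).
have mfib := C1_fiber_measurable FC FV.
rewrite (atlas_sum mfib).
- apply: eq_bigr => i _; rewrite (muc (base i)).
  + rewrite lc_measureE; congr (integral _ _ _); apply/seteqP; split => [z []//|z Uz].
    by have [h1 h2] := lc_point_image Uz.
  + by apply: measurableI => //; exact: lc_image_measurable.
  + by move=> x [].
- by rewrite setICl measure0.
move=> j; apply/eqP; rewrite eq_le measure_ge0 andbT -(N0 j) -(muc (aux j))//.
by apply: le_measure; rewrite ?in_setE//; exact: measurableI.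
Qed.

End atlas.

Section null_sets.
Context {R : realType}.

Lemma hyperplane_null n (i : 'I_n) :
  measurable [set v : 'rV[R]_n | v ord0 i = 0] /\
  lebesgue_rV n [set v : 'rV[R]_n | v ord0 i = 0] = 0%E.
Proof.
pose A (j : 'I_n) : set (measurableTypeR R) := if j == i then [set 0] else setT.
have mA j : measurable (A j) by rewrite /A; case: ifP => // _; exact: measurable_set1.
have -> : [set v : 'rV[R]_n | v ord0 i = 0] = [set v | forall j, A j (v ord0 j)].
  apply/seteqP; split => v /= vi.
    by move=> j; rewrite /A; case: eqP => [->|].
  by have := vi i; rewrite /A eqxx.
split; first exact: measurable_box.
rewrite lebesgue_rV_box// (bigD1 i)//= {1}/A eqxx lebesgue_measure_set1.
exact: mul0e.
Qed.

Lemma measurable_zero_in n (O : set 'rV[R]_n) (f : 'rV[R]_n -> R) :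
  open O -> (forall x, O x -> {for x, continuous f}) ->
  measurable (O `&` [set x | f x = 0]).
Proof.
move=> oO fc.
have o : open (O `&` f @^-1` [set t | t != 0]).
  by apply: open_preimage_in => //; exact: open_neq.
have -> : O `&` [set x | f x = 0] = O `\` (O `&` f @^-1` [set t | t != 0]).
  apply/seteqP; split => x [Ox] /=.
    by move=> fx; split => // -[_]; rewrite /preimage /= fx eqxx.
  move=> h; split => //; apply/eqP; apply: contrapT => /negP fx; apply: h; split => //.
by apply: measurableD; exact: open_measurable_rV.
Qed.

End null_sets.

(** * Covering the fiber by signed transpositions of the axes *)

Section signed_transposition.
Context {R : realType} (n : nat).
Implicit Types (i : 'I_(n + 1)) (s : bool) (v : 'rV[R]_(n + 1)).

Definition last_ord : 'I_(n + 1) := rshift n ord0.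

(** An orthogonal and symmetric matrix that brings the i-th coordinate, up to sign, to the last
    place: the hemisphere around any signed axis becomes the one around the last axis. *)
Definition signed_tperm i s : 'M[R]_(n + 1) := (-1) ^+ s *: tperm_mx i last_ord.

Lemma signed_tperm_tr i s : (signed_tperm i s)^T = signed_tperm i s.
Proof. by rewrite /signed_tperm linearZ /= tr_tperm_mx. Qed.

Lemma signed_tperm_orthogonal i s : signed_tperm i s *m (signed_tperm i s)^T = 1%:M.
Proof.
rewrite signed_tperm_tr /signed_tperm -scalemxAl -scalemxAr scalerA -expr2 sqrr_sign scale1r.
by rewrite /tperm_mx -perm_mxM tperm2 perm_mx1.
Qed.

Lemma last_coord_signed_tperm i s v : last_coord (v *m signed_tperm i s) = (-1) ^+ s * v ord0 i.
Proof.
rewrite /last_coord /signed_tperm -scalemxAr mxE; congr (_ * _).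
by rewrite -xcolE mxE tpermR.
Qed.

(** The last axis is taken whenever possible, so that another axis is used only where the last
    coordinate vanishes: such points form the negligible part of the fiber. *)
Lemma sign_choice v : v != 0 -> exists i s,
  0 < (-1) ^+ s * v ord0 i /\ (i != last_ord -> last_coord v = 0).
Proof.
move=> v0; have [vl|vl] := eqVneq (last_coord v) 0.
  have /existsP[i vi] : [exists i, v ord0 i != 0].
    apply: contraNT v0; rewrite negb_exists => /forallP h; apply/eqP/rowP => i; rewrite mxE.
    by have := h i; rewrite negbK => /eqP.
  by exists i, (v ord0 i < 0); split => //; rewrite -normrEsign normr_gt0.
exists last_ord, (last_coord v < 0); split; last by rewrite eqxx.
by rewrite -/(last_coord v) -normrEsign normr_gt0.
Qed.

End signed_transposition.

Lemma last_axis_only (R : realType) d (z : 'rV[R]_(d + 1)) :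
  lsubmx z = 0 -> z = last_coord z *: last_axis d.
Proof.
move=> z0; apply/rowP => i; rewrite [RHS]mxE /last_axis; have [i' ->|i' ->] := split_ordP i.
  by rewrite row_mxEl [X in _ * X]mxE mulr0; have /rowP/(_ i') := z0; rewrite !mxE.
by rewrite row_mxEr [X in _ * X]mxE (ord1 i') eqxx mulr1.
Qed.

Lemma straightened_bipolar (R : realType) l (A : 'M[R]_(l + 1 + 1)) (B : 'M[R]_(l + 1)) w :
  A *m A^T = 1%:M -> polar_domain w ->
  lsubmx (straightened A (bipolar A B w)) = polar_t 2 w *: hemisphere 1 (polar_y w) *m B.
Proof.
move=> AA Dw; have [r1 _] := polar_in_range Dw.
have key N (v : 'rV[R]_((l + 1 + 1) + (l + 1 + 1))) : upper (lsubmx v) ->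
    straightened A (straighten N A v) = rsubmx v *m N.
  move=> vu; rewrite /straightened /straighten row_mxKl row_mxKr -!mulmxA AA mulmx1.
  by rewrite (mulmxA A) AA mul1mx (mirrorK vu) mulmx1.
by rewrite /bipolar key// polarE row_mxKr mul_row_block !mulmx0 addr0 row_mxKl.
Qed.

Section triangle_fiber.
Context {R : realType} (l : nat).
Let n := (l + 1 + 1)%N.
Variables (r p q : R).
Hypotheses (r0 : 0 < r) (q0 : 0 < q).

Let F := @length_map R n.
Let tau := tri_lengths r p q.

Lemma fiber_length_domain : F @^-1` [set tau] `<=` @length_domain R n.
Proof.
move=> x Fx; have [t1 t2] := tri_lengths_gt0 r p q0.
have E i : length_map x ord0 i = tau ord0 i by rewrite [length_map x]Fx.
have := E 0; have := E 1; have := E 2; rewrite !mxE /= => e2 e1 e0.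
move: t1 t2; rewrite !mxE /= => t1 t2.
by split; rewrite -enorm_gt0 ?e0 ?e1 ?e2.
Qed.

Let dims : (l + 1 + l + 3 = n + n)%N. Proof. by rewrite /n; lia. Qed.

Definition chart_index := ('I_(l + 1 + 1) * bool * ('I_(l + 1) * bool))%type.

Definition index_A (j : chart_index) : 'M[R]_(l + 1 + 1) := signed_tperm j.1.1 j.1.2.
Definition index_B (j : chart_index) : 'M[R]_(l + 1) := signed_tperm j.2.1 j.2.2.

Let AA j : index_A j *m (index_A j)^T = 1%:M. Proof. exact: signed_tperm_orthogonal. Qed.
Let BB j : index_B j *m (index_B j)^T = 1%:M. Proof. exact: signed_tperm_orthogonal. Qed.

Definition fiber_chart (j : chart_index) : lchart (l + 1 + l) F tau :=
  LChart (bipolar_chart (AA j) (BB j) p r0 q0).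

(** For k < 4 the two bits of k are the two signs, and both axes are the last ones. *)
Definition base_index (k : nat) : chart_index :=
  ((last_ord (l + 1), odd k), (last_ord l, odd k./2)).

Let FC := @C1_on_length_map R n.
Let FV := fiber_length_domain.

Lemma fiber_chart_image j x : lc_image (fiber_chart j) x <->
  0 < (-1) ^+ j.1.2 * lsubmx x ord0 j.1.1 /\
  0 < (-1) ^+ j.2.2 * lsubmx (straightened (index_A j) x) ord0 j.2.1.
Proof.
have := bipolar_image (AA j) (BB j) x.
by rewrite {1 3}/index_A /index_B !signed_tperm_tr /upper /= !last_coord_signed_tperm.
Qed.

Lemma base_disjoint i j : (i < 4)%N -> (j < 4)%N -> i != j ->
  lc_image (fiber_chart (base_index i)) `&` lc_image (fiber_chart (base_index j)) = set0.
Proof.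
move=> i4 j4 ij; apply/seteqP; split => // x [] /fiber_chart_image[a b] /fiber_chart_image[c d].
have sgn (s s' : bool) (y : R) : 0 < (-1) ^+ s * y -> 0 < (-1) ^+ s' * y -> s = s'.
  by case: s s' => -[]//=; rewrite ?expr1 ?expr0 ?mul1r ?mulN1r ?oppr_gt0 => h1 h2;
    have := lt_trans h1 h2; rewrite ltxx.
have e1 : odd i = odd j by exact: sgn a c.
have eA : index_A (base_index i) = index_A (base_index j) by rewrite /index_A /base_index /= e1.
rewrite eA in b.
have e2 : odd i./2 = odd j./2 by exact: sgn b d.
move: ij e1 e2 i4 j4; clear.
by case: i => [|[|[|[|]]]]//; case: j => [|[|[|[|]]]].
Qed.

(** Nondegeneracy of the triangle: if zeta were c e on the last axis, the lengths would force c = p,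
    then q = 0. *)
Lemma straightened_eq0 A x : A *m A^T = 1%:M -> upper (lsubmx x *m A^T) -> F x = tau ->
  lsubmx (straightened A x) != 0.
Proof.
move=> A1 u Fx; apply/eqP => z0.
pose y := row_mx (lsubmx x *m A^T) (straightened A x).
have Dy : upper_domain y by rewrite /upper_domain /= /y row_mxKl.
have xE : x = straighten 1%:M A y.
  rewrite /straighten /y row_mxKl row_mxKr mulmx1 /straightened.
  rewrite -(mulmxA _ (mirror _) (mirror _)) (mirrorK u) mulmx1 -!mulmxA (orthogonal_tr A1) !mulmx1.
  by rewrite hsubmxK.
have I1 : (1%:M : 'M[R]_(l + 1 + 1)) *m 1%:M^T = 1%:M by rewrite trmx1 mulmx1.
have := length_map_straighten I1 A1 Dy; rewrite -xE -/F Fx => /rowP E.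
have := E 0; have := E 1; have := E 2; rewrite !mxE /= /y row_mxKl row_mxKr mulmx1.
move=> e2 e1 e0; rewrite -e0 (last_axis_only z0) -scalerBl in e2; rewrite (last_axis_only z0) in e1.
move: e1 e2; rewrite !enormZ enorm_last_axis !mulr1; move: (last_coord _) => c e1 e2.
move: (congr1 (fun t => t ^+ 2) e1) (congr1 (fun t => t ^+ 2) e2).
rewrite !sqr_sqrtr ?addr_ge0 ?sqr_ge0// !real_normK ?num_real// => h1 h2.
have rn : r != 0 by rewrite gt_eqF.
have cp : c = p by apply: (mulfI rn); lra.
have : q ^+ 2 = 0 by rewrite cp in h1; lra.
by move/eqP; rewrite sqrf_eq0 gt_eqF.
Qed.

(* The points that no base chart covers, cut out in the chart j by the vanishing
   of one coordinate. *)
Definition fiber_null (j : chart_index) : set 'rV[R]_(n + n) :=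
  if j.1.1 != last_ord (l + 1) then
    lc_image (fiber_chart j) `&` [set x | last_coord (lsubmx x) = 0]
  else if j.2.1 != last_ord l then
    lc_image (fiber_chart j) `&` [set x | last_coord (lsubmx (straightened (index_A j) x)) = 0]
  else set0.

Lemma fiber_cover x : F x = tau ->
  (exists2 i, (i < 4)%N & lc_image (fiber_chart (base_index i)) x) \/ exists j, fiber_null j x.
Proof.
move=> Fx; have [x0 _ _] := fiber_length_domain Fx.
have [i [s [si il]]] := sign_choice x0.
have u : upper (lsubmx x *m (signed_tperm i s)^T).
  by rewrite signed_tperm_tr /upper /= last_coord_signed_tperm.
have [i' [s' [si' il']]] := sign_choice (straightened_eq0 (signed_tperm_orthogonal i s) u Fx).
pose j : chart_index := ((i, s), (i', s')).
have jx : lc_image (fiber_chart j) x by apply/fiber_chart_image.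
have [ei|ni] := eqVneq i (last_ord (l + 1)); last first.
  by right; exists j; rewrite /fiber_null /= ni; split => //; exact: il.
have [ei'|ni'] := eqVneq i' (last_ord l); last first.
  by right; exists j; rewrite /fiber_null /= ei eqxx /= ni'; split => //; exact: il'.
left; exists (s + s'.*2)%N; first by case: (s); case: (s').
have -> : base_index (s + s'.*2) = j; last exact: jx.
by rewrite /j /base_index ei ei'; case: (s); case: (s').
Qed.

Lemma fiber_null_sub j : fiber_null j `<=` lc_image (fiber_chart j).
Proof. by rewrite /fiber_null => x; case: ifP => _; [case|case: ifP => // _ []]. Qed.

Let upper_open (A : 'M[R]_(l + 1 + 1)) :
  open [set x : 'rV[R]_(n + n) | upper (lsubmx x *m A^T)].
Proof.
have o : open (@upper R (l + 1)).
  by apply: (open_comp (f := fun u : 'rV[R]_(l + 1 + 1) => last_coord u) _ (@open_gt _ 0)) => u _;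
    exact: continuous_entry.
apply: (open_linear_preimage (M := col_mx 1%:M 0 *m A^T) _ o) => v.
by rewrite mulmxA -lsubmx_linear.
Qed.

Lemma straightened_coord_continuous (A : 'M[R]_(l + 1 + 1)) (x : 'rV[R]_(n + n)) :
  upper (lsubmx x *m A^T) ->
  {for x, continuous (fun x : 'rV[R]_(n + n) => last_coord (lsubmx (straightened A x)))}.
Proof.
move=> u.
pose L x := row_mx (lsubmx x *m A^T) (rsubmx x *m A^T) : 'rV[R]_(n + n).
have LC : C1_on [set: 'rV[R]_(n + n)] L.
  apply: C1_on_row_mx; apply: C1_on_mulmxr.
    exact: (C1_on_lin openT (@lsubmx_linear R n n)).
  exact: (C1_on_lin openT (@rsubmx_linear R n n)).
have -> : (fun x : 'rV[R]_(n + n) => last_coord (lsubmx (straightened A x))) =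
    (fun x => (straighten 1%:M 1%:M \o L) x ord0 (rshift n (lshift 1 (last_ord l)))).
  apply/funext => z; rewrite /= /straighten row_mxEr mulmx1 mulmx1 /L row_mxKl row_mxKr.
  by rewrite /last_coord mxE.
apply: continuous_coord; apply: continuous_comp; first exact: (C1_on_continuous LC I).
by apply: (C1_on_continuous (C1_on_straighten _ _)); rewrite /upper_domain /= /L row_mxKl.
Qed.

Lemma fiber_null_measurable j : measurable (fiber_null j).
Proof.
have mi : measurable (lc_image (fiber_chart j)) := lc_image_measurable dims FC FV _.
rewrite /fiber_null; case: ifP => _; last (case: ifP => // _).
  apply: measurableI => //.
  have -> : [set x : 'rV[R]_(n + n) | last_coord (lsubmx x) = 0] =
     [set x | x ord0 (lshift n (last_ord (l + 1))) = 0].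
    by apply/seteqP; split => x; rewrite /= /last_coord mxE.
  by have [] := @hyperplane_null R (n + n) (lshift n (last_ord (l + 1))).
(* Continuity of [straightened] is available only where the first vector is in the upper half-space;
   the condition is inserted here at no cost since it holds on the image of the chart. *)
have -> : lc_image (fiber_chart j) `&`
    [set x | last_coord (lsubmx (straightened (index_A j) x)) = 0] =
  lc_image (fiber_chart j) `&` ([set x : 'rV[R]_(n + n) | upper (lsubmx x *m (index_A j)^T)] `&`
     [set x | last_coord (lsubmx (straightened (index_A j) x)) = 0]).
  apply/seteqP; split => x [jx]; last by move=> [_ h]; split.
  by move=> h; split => //; split => //; have [] := (bipolar_image (AA j) (BB j) x).1 jx.
apply: measurableI => //; apply: measurable_zero_in; first exact: upper_open.
by move=> x; exact: straightened_coord_continuous.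
Qed.

(** In chart j the coordinate that vanishes on [fiber_null j] is, up to sign, r or q times a
    coordinate of one of the two balls, because the chosen axis is not the last one. The parameters
    thus lie in a coordinate hyperplane. *)
Lemma fiber_null0 j : lc_measure dims FC FV (fiber_chart j) (fiber_null j) = 0%E.
Proof.
have key (i : 'I_(l + 1 + l)) : (forall z, @ball_pair R l z ->
    fiber_null j (bipolar (index_A j) (index_B j) (row_mx z (tri_coords r p q))) -> z ord0 i = 0) ->
    lc_measure dims FC FV (fiber_chart j) (fiber_null j) = 0%E.
  move=> h; have [mH H0] := @hyperplane_null R _ i.
  apply: (@lc_measure_null _ _ _ _ dims _ _ _ FC FV (fiber_chart j) _ _
    (fiber_null_measurable j) mH H0).
  exact: h.
have sgn0 (s : bool) (a b : R) : 0 < a -> a * ((-1) ^+ s * b) = 0 -> b = 0.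
  move=> a0 /eqP; rewrite mulf_eq0 gt_eqF//= mulf_eq0 signr_eq0 => /eqP; exact.
have [ei|ni] := eqVneq j.1.1 (last_ord (l + 1)); last first.
  have [i' ei|i' ei] := split_ordP j.1.1; last by case/eqP: ni; rewrite ei (ord1 i').
  apply: (key (lshift l i')) => z Uz; rewrite /fiber_null ni => -[_] /=.
  rewrite /bipolar /straighten row_mxKl polarE row_mxKl -scalemxAl.
  have [xE yE tE] := polar_coords_row z (tri_coords r p q).
  rewrite {1}/last_coord mxE -/(last_coord _) last_coord_signed_tperm ei tE xE.
  rewrite [tri_coords _ _ _ _ _]mxE /= => /(sgn0 _ _ _ r0).
  by rewrite row_mxEl mxE.
have [ei'|ni'] := eqVneq j.2.1 (last_ord l); last first.
  have [i' ei'|i' ei'] := split_ordP j.2.1; last by case/eqP: ni'; rewrite ei' (ord1 i').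
  apply: (key (rshift (l + 1) i')) => z Uz; rewrite /fiber_null ei eqxx ni' => -[_] /=.
  rewrite (straightened_bipolar (index_B j) (AA j) (ball_pair_domain p r0 q0 Uz)) -scalemxAl.
  have [xE yE tE] := polar_coords_row z (tri_coords r p q).
  rewrite {1}/last_coord mxE -/(last_coord _) last_coord_signed_tperm ei' tE yE.
  rewrite [tri_coords _ _ _ _ _]mxE /= => /(sgn0 _ _ _ q0).
  by rewrite row_mxEl mxE.
have -> : fiber_null j = set0 by rewrite /fiber_null ei ei' !eqxx.
exact: measure0.
Qed.

Theorem fiber_leray : regular_value F tau /\
  (exists mu : {measure set 'rV[R]_(n + n) -> \bar R}, is_leray_measure F tau mu) /\
  (forall mu : {measure set 'rV[R]_(n + n) -> \bar R}, is_leray_measure F tau mu ->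
     mu (F @^-1` [set tau]) =
     (\sum_(i < 4) \int[lebesgue_rV (l + 1 + l)]_(z in @ball_pair R l)
       ((r * tau ord0 1 * tau ord0 2 * (r * q) ^ (l%:Z - 1)) *
        ((height (lsubmx z))^-1 * (height (rsubmx z))^-1))%:E)%E).
Proof.
have rF : regular_value F tau.
  split; first by exists (@length_domain R n); [exact: FC|exact: FV].
  move=> x Fx.
  have rk j : lc_image (fiber_chart j) x -> \rank (jacobian F x) = 3%N.
    move=> [w Ww wx].
    have [_ _ _ h] := leray_chart_facts dims FC FV (bipolar_chart (AA j) (BB j) p r0 q0).
    have [z Uz zw] : [set row_mx z (tri_coords r p q) | z in @ball_pair R l] w.
      by rewrite -(bipolar_fiber (AA j) (BB j) p r0 q0); split => //=; rewrite -wx in Fx.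
    by have [_ _] := h z Uz; rewrite zw -wx.
  have [[i _ /rk]|[j /fiber_null_sub /rk]] := fiber_cover Fx; exact.
split; [exact: rF|split].
  exists (atlas_measure dims FC FV 4 (fun i => fiber_chart (base_index i))).
  exact: (atlas_is_leray base_disjoint fiber_null_measurable fiber_null_sub fiber_null0
    fiber_cover rF).
move=> mu muL.
rewrite (leray_measure_fiber base_disjoint fiber_null_measurable fiber_null_sub fiber_null0
  fiber_cover muL).
apply: eq_bigr => i _; apply: eq_integral => z; rewrite in_setE => Uz; congr (_%:E).
exact: (bipolar_density (AA _) (BB _) p r0 q0 dims Uz).
Qed.

End triangle_fiber.

(** * Evaluation *)

Section product_integral.
Context {R : realType} (a b : nat).

Definition rV_cat (z : 'rV[R]_a * 'rV[R]_b) : 'rV[R]_(a + b) := row_mx z.1 z.2.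

Lemma measurable_rV_cat : measurable_fun setT rV_cat.
Proof.
apply: measurable_fun_rVP => i; have [j ->|j ->] := split_ordP i.
  have -> : rV_coord (lshift b j) \o rV_cat = rV_coord j \o fst.
    by apply/funext => z; rewrite /= /rV_coord /rV_cat row_mxEl.
  by apply: measurableT_comp; [exact: measurable_rV_coord|exact: measurable_fst].
have -> : rV_coord (rshift a j) \o rV_cat = rV_coord j \o snd.
  by apply/funext => z; rewrite /= /rV_coord /rV_cat row_mxEr.
by apply: measurableT_comp; [exact: measurable_rV_coord|exact: measurable_snd].
Qed.

Lemma lebesgue_rV_cat A : measurable A ->
  lebesgue_rV (a + b) A = pushforward (lebesgue_rV a \x lebesgue_rV b)%E rV_cat A.
Proof.
pose m : {measure set 'rV[R]_(a + b) -> \bar R} :=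
  measure_function_pushforward__canonical__measure_function_Measure
    (lebesgue_rV a \x lebesgue_rV b)%E measurable_rV_cat.
apply: (lebesgue_rV_unique (m := m)) => B mB.
rewrite big_split_ord /= -!lebesgue_rV_box//.
have m1 := measurable_box (fun i => mB (lshift b i)).
have m2 := measurable_box (fun i => mB (rshift a i)).
rewrite -[RHS](product_measure1E _ _ m1 m2) /pushforward; congr (_ _).
apply/seteqP; split => z /= zB.
  by split => i;
    [have := zB (lshift b i); rewrite row_mxEl|have := zB (rshift a i); rewrite row_mxEr].
by move=> i; have [j ->|j ->] := split_ordP i; rewrite ?row_mxEl ?row_mxEr; apply zB.
Qed.

Lemma measurable_lsubmx : measurable_fun setT (@lsubmx R 1 a b).
Proof.
apply: measurable_fun_rVP => i; rewrite (_ : _ \o _ = rV_coord (lshift b i)).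
  exact: measurable_rV_coord.
by apply/funext => z; rewrite /= /rV_coord mxE.
Qed.

Lemma measurable_rsubmx : measurable_fun setT (@rsubmx R 1 a b).
Proof.
apply: measurable_fun_rVP => i; rewrite (_ : _ \o _ = rV_coord (rshift a i)).
  exact: measurable_rV_coord.
by apply/funext => z; rewrite /= /rV_coord mxE.
Qed.

Lemma integral_rV_product (D1 : set 'rV[R]_a) (D2 : set 'rV[R]_b) 
    (f : 'rV[R]_a -> R) (g : 'rV[R]_b -> R) :
  measurable D1 -> measurable D2 -> measurable_fun D1 f -> measurable_fun D2 g ->
  (forall x, 0 <= f x) -> (forall x, 0 <= g x) ->
  (\int[lebesgue_rV (a + b)]_(z in [set z | D1 (lsubmx z) /\ D2 (rsubmx z)])
     (f (lsubmx z) * g (rsubmx z))%:E =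
  (\int[lebesgue_rV a]_(x in D1) (f x)%:E) * \int[lebesgue_rV b]_(y in D2) (g y)%:E)%E.
Proof.
move=> mD1 mD2 mf mg f0 g0.
(* Extension by 0 makes both factors measurable on the whole space, as Tonelli requires. *)
pose f' := (EFin \o f) \_ D1; pose g' := (EFin \o g) \_ D2.
have mf' : measurable_fun setT f'.
  by apply/(measurable_restrictT _ _).1 => //; exact/measurable_EFinP.
have mg' : measurable_fun setT g'.
  by apply/(measurable_restrictT _ _).1 => //; exact/measurable_EFinP.
have f'0 x : (0 <= f' x)%E by rewrite /f' patchE; case: ifP => // _; rewrite lee_fin.
have g'0 x : (0 <= g' x)%E by rewrite /g' patchE; case: ifP => // _; rewrite lee_fin.
pose h z := (f' (lsubmx z) * g' (rsubmx z))%E.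
have mh : measurable_fun setT h.
  apply: emeasurable_funM.
    by apply: measurableT_comp mf' _; exact: measurable_lsubmx.
  by apply: measurableT_comp mg' _; exact: measurable_rsubmx.
have h0 z : (0 <= h z)%E by rewrite mule_ge0.
rewrite integral_mkcond.
have -> : ((fun z : 'rV[R]_(a + b) => (f (lsubmx z) * g (rsubmx z))%:E) \_
    [set z | D1 (lsubmx z) /\ D2 (rsubmx z)]) = h.
  apply/funext => z; rewrite /h /f' /g' !patchE.
  have [d1|d1] := pselect (D1 (lsubmx z)); have [d2|d2] := pselect (D2 (rsubmx z)).
  - by rewrite !mem_set.
  - by rewrite (mem_set d1) !memNset ?mule0// => -[].
  - by rewrite (mem_set d2) !memNset ?mul0e// => -[].
  - by rewrite !memNset ?mul0e// => -[].
rewrite (@eq_measure_integral _ _ _ _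
  (measure_function_pushforward__canonical__measure_function_Measure
    (lebesgue_rV a \x lebesgue_rV b)%E measurable_rV_cat)); last first.
  by move=> A mA _; exact: lebesgue_rV_cat.
rewrite ge0_integral_pushforward//; [|exact: measurable_rV_cat].
rewrite preimage_setT fubini_tonelli1//=; last first.
  by apply: measurableT_comp mh _; exact: measurable_rV_cat.
rewrite [X in _ = (X * _)%E]integral_mkcond [X in _ = (_ * X)%E]integral_mkcond -/f' -/g'.
rewrite -ge0_integralZr//; last first.
  by apply: integral_ge0 => x _.
apply: eq_integral => x _; rewrite /fubini_F -ge0_integralZl//.
by apply: eq_integral => y _; rewrite /h /rV_cat /= row_mxKl row_mxKr.
Qed.

End product_integral.

Lemma ereal_half (R : realType) (t : \bar R) : (0 <= t)%E -> 1%E = (t + t)%E -> t = (2^-1)%:E.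
Proof. by case: t => [t| |]// _; rewrite -EFinD => -[h]; congr (_%:E); lra. Qed.

Lemma col_mx2 (R : realType) (u v : 'rV[R]_2) j :
  (col_mx u v : 'M[R]_2) 0 j = u ord0 j /\ (col_mx u v : 'M[R]_2) 1 j = v ord0 j.
Proof.
split.
  have -> : (0 : 'I_2) = lshift 1 (ord0 : 'I_1) by exact: val_inj.
  by rewrite (@col_mxEu _ 1 1).
have -> : (1 : 'I_2) = rshift 1 (ord0 : 'I_1) by exact: val_inj.
by rewrite (@col_mxEd _ 1 1).
Qed.

(** * Area of a triangle *)

Section triangle_area.
Context {R : realType}.

Definition std_triangle : set 'rV[R]_2 :=
  [set v | [/\ 0 <= v ord0 0, 0 <= v ord0 1 & v ord0 0 + v ord0 1 <= 1]].

Let square : set 'rV[R]_2 := [set v | forall i, `[0, 1]%classic (v ord0 i)].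

Let beyond : set 'rV[R]_2 := [set v | 1 < v ord0 0 + v ord0 1].

Let msquare : measurable square.
Proof. by apply: (measurable_box (A := fun=> `[0, 1]%classic)) => i; exact: measurable_itv. Qed.

Let square_vol : lebesgue_rV 2 square = 1%E.
Proof.
rewrite [LHS](lebesgue_rV_box (A := fun=> `[0, 1]%classic)); last first.
  by move=> i; exact: measurable_itv.
by rewrite big1// => i _; rewrite lebesgue_measure_itv/= lte_fin ltr01 -EFinB subr0.
Qed.

Let mbeyond : measurable beyond.
Proof.
apply: open_measurable_rV.
have c : continuous (fun v : 'rV[R]_2 => v ord0 0 + v ord0 1).
  by move=> v; exact: (continuousD (@continuous_entry R 1 2 ord0 0 v)
    (@continuous_entry R 1 2 ord0 1 v)).
apply: (open_comp (f := fun v : 'rV[R]_2 => v ord0 0 + v ord0 1) _ (@open_gt _ 1)) => v _.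
exact: c.
Qed.

Let I2P (i : 'I_2) : i = 0 \/ i = 1.
Proof. by case: i => -[|[|//]] ?; [left|right]; exact: val_inj. Qed.

Lemma std_triangleE : std_triangle = square `\` beyond.
Proof.
apply/seteqP; split => v.
  move=> [v0 v1 v01]; split; last by rewrite /beyond /= ltNge v01.
  by move=> i; rewrite /= in_itv /=; case: (I2P i) => ->; apply/andP; split => //; lra.
move=> [vs]; rewrite /beyond /= => /negP; rewrite -leNgt => v01.
by have := vs 0; have := vs 1; rewrite /= !in_itv /= => /andP[v1 _] /andP[v0 _].
Qed.

Lemma std_triangle_measurable : measurable std_triangle.
Proof. by rewrite std_triangleE; exact: measurableD. Qed.

Let flip_vol A : measurable A ->
  lebesgue_rV 2 [set v : 'rV[R]_2 | A (const_mx 1 - v)] = lebesgue_rV 2 A.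
Proof.
move=> mA.
have [N dN vN] : exists2 N : 'M[R]_2, \det N = 1 & forall v : 'rV[R]_2, v *m N = - v.
  exists (- 1%:M); last by move=> v; rewrite mulmxN mulmx1.
  by rewrite -scaleN1r detZ det1 mulr1 sqrrN expr1n.
have N0 : \det N != 0 by rewrite dN oner_neq0.
have mA' : measurable [set v : 'rV[R]_2 | A (v + const_mx 1)].
  by rewrite -[X in measurable X]setTI; exact: measurable_addr_rV.
have := lebesgue_rV_mulmx N0 mA'.
rewrite dN normr1 invr1 mul1e (lebesgue_rVD _ mA) => <-.
by congr (lebesgue_rV _ _); apply/seteqP; split => v /=; rewrite vN addrC.
Qed.

(** The point reflection v |-> (1, 1) - v exchanges the part of the unit square beyond the diagonal
    with the triangle deprived of that diagonal. The diagonal is null, so the unit area of the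
    square is twice that of the triangle. *)
Lemma std_triangle_vol : lebesgue_rV 2 std_triangle = (2^-1)%:E.
Proof.
have mT := std_triangle_measurable.
pose diag : set 'rV[R]_2 := [set v | v ord0 0 + v ord0 1 = 1].
have mdiag : measurable diag.
  have -> : diag = setT `&` [set v : 'rV[R]_2 | v ord0 0 + v ord0 1 - 1 = 0].
    apply/seteqP; split => v; rewrite /diag /=; first by move=> ->; rewrite subrr.
    by move=> [_ /eqP]; rewrite subr_eq0 => /eqP.
  apply: measurable_zero_in => [|v _]; first exact: openT.
  have c : {for v, continuous (fun=> - 1 : R)} by exact: cst_continuous.
  exact: (continuousD (continuousD (@continuous_entry R 1 2 ord0 0 v)
    (@continuous_entry R 1 2 ord0 1 v)) c).
have diag0 : lebesgue_rV 2 diag = 0%E.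
  (* A linear map whose first coordinate is v0 + v1 carries the line v0 + v1 = 1 to a translate of a
     coordinate hyperplane. *)
  have [P dP vP] : exists2 P : 'M[R]_2, \det P = - 1 &
      forall v : 'rV[R]_2, (v *m P) ord0 0 = v ord0 0 + v ord0 1.
    exists (\matrix_(i, j) (if (i == 1) && (j == 1) then 0 else 1)).
      by rewrite det_mx2 !mxE /= mulr0 mulr1 sub0r.
    move=> v; rewrite mxE !big_ord_recl big_ord0 !mxE /= !mulr1 addr0.
    by congr (_ + v _ _); exact: val_inj.
  have [mH H0] := @hyperplane_null R 2 0.
  have P0 : \det P != 0 by rewrite dP oppr_eq0 oner_neq0.
  have mH' : measurable [set v : 'rV[R]_2 | [set v : 'rV[R]_2 | v ord0 0 = 0] (v + - const_mx 1)].
    by rewrite -[X in measurable X]setTI; exact: measurable_addr_rV.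
  have := lebesgue_rV_mulmx P0 mH'; rewrite (lebesgue_rVD _ mH) H0 mule0 => <-.
  have e (v : 'rV[R]_2) : (v *m P - const_mx 1) ord0 0 = v ord0 0 + v ord0 1 - 1.
    by rewrite mxE vP !mxE.
  congr (lebesgue_rV _ _); apply/seteqP; split => v; rewrite /diag /= e.
    by move=> ->; rewrite subrr.
  by move=> /eqP; rewrite subr_eq0 => /eqP.
have split1 : lebesgue_rV 2 square =
    (lebesgue_rV 2 std_triangle + lebesgue_rV 2 (square `&` beyond))%E.
  by rewrite std_triangleE; exact: measureDI.
have flip : lebesgue_rV 2 (square `&` beyond) = lebesgue_rV 2 (std_triangle `\` diag).
  rewrite -flip_vol; last exact: measurableI.
  congr (lebesgue_rV _ _); apply/seteqP; split => v.
    move=> [vs]; rewrite /beyond /= !mxE => v01.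
    have := vs 0; have := vs 1; rewrite /= !in_itv /= !mxE => /andP[_ v1] /andP[_ v0].
    by split; [split; lra|rewrite /diag /=; lra].
  move=> [[v0 v1 v01]]; rewrite /diag /= => vd; have {}vd : v ord0 0 + v ord0 1 < 1.
    by rewrite lt_neqAle v01 andbT; apply/eqP.
  split; last by rewrite /beyond /= !mxE; lra.
  by move=> i; rewrite /= in_itv /= !mxE; case: (I2P i) => ->; apply/andP; split; lra.
have split2 : lebesgue_rV 2 (std_triangle `\` diag) = lebesgue_rV 2 std_triangle.
  have d0 : lebesgue_rV 2 (std_triangle `&` diag) = 0%E.
    by apply: (subset_measure0 (measurableI _ _ mT mdiag) mdiag _ diag0) => v [].
  apply/esym; apply: etrans (measureDI _ mT mdiag) _.
  by apply: etrans (congr1 (fun x => _ + x)%E d0) _; exact: adde0.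
move: split1; rewrite square_vol flip split2.
by apply: ereal_half; exact: measure_ge0.
Qed.

(** The barycentric coordinates (1 - v0 - v1, v0, v1) exhibit the triangle as the image of the
    standard one under v |-> v M + a. *)
Lemma triangle_areaE (a b c : 'rV[R]_2) : \det (col_mx (b - a) (c - a) : 'M[R]_2) != 0 ->
  triangle_area a b c = `|\det (col_mx (b - a) (c - a) : 'M[R]_2)| / 2.
Proof.
pose M := (col_mx (b - a) (c - a) : 'M[R]_2); rewrite -/M => M0.
have Mu : M \in unitmx by rewrite unitmxE unitfE.
have mT := std_triangle_measurable.
have vM (v : 'rV[R]_2) : v *m M = v ord0 0 *: (b - a) + v ord0 1 *: (c - a).
  apply/rowP => j; have [e0 e1] := col_mx2 (b - a) (c - a) j.
  rewrite mxE !big_ord_recl big_ord0 addr0 [RHS]mxE [X in _ = X + _]mxE [X in _ = _ + X]mxE -e0 -e1.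
  by congr (_ + v _ _ * M _ _); exact: val_inj.
have TE : triangle a b c = [set x | [set v : 'rV[R]_2 | std_triangle (v *m invmx M)] (x + - a)].
  apply/seteqP; split => x.
    move=> [s [t [u [s0 t0 u0 stu ->]]]] /=.
    pose v : 'rV[R]_2 := \row_i [:: t; u]`_i.
    have -> : s *: a + t *: b + u *: c - a = v *m M.
      rewrite vM !mxE /=; have -> : s = 1 - t - u by lra.
      by apply/rowP => i; rewrite !mxE; ring.
    by rewrite mulmxK// /std_triangle /= !mxE /=; split => //; lra.
  rewrite /=; set v := (x - a) *m invmx M => -[v0 v1 v01].
  have xE : x = v *m M + a by rewrite /v mulmxKV// subrK.
  exists (1 - v ord0 0 - v ord0 1), (v ord0 0), (v ord0 1); split => //; [lra|ring|].
  rewrite xE vM; apply/rowP => i; rewrite !mxE.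
  by move: (v ord0 0) (v ord0 1) => s t; ring.
have mA : measurable [set v : 'rV[R]_2 | std_triangle (v *m invmx M)].
  by rewrite -[X in measurable X]setTI; exact: measurable_mulmxr.
have iM0 : \det (invmx M) != 0 by rewrite det_inv invr_eq0.
rewrite /triangle_area TE lebesgue_rVD// lebesgue_rV_mulmx// std_triangle_vol.
by rewrite det_inv normfV invrK.
Qed.

End triangle_area.

(** With r = |b - a|, the height over this side is q = |det M| / r, so r q is twice the area. The
    relation q^2 + p^2 = |c - b|^2 is Lagrange's identity for b - a and c - b, whose determinant is
    that of b - a and c - a. *)
Lemma triangle_coordinates (R : realType) (a b c : 'rV[R]_2) :
  nondegenerate_triangle a b c -> exists r p q : R,
    [/\ 0 < r, 0 < q, side_lengths a b c = tri_lengths r p q & 2 * triangle_area a b c = r * q].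
Proof.
rewrite /nondegenerate_triangle => Mf.
pose M := (col_mx (b - a) (c - a) : 'M[R]_2).
have M0 : \det M != 0 by rewrite -unitfE -unitmxE -row_free_unit.
have ME : \det M = (b - a) ord0 0 * (c - a) ord0 1 - (b - a) ord0 1 * (c - a) ord0 0.
  rewrite det_mx2.
  by rewrite /M !(col_mx2 (b - a) (c - a) _).1 !(col_mx2 (b - a) (c - a) _).2.
have en2 (v : 'rV[R]_2) : enorm v ^+ 2 = v ord0 0 ^+ 2 + v ord0 1 ^+ 2.
  rewrite enorm_sqr dotE !big_ord_recl big_ord0 addr0 -!expr2.
  by have -> : lift ord0 ord0 = 1 :> 'I_2 by exact: val_inj.
have r0 : 0 < enorm (b - a).
  rewrite enorm_gt0; apply: contraNneq M0 => ba0; rewrite ME ba0 !mxE !mul0r subrr//.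
have rn : enorm (b - a) != 0 by rewrite gt_eqF.
pose r := enorm (b - a).
pose p := - ((b - a) ord0 0 * (c - b) ord0 0 + (b - a) ord0 1 * (c - b) ord0 1) / r.
pose q := `|\det M| / r.
exists r, p, q; split.
- exact: r0.
- by rewrite divr_gt0// normr_gt0.
- have en (v : 'rV[R]_2) t : enorm v ^+ 2 = t -> enorm v = Num.sqrt t.
    by move=> <-; rewrite sqrtr_sqr ger0_norm// enorm_ge0.
  have r2 : r ^+ 2 = (b - a) ord0 0 ^+ 2 + (b - a) ord0 1 ^+ 2 by exact: en2.
  have qp : q ^+ 2 + p ^+ 2 = enorm (c - b) ^+ 2.
    apply: (mulfI (_ : r ^+ 2 != 0)); first by rewrite expf_neq0.
    rewrite /q /p !exprMn !exprVn real_normK ?num_real// -mulrDl mulrCA mulfV ?expf_neq0// mulr1.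
    by rewrite r2 en2 ME !mxE; ring.
  apply/rowP => i; rewrite !mxE; congr nth; congr [:: _; _; _]; apply: en.
    by rewrite qp.
  have -> : q ^+ 2 + (p - r) ^+ 2 = (q ^+ 2 + p ^+ 2) + r ^+ 2 - 2 * (p * r) by ring.
  rewrite qp r2 /p divfK// !en2 !mxE; ring.
by rewrite triangle_areaE// -/M /q; field.
Qed.

Lemma integral_ball_pair (R : realType) l (C : R) : 0 <= C ->
  (\int[lebesgue_rV (l + 1 + l)]_(z in @ball_pair R l)
     (C * ((height (lsubmx z))^-1 * (height (rsubmx z))^-1))%:E =
  C%:E * ((\int[lebesgue_rV (l + 1)]_(x in @unit_ball R (l + 1)) ((height x)^-1)%:E) *
    \int[lebesgue_rV l]_(x in @unit_ball R l) ((height x)^-1)%:E))%E.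
Proof.
move=> C0.
have mh d (t : R) : measurable_fun (@unit_ball R d) (fun x : 'rV[R]_d => t * (height x)^-1).
  apply: continuous_measurable_rV; first exact: unit_ball_open.
  move=> x Bx; apply: continuousM; first exact: cst_continuous.
  by apply: continuousV; [exact: height_pos|exact: continuous_height].
have mh1 d : measurable_fun (@unit_ball R d) (fun x : 'rV[R]_d => (height x)^-1).
  by have := mh d 1; under eq_fun do rewrite mul1r.
have mB d : measurable (@unit_ball R d) by apply: open_measurable_rV; exact: unit_ball_open.
have h0 d (x : 'rV[R]_d) : 0 <= (height x)^-1 by rewrite invr_ge0 sqrtr_ge0.
under eq_integral do rewrite mulrA.
have Ch0 (x : 'rV[R]_(l + 1)) : 0 <= C * (height x)^-1 by rewrite mulr_ge0.
have := integral_rV_product (mB (l + 1)%N) (mB l) (mh _ C) (mh1 _) Ch0 (h0 l).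
rewrite -[ball_pair (l := l)]/[set z | unit_ball (lsubmx z) /\ unit_ball (rsubmx z)] => ->.
rewrite muleA; congr (_ * _)%E.
under eq_integral do rewrite EFinM.
have mE : measurable_fun (@unit_ball R (l + 1)) (EFin \o (fun x : 'rV[R]_(l + 1) => (height x)^-1)).
  by apply/measurable_EFinP; exact: mh1.
by apply: (ge0_integralZl _ (mB _) mE) => // x _; rewrite lee_fin.
Qed.

Theorem proposition1p6 (R : realType) (n : nat) (hn : (2 <= n)%N)
    (tau : 'rV[R]_3) (a b c : 'rV[R]_2)
    (nondegenerate_abc : nondegenerate_triangle a b c)
    (tau_abc : tau = side_lengths a b c) :
  (exists mu : {measure set 'rV[R]_(n + n) -> \bar R},
     is_leray_measure (@length_map R n) tau mu) /\
  (forall mu : {measure set 'rV[R]_(n + n) -> \bar R},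
     is_leray_measure (@length_map R n) tau mu ->
     mu (@length_map R n @^-1` [set tau]) =
     (vol_sphere R (n - 1) * vol_sphere R (n - 2) *
      (\prod_(i < 3) tau ord0 i *
       (2 * triangle_area a b c) ^ (n%:Z - 3))%:E)%E).
Proof.
have [l nE] : exists l, n = (l + 1 + 1)%N by exists n.-2; lia.
have [r [p [q [r0 q0 sE ->]]]] := triangle_coordinates nondegenerate_abc.
rewrite {}tau_abc {}sE; subst n.
have [_ [ex val]] := fiber_leray l p r0 q0.
split; first exact: ex.
move=> mu /val ->.
rewrite addnK (_ : (l + 1 + 1 - 2 = l)%N); last by lia.
have -> : \prod_(i < 3) tri_lengths r p q ord0 i * (r * q) ^ ((l + 1 + 1)%N%:Z - 3) =
    r * tri_lengths r p q ord0 1 * tri_lengths r p q ord0 2 * (r * q) ^ (l%:Z - 1).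
  rewrite (_ : (l + 1 + 1)%N%:Z - 3 = l%:Z - 1); last by lia.
  congr (_ * _); rewrite !big_ord_recl big_ord0 mulr1 mulrA.
  by congr (_ * tri_lengths _ _ _ _ _ * tri_lengths _ _ _ _ _); rewrite ?mxE//; exact: val_inj.
set C := r * _ * _ * _.
have C0 : 0 <= C.
  have [t1 t2] := tri_lengths_gt0 r p q0.
  by rewrite !mulr_ge0 ?exprz_ge0 ?mulr_ge0// ltW.
under eq_bigr do rewrite (integral_ball_pair l C0).
rewrite !vol_sphereE; set X := integral _ _ _; set Y := integral _ _ _.
have X0 : (0 <= X)%E by apply: integral_ge0 => x _; rewrite lee_fin invr_ge0 sqrtr_ge0.
have Y0 : (0 <= Y)%E by apply: integral_ge0 => x _; rewrite lee_fin invr_ge0 sqrtr_ge0.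
have d2 (x : \bar R) : (0 <= x -> 2%:E * x = x + x)%E.
  move=> x0; have -> : (2%:E = 1%:E + 1%:E :> \bar R)%E by rewrite -EFinD.
  by rewrite ge0_muleDl ?mul1e// lee_fin.
(* X and Y are half of the two sphere volumes: the four equal charts add up to 4 C X Y = C (2 X) (2
   Y). *)
rewrite muleACA -EFinM -muleA [RHS]muleC [(X * Y * _)%E]muleC -natrM.
have XY0 : (0 <= C%:E * (X * Y))%E by rewrite !mule_ge0// lee_fin.
rewrite !big_ord_recl big_ord0 adde0 muleC.
have -> : (4%:R = 2 * 2 :> R) by rewrite -natrM.
rewrite muleC in XY0; move: (X * Y * C%:E)%E XY0 => t t0.
by rewrite [RHS]muleC EFinM -muleA d2 ?mule_ge0// d2// addeA.
Qed.
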